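(* Let $\Omega$ be a hyperbolic domain in $\mathbb C$ with $z=0$ as an isolated boundary point and let $\lambda(z)\,|dz|$ be a conformal pseudometric with curvature $\kappa_\lambda\le-4$ on $\Omega$. Let $R:=\operatorname{dist}(0,\partial\Omega\setminus\{0\})$. Then for any $0<r<R$, $$\lambda(z)\le\left(\max_{|\xi|=r}\frac{\lambda(\xi)}{\lambda_\Omega(\xi)}\right)^{C_{r,R}(z)}\cdot\lambda_\Omega(z)\quad\text{ on }\quad 0<|z|<r,$$ where $$C_{r,R}(z)=\frac{\log(r/R)}{\log(|z|/R)}<1.$$
   Context: A hyperbolic domain $\Omega$ in $\mathbb C$ is a non-empty, open, connected subset of $\mathbb C$ such that $\hat{\mathbb C}\setminus\Omega$ contains at least three distinct points, where $\hat{\mathbb C}=\mathbb C\cup\{\infty\}$. Here $\operatorname{dist}$ is Euclidean distance. A conformal pseudometric $\lambda(z)\,|dz|$ on a domain $G\subseteq\mathbb C$ is a continuous function $\lambda:G\to[0,\infty)$; it is assumed throughout to be of class $C^2$ on the open set $G_\lambda=\{z\in G:\lambda(z)>0\}$. Its Gauss curvature is $\kappa_\lambda(z)=-\Delta(\log\lambda)(z)/\lambda(z)^2$ for $z\in G_\lambda$, and ''$\kappa_\lambda\le-4$'' means $\kappa_\lambda(z)\le-4$ for all $z\in G_\lambda$. The hyperbolic metric of the unit disk $\mathbb D$ is $\lambda_{\mathbb D}(z)\,|dz|=|dz|/(1-|z|^2)$ (curvature $-4$). The hyperbolic metric $\lambda_\Omega(z)\,|dz|$ of $\Omega$ is defined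 by $\lambda_\Omega(\pi(z))|\pi'(z)|=\lambda_{\mathbb D}(z)$ for a holomorphic universal covering $\pi:\mathbb D\to\Omega$. *)

(* Defs.v *)
From Stdlib Require Import Reals.
From Coquelicot Require Import Coquelicot.
Open Scope R_scope.

Definition connected (S : C -> Prop) : Prop :=
  forall U V : C -> Prop,
    open U -> open V ->
    (forall z, S z -> U z \/ V z) ->
    (exists z, S z /\ U z) -> (exists z, S z /\ V z) ->
    exists z, S z /\ U z /\ V z.

(* The boundary is taken in the plane, not in the Riemann sphere. *)
Definition boundary (S : C -> Prop) (z : C) : Prop :=
  (forall N : C -> Prop, locally z N -> exists w, N w /\ S w) /\
  (forall N : C -> Prop, locally z N -> exists w, N w /\ ~ S w).

Definition isolated_point (E : C -> Prop) (z : C) : Prop :=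
  E z /\ locally z (fun w => E w -> w = z).

(* The infimum of the empty set is p_infty, so this is 0 if E is empty. *)
Definition dist_set (z : C) (E : C -> Prop) : R :=
  real (Glb_Rbar (fun d => exists w, E w /\ d = Cmod (w - z))).

(* The Riemann sphere is [option C], with [None] the point at infinity. *)
Definition sphere_compl (S : C -> Prop) (p : option C) : Prop :=
  match p with Some z => ~ S z | None => True end.

Definition hyperbolic_domain (Omega : C -> Prop) : Prop :=
  (exists z, Omega z) /\ open Omega /\ connected Omega /\
  exists p q s : option C,
    sphere_compl Omega p /\ sphere_compl Omega q /\ sphere_compl Omega s /\
    p <> q /\ p <> s /\ q <> s.

(* [ex_diff_n f 2 x y] asks for the partial derivatives up to order 2 to exist
   and be continuous at (x, y); required at every point of an open set, this is
   the class C^2 there. *)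
Definition C2_on (U : C -> Prop) (f : C -> R) : Prop :=
  forall z, U z -> ex_diff_n (fun x y => f (x, y)) 2 (fst z) (snd z).

Definition laplacian (f : C -> R) (z : C) : R :=
  partial_derive 2 0 (fun x y => f (x, y)) (fst z) (snd z) +
  partial_derive 0 2 (fun x y => f (x, y)) (fst z) (snd z).

(* Metrics are total functions of which only the values on the domain G are
   constrained; G is always open, so continuity on G is continuity at each of
   its points. *)
Definition positive_set (G : C -> Prop) (lam : C -> R) (z : C) : Prop :=
  G z /\ 0 < lam z.

Definition conformal_pseudometric (G : C -> Prop) (lam : C -> R) : Prop :=
  (forall z, G z -> 0 <= lam z) /\
  (forall z, G z -> continuous lam z) /\
  C2_on (positive_set G lam) lam.

Definition gauss_curvature (lam : C -> R) (z : C) : R :=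
  - laplacian (fun w => ln (lam w)) z / (lam z) ^ 2.

Definition curvature_le (G : C -> Prop) (lam : C -> R) (k : R) : Prop :=
  forall z, positive_set G lam z -> gauss_curvature lam z <= k.

Definition unit_disk (z : C) : Prop := Cmod z < 1.

Definition lambda_disk (z : C) : R := 1 / (1 - Cmod z ^ 2).

Definition holomorphic_on (U : C -> Prop) (f : C -> C) : Prop :=
  forall z, U z -> ex_derive f z.

Definition homeo_onto (V U : C -> Prop) (p : C -> C) : Prop :=
  (forall z, V z -> U (p z) /\ continuous p z) /\
  exists q : C -> C,
    (forall w, U w -> V (q w) /\ continuous q w /\ p (q w) = w) /\
    (forall z, V z -> q (p z) = z).

(* All sets are open, so pointwise continuity is continuity of restrictions. *)
Definition evenly_covered (X : C -> Prop) (p : C -> C) (U : C -> Prop) : Prop :=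
  exists (I : Type) (V : I -> C -> Prop),
    (forall i, open (V i)) /\
    (forall i j z, V i z -> V j z -> i = j) /\
    (forall z, (X z /\ U (p z)) <-> exists i, V i z) /\
    (forall i, homeo_onto (V i) U p).

Definition covering_map (X Y : C -> Prop) (p : C -> C) : Prop :=
  (forall z, X z -> Y (p z) /\ continuous p z) /\
  (forall w, Y w -> exists z, X z /\ p z = w) /\
  (forall w, Y w -> exists U : C -> Prop,
     open U /\ U w /\ (forall u, U u -> Y u) /\ evenly_covered X p U).

(* The disk is simply connected, so every covering by it is universal. *)
Definition holomorphic_universal_covering
    (Omega : C -> Prop) (p : C -> C) : Prop :=
  holomorphic_on unit_disk p /\ covering_map unit_disk Omega p.

(* The equation determines lam on Omega, because p is onto Omega. *)
Definition hyperbolic_metric (Omega : C -> Prop) (lam : C -> R) : Prop :=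
  exists p : C -> C,
    holomorphic_universal_covering Omega p /\
    forall z, unit_disk z -> lam (p z) * Cmod (C_derive p z) = lambda_disk z.

Definition is_max (E : R -> Prop) (M : R) : Prop :=
  E M /\ forall x, E x -> x <= M.

(* Real power of a base x >= 0 with a positive exponent; [Rpower 0 y] is 1 since
   [ln 0] is 0, whereas 0 ^ y must be 0 here. *)
Definition nnpow (x y : R) : R :=
  if Rlt_dec 0 x then Rpower x y else 0.

Definition C_exponent (r R0 : R) (z : C) : R :=
  ln (r / R0) / ln (Cmod z / R0).

(* Main.v *)
Require Import Defs.
From Stdlib Require Import Reals Lra Lia Classical ClassicalEpsilon.
From Coquelicot Require Import Coquelicot.
Open Scope R_scope.

(** Write [L z = ln (R0 / |z|)] and let [lamR z = 1 / (2 |z| L z)] be the hyperbolic metric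
    of the punctured disk of radius [R0] around 0.  This disk is contained in [Omega], since
    it is connected, meets [Omega] and contains no boundary point.

    Two applications of the lemma of Ahlfors ([ahlfors]) give [lam <= lamOmega], so that
    the maximum [M] is at most 1, and [lamOmega <= lamR] near the puncture
    ([metric_le_punctured_disk]).  The rest is a maximum principle ([comparison]).  Put
    [c = ln (1 / M) * ln (R0 / r) >= 0] and [v = c / L], so that [M ^ C = exp (- v)] and the
    claim is [u + v <= 0] for [u = ln (lam / lamOmega)].  This holds on the circle [|z| = r]
    by the choice of [c], and asymptotically at the puncture because [u <= 0] and [v] tends
    to 0.  The curvatures give [Delta u >= 4 lam ^ 2 - 4 lamOmega ^ 2 >= 8 lamOmega ^ 2 u],
    while a computation gives [Delta v = 8 lamR ^ 2 v >= 8 lamOmega ^ 2 v]; hence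
    [Delta (u + v) > 0] where [u + v > 0], and there is no positive maximum.  If [M = 0],
    the bound holds with every small positive number in place of [M].

    Both applications of the maximum principle need Laplacians of functions composed with
    holomorphic maps, and the Laplacian of [lamOmega] itself, which is known only through
    the covering map.  They are computed with pointwise second order expansions ([jet2]),
    for which composition is substitution.  These require that a function that is complex
    differentiable on an open set has a differentiable derivative ([holomorphic_derive]):
    Goursat's theorem for triangles provides local primitives, a primitive satisfies the mean
    value property over circles, and the mean values can be differentiated repeatedly under
    the integral sign. *)

(** * Metric form of the topology and of the derivative in the plane *)

(** Continuity on [C] refers to the product structure of the plane and complex derivatives
    to the structure of a normed field; both are reduced to estimates of the modulus. *)
Lemma locally_Cmod (z : C) (P : C -> Prop) :
  locally z P <-> exists d, 0 < d /\ forall w, Cmod (w - z) < d -> P w.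
Proof.
  rewrite locally_C; split.
  - intros [d Hd]; exists d; split; [apply cond_pos | exact Hd].
  - intros [d [Hd H]]; exists (mkposreal d Hd); exact H.
Qed.

Lemma locally_R (x : R) (P : R -> Prop) :
  locally x P <-> exists d, 0 < d /\ forall y, Rabs (y - x) < d -> P y.
Proof.
  split.
  - intros [d Hd]; exists d; split; [apply cond_pos | exact Hd].
  - intros [d [Hd H]]; exists (mkposreal d Hd); exact H.
Qed.

Lemma open_ball (S : C -> Prop) (z : C) :
  open S -> S z -> exists d, 0 < d /\ forall w, Cmod (w - z) < d -> S w.
Proof. intros HS Hz; apply locally_Cmod, HS, Hz. Qed.

Lemma Cmod_minus_sym (a b : C) : Cmod (a - b) = Cmod (b - a).
Proof. rewrite <- Cmod_opp; f_equal; ring. Qed.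

Lemma Cmod_triangle_minus (a b c : C) : Cmod (a - c) <= Cmod (a - b) + Cmod (b - c).
Proof. replace (a - c)%C with ((a - b) + (b - c))%C by ring; apply Cmod_triangle. Qed.

Lemma Cmod_triangle_rev (a b : C) : Cmod a - Cmod b <= Cmod (a - b).
Proof.
  assert (H := Cmod_triangle (a - b) b).
  replace (a - b + b)%C with a in H by ring; lra.
Qed.

Lemma open_disk (a : C) (r : R) : open (fun w : C => Cmod (w - a) < r).
Proof.
  intros z Hz; apply locally_Cmod; exists (r - Cmod (z - a)); split; [lra|].
  intros w Hw; assert (H := Cmod_triangle_minus w z a); lra.
Qed.

Section Continuity.
Context {T : UniformSpace}.

Lemma continuous_C_iff (f : T -> C) (x : T) :
  continuous f x <-> forall eps, 0 < eps -> locally x (fun y => Cmod (f y - f x) < eps).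
Proof.
  split.
  - intros Hf eps He; apply (Hf (fun w => Cmod (w - f x) < eps)).
    apply locally_Cmod; exists eps; split; auto.
  - intros H P HP; apply locally_Cmod in HP; destruct HP as [d [Hd HP]].
    change (locally x (fun y => P (f y))); generalize (H d Hd); apply filter_imp; intros y Hy; apply HP, Hy.
Qed.

Lemma continuous_R_iff (f : T -> R) (x : T) :
  continuous f x <-> forall eps, 0 < eps -> locally x (fun y => Rabs (f y - f x) < eps).
Proof.
  split.
  - intros Hf eps He; apply (Hf (fun w => Rabs (w - f x) < eps)).
    apply locally_R; exists eps; split; auto.
  - intros H P HP; apply locally_R in HP; destruct HP as [d [Hd HP]].
    change (locally x (fun y => P (f y))); generalize (H d Hd); apply filter_imp; intros y Hy; apply HP, Hy.
Qed.

Lemma continuous_C_pair (f : T -> C) (x : T) :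
  continuous (fun y => fst (f y)) x -> continuous (fun y => snd (f y)) x -> continuous f x.
Proof.
  intros H1 H2; apply continuous_C_iff; intros eps He.
  assert (A1 := proj1 (continuous_R_iff _ _) H1 (eps / 2) ltac:(lra)).
  assert (A2 := proj1 (continuous_R_iff _ _) H2 (eps / 2) ltac:(lra)).
  generalize (filter_and _ _ A1 A2); apply filter_imp; intros y [B1 B2].
  apply Rle_lt_trans with (Rabs (fst (f y) - fst (f x)) + Rabs (snd (f y) - snd (f x))).
  2: lra.
  replace (f y - f x)%C with
    (RtoC (fst (f y) - fst (f x)) + Ci * RtoC (snd (f y) - snd (f x)))%C
    by (destruct (f y), (f x); apply injective_projections; simpl; ring).
  eapply Rle_trans; [apply Cmod_triangle|].
  rewrite Cmod_mult, Cmod_Ci, !Cmod_R; lra.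
Qed.

Lemma continuous_fst_C (f : T -> C) (x : T) :
  continuous f x -> continuous (fun y => fst (f y)) x.
Proof. intros H; apply (continuous_comp f (@fst R R)); [exact H | apply continuous_fst]. Qed.

Lemma continuous_snd_C (f : T -> C) (x : T) :
  continuous f x -> continuous (fun y => snd (f y)) x.
Proof. intros H; apply (continuous_comp f (@snd R R)); [exact H | apply continuous_snd]. Qed.

Lemma continuous_Cplus (f g : T -> C) (x : T) :
  continuous f x -> continuous g x -> continuous (fun y => (f y + g y)%C) x.
Proof.
  intros Hf Hg; apply continuous_C_pair; simpl;
    apply (continuous_plus (V := R_NormedModule));
    (apply continuous_fst_C || apply continuous_snd_C); assumption.
Qed.

Lemma continuous_Cmult (f g : T -> C) (x : T) :
  continuous f x -> continuous g x -> continuous (fun y => (f y * g y)%C) x.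
Proof.
  intros Hf Hg.
  assert (F1 := continuous_fst_C _ _ Hf); assert (F2 := continuous_snd_C _ _ Hf).
  assert (G1 := continuous_fst_C _ _ Hg); assert (G2 := continuous_snd_C _ _ Hg).
  apply continuous_C_pair; simpl.
  - apply (continuous_minus (V := R_NormedModule));
      apply (continuous_mult (K := R_AbsRing)); assumption.
  - apply (continuous_plus (V := R_NormedModule));
      apply (continuous_mult (K := R_AbsRing)); assumption.
Qed.

Lemma continuous_Copp (f : T -> C) (x : T) :
  continuous f x -> continuous (fun y => (- f y)%C) x.
Proof.
  intros Hf; apply continuous_C_pair; simpl; apply (continuous_opp (V := R_NormedModule));
    (apply continuous_fst_C || apply continuous_snd_C); assumption.
Qed.

Lemma continuous_Cminus (f g : T -> C) (x : T) :
  continuous f x -> continuous g x -> continuous (fun y => (f y - g y)%C) x.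
Proof. intros Hf Hg; apply continuous_Cplus; [|apply continuous_Copp]; assumption. Qed.

Lemma continuous_RtoC (f : T -> R) (x : T) :
  continuous f x -> continuous (fun y => RtoC (f y)) x.
Proof. intros Hf; apply continuous_C_pair; simpl; [exact Hf | apply continuous_const]. Qed.

Lemma continuous_Cmod (f : T -> C) (x : T) :
  continuous f x -> continuous (fun y => Cmod (f y)) x.
Proof.
  intros Hf; apply continuous_R_iff; intros eps He.
  generalize (proj1 (continuous_C_iff _ _) Hf eps He); apply filter_imp; intros y Hy.
  assert (H1 := Cmod_triangle_rev (f y) (f x)).
  assert (H2 := Cmod_triangle_rev (f x) (f y)).
  rewrite Cmod_minus_sym in H2; apply Rabs_lt_between; lra.
Qed.

End Continuity.

Lemma continuous_C_eps (f : C -> C) (z : C) :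
  continuous f z <->
  forall eps, 0 < eps ->
    exists d, 0 < d /\ forall w, Cmod (w - z) < d -> Cmod (f w - f z) < eps.
Proof.
  rewrite continuous_C_iff; split; intros H eps He;
    [apply locally_Cmod|apply locally_Cmod]; auto.
Qed.

Lemma continuous_C_R_eps (f : C -> R) (z : C) :
  continuous f z <->
  forall eps, 0 < eps ->
    exists d, 0 < d /\ forall w, Cmod (w - z) < d -> Rabs (f w - f z) < eps.
Proof.
  rewrite continuous_R_iff; split; intros H eps He;
    [apply locally_Cmod|apply locally_Cmod]; auto.
Qed.

Lemma is_derive_C_eps (f : C -> C) (z l : C) :
  is_derive f z l <->
  forall eps, 0 < eps -> exists d, 0 < d /\ forall w, Cmod (w - z) < d ->
    Cmod (f w - f z - (w - z) * l) <= eps * Cmod (w - z).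
Proof.
  split.
  - intros [_ H] eps He.
    destruct (H z (fun P HP => HP) (mkposreal eps He)) as [d Hd].
    exists d; split; [apply cond_pos|]; intros w Hw; apply Hd, Hw.
  - intros H; split; [apply is_linear_scal_l|].
    intros y Hy eps; apply (is_filter_lim_locally_unique (V := AbsRing_NormedModule C_AbsRing)) in Hy; subst y.
    destruct (H eps (cond_pos eps)) as [d [Hd H1]].
    exists (mkposreal d Hd); intros w Hw; apply (H1 w Hw).
Qed.

Lemma norm_C_R (z : C) : norm (K := R_AbsRing) (V := C_R_NormedModule) z = Cmod z.
Proof.
  unfold norm, Cmod; simpl; unfold prod_norm; simpl; unfold norm; simpl; unfold abs; simpl.
  f_equal; rewrite !Rmult_1_r, <- !Rabs_mult, !Rabs_pos_eq; nra.
Qed.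

Lemma scal_C_R (r : R) (z : C) :
  scal (K := R_AbsRing) (V := C_R_NormedModule) r z = (RtoC r * z)%C.
Proof.
  apply injective_projections; simpl; unfold scal; simpl; unfold mult; simpl; ring.
Qed.

Lemma is_derive_curve_eps (f : R -> C) (t : R) (l : C) :
  is_derive (K := R_AbsRing) (V := C_R_NormedModule) f t l <->
  forall eps, 0 < eps -> exists d, 0 < d /\ forall s, Rabs (s - t) < d ->
    Cmod (f s - f t - RtoC (s - t) * l) <= eps * Rabs (s - t).
Proof.
  split.
  - intros [_ H] eps He.
    destruct (H t (fun P HP => HP) (mkposreal eps He)) as [d Hd].
    exists d; split; [apply cond_pos|]; intros w Hw.
    assert (H1 := Hd w Hw); simpl in H1.
    rewrite norm_C_R, scal_C_R in H1; exact H1.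
  - intros H; split; [apply is_linear_scal_l|].
    intros y Hy eps; apply (is_filter_lim_locally_unique (V := AbsRing_NormedModule R_AbsRing)) in Hy; subst y.
    destruct (H eps (cond_pos eps)) as [d [Hd H1]].
    exists (mkposreal d Hd); intros w Hw.
    rewrite norm_C_R, scal_C_R; apply (H1 w Hw).
Qed.

Lemma is_derive_C_continuous (f : C -> C) (z l : C) : is_derive f z l -> continuous f z.
Proof.
  intros H; apply continuous_C_eps; intros eps He.
  destruct (proj1 (is_derive_C_eps _ _ _) H 1 Rlt_0_1) as [d [Hd H1]].
  assert (Hl := Cmod_ge_0 l).
  exists (Rmin d (eps / (Cmod l + 2))); split.
  { apply Rmin_pos; [lra|]; apply Rdiv_lt_0_compat; lra. }
  intros w Hw.
  assert (A1 := H1 w (Rlt_le_trans _ _ _ Hw (Rmin_l _ _))).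
  assert (A2 := Rlt_le_trans _ _ _ Hw (Rmin_r _ _)).
  apply Rlt_div_r in A2; [|lra].
  assert (A3 := Cmod_triangle_rev (f w - f z) ((w - z) * l)).
  rewrite Cmod_mult in A3; assert (A4 := Cmod_ge_0 (w - z)); nra.
Qed.

Lemma is_derive_C_unique (f : C -> C) (z l1 l2 : C) :
  is_derive f z l1 -> is_derive f z l2 -> l1 = l2.
Proof.
  intros H1 H2; rewrite <- (is_C_derive_unique _ _ _ H1); apply is_C_derive_unique, H2.
Qed.

Lemma is_derive_comp_curve (F : C -> C) (g : R -> C) (t : R) (l m : C) :
  is_derive F (g t) l ->
  is_derive (K := R_AbsRing) (V := C_R_NormedModule) g t m ->
  is_derive (K := R_AbsRing) (V := C_R_NormedModule) (fun s => F (g s)) t (m * l)%C.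
Proof.
  intros HF Hg; apply is_derive_curve_eps; intros eps He.
  assert (Hl := Cmod_ge_0 l); assert (Hm := Cmod_ge_0 m).
  set (e1 := eps / (2 * (Cmod m + 1))).
  assert (He1 : 0 < e1) by (apply Rdiv_lt_0_compat; lra).
  set (e2 := Rmin 1 (eps / (2 * (Cmod l + 1)))).
  assert (He2 : 0 < e2) by (apply Rmin_pos; [lra | apply Rdiv_lt_0_compat; lra]).
  destruct (proj1 (is_derive_C_eps _ _ _) HF e1 He1) as [d1 [Hd1 H1]].
  destruct (proj1 (is_derive_curve_eps _ _ _) Hg e2 He2) as [d2 [Hd2 H2]].
  exists (Rmin d2 (d1 / (Cmod m + 1))); split.
  { apply Rmin_pos; [lra | apply Rdiv_lt_0_compat; lra]. }
  intros s Hs.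
  assert (B2 := H2 s (Rlt_le_trans _ _ _ Hs (Rmin_l _ _))).
  assert (Hs2 := Rlt_le_trans _ _ _ Hs (Rmin_r _ _)).
  apply Rlt_div_r in Hs2; [|lra].
  assert (Ha := Rabs_pos (s - t)).
  assert (Hg1 : Cmod (g s - g t) <= (Cmod m + 1) * Rabs (s - t)).
  { assert (B := Cmod_triangle_rev (g s - g t) (RtoC (s - t) * m)).
    rewrite Cmod_mult, Cmod_R in B.
    assert (e2 <= 1) by apply Rmin_l; nra. }
  assert (B1 := H1 (g s) ltac:(lra)).
  replace (F (g s) - F (g t) - RtoC (s - t) * (m * l))%C with
    ((F (g s) - F (g t) - (g s - g t) * l) + (g s - g t - RtoC (s - t) * m) * l)%C by ring.
  eapply Rle_trans; [apply Cmod_triangle|]; rewrite Cmod_mult.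
  assert (E1 : e1 * (Cmod m + 1) = eps / 2) by (unfold e1; field; lra).
  assert (E2 : e2 * Cmod l <= eps / 2).
  { apply Rle_trans with (eps / (2 * (Cmod l + 1)) * (Cmod l + 1)).
    - apply Rmult_le_compat; try lra; apply Rmin_r.
    - right; field; lra. }
  apply Rle_trans with (e1 * ((Cmod m + 1) * Rabs (s - t)) + (e2 * Rabs (s - t)) * Cmod l).
  - apply Rplus_le_compat.
    + eapply Rle_trans; [exact B1|]; apply Rmult_le_compat_l; lra.
    + apply Rmult_le_compat_r; [apply Cmod_ge_0 | exact B2].
  - rewrite <- Rmult_assoc, E1.
    replace (e2 * Rabs (s - t) * Cmod l) with ((e2 * Cmod l) * Rabs (s - t)) by ring; nra.
Qed.

Lemma is_derive_curve_pair (u v : R -> R) (t a b : R) :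
  is_derive u t a -> is_derive v t b ->
  is_derive (K := R_AbsRing) (V := C_R_NormedModule) (fun s => (u s, v s) : C) t ((a, b) : C).
Proof.
  intros Hu Hv; apply is_derive_curve_eps; intros eps He.
  destruct Hu as [_ Hu]; destruct Hv as [_ Hv].
  assert (He2 : 0 < eps / 2) by lra.
  destruct (Hu t (fun P HP => HP) (mkposreal _ He2)) as [d1 H1].
  destruct (Hv t (fun P HP => HP) (mkposreal _ He2)) as [d2 H2].
  exists (Rmin d1 d2); split; [apply Rmin_pos; apply cond_pos|]; intros s Hs.
  assert (A1 := H1 s (Rlt_le_trans _ _ _ Hs (Rmin_l _ _))).
  assert (A2 := H2 s (Rlt_le_trans _ _ _ Hs (Rmin_r _ _))).
  unfold norm, minus, plus, opp, scal in A1, A2; simpl in A1, A2.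
  unfold abs, mult in A1, A2; simpl in A1, A2.
  replace ((u s, v s) - (u t, v t) - RtoC (s - t) * (a, b))%C with
   (RtoC (u s + - u t + - ((s + - t) * a)) + Ci * RtoC (v s + - v t + - ((s + - t) * b)))%C
   by (apply injective_projections; simpl; ring).
  eapply Rle_trans; [apply Cmod_triangle|].
  rewrite Cmod_mult, Cmod_Ci, !Cmod_R; unfold Rminus; lra.
Qed.

Lemma is_derive_Cscal (f : C -> C) (z k l : C) :
  is_derive f z l -> is_derive (fun w => k * f w)%C z (k * l)%C.
Proof.
  intros H; apply is_derive_C_eps; intros eps He; assert (Hk := Cmod_ge_0 k).
  destruct (proj1 (is_derive_C_eps _ _ _) H (eps / (Cmod k + 1))) as [d [Hd H1]].
  { apply Rdiv_lt_0_compat; lra. }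
  exists d; split; [exact Hd|]; intros w Hw; assert (A := H1 w Hw).
  replace (_ - _ - _)%C with (k * (f w - f z - (w - z) * l))%C by ring.
  rewrite Cmod_mult.
  apply Rle_trans with ((Cmod k + 1) * (eps / (Cmod k + 1) * Cmod (w - z))).
  - apply Rmult_le_compat; try apply Cmod_ge_0; lra.
  - right; field; lra.
Qed.

Lemma is_derive_Ccomp (f g : C -> C) (z l m : C) :
  is_derive f (g z) l -> is_derive g z m -> is_derive (fun w => f (g w)) z (m * l)%C.
Proof.
  intros HF Hg; apply is_derive_C_eps; intros eps He.
  assert (Hl := Cmod_ge_0 l); assert (Hm := Cmod_ge_0 m).
  set (e1 := eps / (2 * (Cmod m + 1))).
  assert (He1 : 0 < e1) by (apply Rdiv_lt_0_compat; lra).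
  set (e2 := Rmin 1 (eps / (2 * (Cmod l + 1)))).
  assert (He2 : 0 < e2) by (apply Rmin_pos; [lra | apply Rdiv_lt_0_compat; lra]).
  destruct (proj1 (is_derive_C_eps _ _ _) HF e1 He1) as [d1 [Hd1 H1]].
  destruct (proj1 (is_derive_C_eps _ _ _) Hg e2 He2) as [d2 [Hd2 H2]].
  exists (Rmin d2 (d1 / (Cmod m + 1))); split.
  { apply Rmin_pos; [lra | apply Rdiv_lt_0_compat; lra]. }
  intros s Hs.
  assert (B2 := H2 s (Rlt_le_trans _ _ _ Hs (Rmin_l _ _))).
  assert (Hs2 := Rlt_le_trans _ _ _ Hs (Rmin_r _ _)).
  apply Rlt_div_r in Hs2; [|lra].
  assert (Ha := Cmod_ge_0 (s - z)).
  assert (Hg1 : Cmod (g s - g z) <= (Cmod m + 1) * Cmod (s - z)).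
  { assert (B := Cmod_triangle_rev (g s - g z) ((s - z) * m)).
    rewrite Cmod_mult in B.
    assert (e2 <= 1) by apply Rmin_l; nra. }
  assert (B1 := H1 (g s) ltac:(lra)).
  replace (f (g s) - f (g z) - (s - z) * (m * l))%C with
    ((f (g s) - f (g z) - (g s - g z) * l) + (g s - g z - (s - z) * m) * l)%C by ring.
  eapply Rle_trans; [apply Cmod_triangle|]; rewrite Cmod_mult.
  assert (E1 : e1 * (Cmod m + 1) = eps / 2) by (unfold e1; field; lra).
  assert (E2 : e2 * Cmod l <= eps / 2).
  { apply Rle_trans with (eps / (2 * (Cmod l + 1)) * (Cmod l + 1)).
    - apply Rmult_le_compat; try lra; apply Rmin_r.
    - right; field; lra. }
  apply Rle_trans with (e1 * ((Cmod m + 1) * Cmod (s - z)) + (e2 * Cmod (s - z)) * Cmod l).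
  - apply Rplus_le_compat.
    + eapply Rle_trans; [exact B1|]; apply Rmult_le_compat_l; lra.
    + apply Rmult_le_compat_r; [apply Cmod_ge_0 | exact B2].
  - rewrite <- Rmult_assoc, E1.
    replace (e2 * Cmod (s - z) * Cmod l) with ((e2 * Cmod l) * Cmod (s - z)) by ring; nra.
Qed.

Lemma is_derive_C_ext_loc (f g : C -> C) (z l : C) :
  locally z (fun w => f w = g w) -> is_derive f z l -> is_derive g z l.
Proof.
  intros H; apply (is_derive_ext_loc (K := C_AbsRing) (V := C_NormedModule)).
  apply (proj1 (locally_C z _)), H.
Qed.

(** * Bisection in the plane *)

Lemma C_cauchy_limit (p : nat -> C) (s : nat -> R) :
  (forall m n, (n <= m)%nat -> Cmod (p m - p n) <= s n) ->
  is_lim_seq s 0 ->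
  exists z, forall n, Cmod (p n - z) <= s n.
Proof.
  intros Hp Hs.
  assert (Hc : forall f : C -> R,
    (forall a b, Rabs (f a - f b) <= Cmod (a - b)) ->
    exists l : R, is_lim_seq (fun n => f (p n)) l).
  { intros f Hf; apply ex_lim_seq_cauchy_corr; intros eps.
    apply is_lim_seq_spec in Hs; destruct (Hs (pos_div_2 eps)) as [N HN].
    exists N; intros n m Hn Hm.
    assert (A : forall k, (N <= k)%nat -> Rabs (f (p k) - f (p N)) < eps / 2).
    { intros k Hk; eapply Rle_lt_trans; [apply Hf|].
      eapply Rle_lt_trans; [apply Hp, Hk|].
      assert (B := HN N (le_n _)); simpl in B; rewrite Rminus_0_r in B.
      eapply Rle_lt_trans; [apply Rle_abs | exact B]. }
    assert (A1 := A n Hn); assert (A2 := A m Hm).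
    apply Rabs_lt_between in A1; apply Rabs_lt_between in A2; apply Rabs_lt_between; lra. }
  assert (Hfst : forall a b : C, Rabs (fst a - fst b) <= Cmod (a - b)).
  { intros a b; eapply Rle_trans; [|apply Rmax_Cmod]; apply Rmax_l. }
  assert (Hsnd : forall a b : C, Rabs (snd a - snd b) <= Cmod (a - b)).
  { intros a b; eapply Rle_trans; [|apply Rmax_Cmod]; apply Rmax_r. }
  destruct (Hc fst Hfst) as [x Hx]; destruct (Hc snd Hsnd) as [y Hy].
  exists (x, y); intros n; apply le_epsilon; intros eps He.
  assert (He2 : 0 < eps / 2) by lra.
  apply is_lim_seq_spec in Hx; destruct (Hx (mkposreal _ He2)) as [N1 H1].
  apply is_lim_seq_spec in Hy; destruct (Hy (mkposreal _ He2)) as [N2 H2].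
  set (m := Nat.max n (Nat.max N1 N2)).
  assert (B1 := H1 m ltac:(lia)); assert (B2 := H2 m ltac:(lia)); simpl in B1, B2.
  assert (B3 := Hp m n ltac:(lia)).
  assert (B4 := Cmod_triangle_minus (p n) (p m) (x, y)).
  rewrite Cmod_minus_sym in B3.
  assert (B5 : Cmod (p m - (x, y)) <= eps).
  { replace (p m - (x, y))%C with (RtoC (fst (p m) - x) + Ci * RtoC (snd (p m) - y))%C
      by (apply injective_projections; simpl; ring).
    eapply Rle_trans; [apply Cmod_triangle|].
    rewrite Cmod_mult, Cmod_Ci, !Cmod_R; lra. }
  lra.
Qed.

(** A figure of a fixed shape is given by a base point [p] and a signed size [s].  If
    every figure with property [B] contains one of half its size with property [B],
    then figures with property [B] shrink to a point.  Negative sizes are allowed since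
    the middle one of the four pieces of a triangle is turned upside down. *)
Lemma bisection (B : C -> R -> Prop) (K : R) :
  (forall p s, B p s -> exists p' s',
     B p' s' /\ Cmod (p' - p) <= K * Rabs s /\ Rabs s' = Rabs s / 2) ->
  forall p0 s0, B p0 s0 ->
  exists z, forall eps, 0 < eps ->
    exists p s, B p s /\ Rabs s < eps /\ Cmod (p - z) <= 2 * K * Rabs s /\
      (s0 <> 0 -> s <> 0).
Proof.
  intros step p0 s0 H0.
  pose (T := {x : C * R | B (fst x) (snd x)}).
  assert (next : forall x : T, {y : T |
    Cmod (fst (proj1_sig y) - fst (proj1_sig x)) <= K * Rabs (snd (proj1_sig x)) /\
    Rabs (snd (proj1_sig y)) = Rabs (snd (proj1_sig x)) / 2}).
  { intros [[p s] Hx]; apply constructive_indefinite_description; simpl in *.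
    destruct (step p s Hx) as [p' [s' [H1 H2]]].
    exists (exist (fun x : C * R => B (fst x) (snd x)) (p', s') H1); exact H2. }
  pose (x := nat_rect (fun _ => T) (exist _ (p0, s0) H0) (fun _ y => proj1_sig (next y))).
  pose (p := fun n => fst (proj1_sig (x n))); pose (s := fun n => snd (proj1_sig (x n))).
  assert (HB : forall n, B (p n) (s n)) by (intros n; apply (proj2_sig (x n))).
  assert (Hp : forall n, Cmod (p (S n) - p n) <= K * Rabs (s n))
    by (intros n; apply (proj2_sig (next (x n)))).
  assert (Hs : forall n, Rabs (s (S n)) = Rabs (s n) / 2)
    by (intros n; apply (proj2_sig (next (x n)))).
  assert (Hsn : forall n, Rabs (s n) = Rabs s0 * (1 / 2) ^ n).
  { induction n as [|n IH]; [unfold s; simpl; ring|]; rewrite Hs, IH; simpl; field. }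
  assert (Hlim : is_lim_seq (fun n => 2 * K * Rabs (s n)) 0).
  { apply is_lim_seq_ext with (fun n => (2 * K * Rabs s0) * (1 / 2) ^ n).
    { intros n; rewrite Hsn; ring. }
    replace (Finite 0) with (Rbar_mult (2 * K * Rabs s0) 0) by (simpl; f_equal; ring).
    apply is_lim_seq_scal_l, is_lim_seq_geom; rewrite Rabs_pos_eq; lra. }
  destruct (C_cauchy_limit p (fun n => 2 * K * Rabs (s n))) as [z Hz]; [|exact Hlim|].
  { intros m n Hmn.
    assert (A : Cmod (p m - p n) <= 2 * K * (Rabs (s n) - Rabs (s m))).
    { induction Hmn as [|m Hmn IH].
      - replace (p n - p n)%C with (RtoC 0) by ring; rewrite Cmod_0; lra.
      - assert (A1 := Cmod_triangle_minus (p (S m)) (p m) (p n)).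
        assert (A2 := Hp m); rewrite Hs; lra. }
    assert (A1 := Hp m); assert (A2 := Cmod_ge_0 (p (S m) - p m)); lra. }
  exists z; intros eps He.
  assert (Hlim2 : is_lim_seq (fun n => Rabs s0 * (1 / 2) ^ n) 0).
  { replace (Finite 0) with (Rbar_mult (Rabs s0) 0) by (simpl; f_equal; ring).
    apply is_lim_seq_scal_l, is_lim_seq_geom; rewrite Rabs_pos_eq; lra. }
  apply is_lim_seq_spec in Hlim2; destruct (Hlim2 (mkposreal eps He)) as [N HN].
  exists (p N), (s N); split; [apply HB|]; split; [|split; [apply Hz|]].
  - rewrite Hsn; assert (A := HN N (le_n _)); simpl in A; rewrite Rminus_0_r in A.
    eapply Rle_lt_trans; [apply Rle_abs | exact A].
  - intros Hs0 E; assert (A := Hsn N); rewrite E, Rabs_R0 in A.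
    assert (0 < Rabs s0) by (apply Rabs_pos_lt, Hs0).
    assert (0 < (1 / 2) ^ N) by (apply pow_lt; lra); nra.
Qed.

(** The property that is bisected is to contain, for every point of [E], another
    one at which [f] is at least as large. *)
Lemma continuous_max_closed (f : C -> R) (E : C -> Prop) (r : R) :
  (exists z, E z) ->
  (forall z, E z -> Cmod z <= r) ->
  (forall z, (forall eps, 0 < eps -> exists w, E w /\ Cmod (w - z) < eps) -> E z) ->
  (forall z, E z -> continuous f z) ->
  exists z, E z /\ forall w, E w -> f w <= f z.
Proof.
  intros [e0 He0] Hbd Hcl Hf.
  pose (Q := fun (p : C) (s : R) (w : C) =>
    fst p <= fst w <= fst p + s /\ snd p <= snd w <= snd p + s).
  pose (B := fun p s => 0 < s /\ forall e, E e -> exists e', E e' /\ Q p s e' /\ f e <= f e').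
  assert (Hr : 0 <= r) by (eapply Rle_trans; [apply Cmod_ge_0 | apply (Hbd e0 He0)]).
  assert (HQ : forall p s w, 0 < s -> Q p s w -> Cmod (w - p) <= 2 * s).
  { intros p s w Hs [H1 H2].
    replace (w - p)%C with (RtoC (fst w - fst p) + Ci * RtoC (snd w - snd p))%C
      by (apply injective_projections; simpl; ring).
    eapply Rle_trans; [apply Cmod_triangle|].
    rewrite Cmod_mult, Cmod_Ci, !Cmod_R, !Rabs_pos_eq; lra. }
  destruct (bisection B 1) with (p0 := ((- (r + 1), - (r + 1)) : C)) (s0 := 2 * (r + 1))
    as [z Hz].
  - intros p s [Hs HB].
    (* One of the four quarters is good: otherwise four points of [E] witness the
       failures, and the largest of the four values contradicts [HB]. *)
    assert (Hq : exists a b : R, (a = 0 \/ a = s / 2) /\ (b = 0 \/ b = s / 2) /\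
      B (p + (a, b))%C (s / 2)).
    { apply NNPP; intros N.
      assert (N1 : forall a b, (a = 0 \/ a = s / 2) -> (b = 0 \/ b = s / 2) ->
        exists e, E e /\ forall e', E e' -> Q (p + (a, b))%C (s / 2) e' -> f e' < f e).
      { intros a b Ha Hb; apply NNPP; intros N2; apply N; exists a, b.
        split; [exact Ha|]; split; [exact Hb|]; split; [lra|]; intros e He.
        apply NNPP; intros N3; apply N2; exists e; split; [exact He|].
        intros e' He' HQ'; apply Rnot_le_lt; intros N4; apply N3; exists e'; auto. }
      destruct (N1 0 0 ltac:(auto) ltac:(auto)) as [e1 [E1 F1]].
      destruct (N1 0 (s / 2) ltac:(auto) ltac:(auto)) as [e2 [E2 F2]].
      destruct (N1 (s / 2) 0 ltac:(auto) ltac:(auto)) as [e3 [E3 F3]].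
      destruct (N1 (s / 2) (s / 2) ltac:(auto) ltac:(auto)) as [e4 [E4 F4]].
      assert (M : exists e, E e /\ f e1 <= f e /\ f e2 <= f e /\ f e3 <= f e /\ f e4 <= f e).
      { assert (M2 : forall a b, E a -> E b -> exists e, E e /\ f a <= f e /\ f b <= f e).
        { intros a b Ha Hb; destruct (Rle_dec (f a) (f b)); [exists b | exists a];
            repeat split; auto; lra. }
        destruct (M2 e1 e2 E1 E2) as [a [Ea [A1 A2]]].
        destruct (M2 e3 e4 E3 E4) as [b [Eb [B1 B2]]].
        destruct (M2 a b Ea Eb) as [c [Ec [C1 C2]]].
        exists c; repeat split; auto; lra. }
      destruct M as [e [Ee [M1 [M2 [M3 M4]]]]].
      destruct (HB e Ee) as [e' [Ee' [[Q1 Q2] Hle]]].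
      destruct (Rle_dec (fst e') (fst p + s / 2)) as [Hx|Hx];
      destruct (Rle_dec (snd e') (snd p + s / 2)) as [Hy|Hy].
      - assert (f e' < f e1) by (apply F1; [exact Ee' | split; simpl; lra]); lra.
      - assert (f e' < f e2) by (apply F2; [exact Ee' | split; simpl; lra]); lra.
      - assert (f e' < f e3) by (apply F3; [exact Ee' | split; simpl; lra]); lra.
      - assert (f e' < f e4) by (apply F4; [exact Ee' | split; simpl; lra]); lra. }
    destruct Hq as [a [b [Ha [Hb HBq]]]].
    exists (p + (a, b))%C, (s / 2); split; [exact HBq|]; split.
    + replace (p + (a, b) - p)%C with (RtoC a + Ci * RtoC b)%C
        by (apply injective_projections; simpl; ring).
      eapply Rle_trans; [apply Cmod_triangle|].
      rewrite Cmod_mult, Cmod_Ci, !Cmod_R.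
      rewrite !Rabs_pos_eq; destruct Ha, Hb; lra.
    + rewrite !Rabs_pos_eq; lra.
  - split; [lra|]; intros e He; exists e; split; [exact He|]; split; [|lra].
    assert (A := Rmax_Cmod e); assert (A1 := Hbd e He).
    assert (A2 := Rmax_l (Rabs (fst e)) (Rabs (snd e))).
    assert (A3 := Rmax_r (Rabs (fst e)) (Rabs (snd e))).
    assert (A4 : Rabs (fst e) <= r) by lra; assert (A5 : Rabs (snd e) <= r) by lra.
    apply Rabs_le_between in A4; apply Rabs_le_between in A5; split; simpl; lra.
  - assert (Hn : forall e, E e -> forall eps, 0 < eps ->
      exists e', E e' /\ Cmod (e' - z) < eps /\ f e <= f e').
    { intros e He eps Heps; destruct (Hz (eps / 4) ltac:(lra)) as [p [s [[Hs HB] [H1 [H2 _]]]]].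
      destruct (HB e He) as [e' [Ee' [Q' Hle]]]; exists e'; split; [exact Ee'|].
      split; [|exact Hle].
      rewrite Rabs_pos_eq in H1, H2 by lra.
      assert (A := HQ p s e' Hs Q'); assert (A2 := Cmod_triangle_minus e' p z); lra. }
    assert (Ez : E z).
    { apply Hcl; intros eps Heps; destruct (Hn e0 He0 eps Heps) as [w [H1 [H2 _]]].
      exists w; auto. }
    exists z; split; [exact Ez|]; intros w Hw; apply le_epsilon; intros eps Heps.
    destruct (proj1 (continuous_C_R_eps f z) (Hf z Ez) eps Heps) as [d [Hd H1]].
    destruct (Hn w Hw d Hd) as [w' [_ [H2 H3]]].
    assert (A := H1 w' H2); apply Rabs_lt_between in A; lra.
Qed.

(** * Integrals of complex-valued functions *)

Definition CInt (f : R -> C) (a b : R) : C := RInt (V := C_R_CompleteNormedModule) f a b.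

Definition cont_on (f : R -> C) (a b : R) : Prop := forall t, a <= t <= b -> continuous f t.

Lemma cont_on_ex_RInt (f : R -> C) (a b : R) :
  a <= b -> cont_on f a b -> ex_RInt (V := C_R_CompleteNormedModule) f a b.
Proof.
  intros Hab Hf; apply (ex_RInt_continuous (V := C_R_CompleteNormedModule)); intros t Ht.
  rewrite Rmin_left, Rmax_right in Ht by lra; apply Hf, Ht.
Qed.

Lemma CInt_correct (f : R -> C) (a b : R) :
  a <= b -> cont_on f a b -> is_RInt (V := C_R_NormedModule) f a b (CInt f a b).
Proof.
  intros Hab Hf; apply (RInt_correct (V := C_R_CompleteNormedModule)), cont_on_ex_RInt; auto.
Qed.

Lemma CInt_unique (f : R -> C) (a b : R) (l : C) :
  is_RInt (V := C_R_NormedModule) f a b l -> CInt f a b = l.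
Proof. intros H; apply (is_RInt_unique (V := C_R_CompleteNormedModule)), H. Qed.

Lemma CInt_ext (f g : R -> C) (a b : R) :
  a <= b -> (forall t, a <= t <= b -> f t = g t) -> CInt f a b = CInt g a b.
Proof.
  intros Hab H; apply (RInt_ext (V := C_R_CompleteNormedModule)); intros t Ht.
  rewrite Rmin_left, Rmax_right in Ht by lra; apply H; lra.
Qed.

Lemma CInt_bound (f : R -> C) (a b M : R) :
  a <= b -> cont_on f a b -> (forall t, a <= t <= b -> Cmod (f t) <= M) ->
  Cmod (CInt f a b) <= (b - a) * M.
Proof.
  intros Hab Hc HM; rewrite <- norm_C_R.
  apply (norm_RInt_le_const (V := C_R_NormedModule) f a b); [exact Hab| |].
  - intros t Ht; rewrite norm_C_R; apply HM, Ht.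
  - apply CInt_correct; auto.
Qed.

Lemma CInt_plus (f g : R -> C) (a b : R) :
  a <= b -> cont_on f a b -> cont_on g a b ->
  CInt (fun t => f t + g t)%C a b = (CInt f a b + CInt g a b)%C.
Proof.
  intros Hab Hf Hg; apply CInt_unique.
  apply (is_RInt_plus (V := C_R_NormedModule)); apply CInt_correct; auto.
Qed.

Lemma CInt_scal (k : C) (f : R -> C) (a b : R) :
  a <= b -> cont_on f a b -> CInt (fun t => k * f t)%C a b = (k * CInt f a b)%C.
Proof.
  intros Hab Hf; apply CInt_unique.
  assert (H := CInt_correct f a b Hab Hf).
  assert (H1 := is_RInt_fct_extend_fst (U := R_NormedModule) (V := R_NormedModule) _ _ _ _ H).
  assert (H2 := is_RInt_fct_extend_snd (U := R_NormedModule) (V := R_NormedModule) _ _ _ _ H).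
  apply (is_RInt_fct_extend_pair (U := R_NormedModule) (V := R_NormedModule)
    (fun t => k * f t)%C a b (fst (k * CInt f a b)%C) (snd (k * CInt f a b)%C)); simpl.
  - apply (is_RInt_minus (V := R_NormedModule)); apply (is_RInt_scal (V := R_NormedModule));
      assumption.
  - apply (is_RInt_plus (V := R_NormedModule)); apply (is_RInt_scal (V := R_NormedModule));
      assumption.
Qed.

Lemma CInt_const (k : C) (a b : R) : CInt (fun _ => k) a b = (RtoC (b - a) * k)%C.
Proof.
  unfold CInt; rewrite (RInt_const (V := C_R_CompleteNormedModule)).
  exact (scal_C_R (b - a) k).
Qed.

Lemma cont_on_mult (f g : R -> C) (a b : R) :
  cont_on f a b -> cont_on g a b -> cont_on (fun t => f t * g t)%C a b.
Proof. intros Hf Hg t Ht; apply continuous_Cmult; auto. Qed.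

Lemma cont_on_plus (f g : R -> C) (a b : R) :
  cont_on f a b -> cont_on g a b -> cont_on (fun t => f t + g t)%C a b.
Proof. intros Hf Hg t Ht; apply continuous_Cplus; auto. Qed.

Lemma cont_on_const (k : C) (a b : R) : cont_on (fun _ => k) a b.
Proof. intros t Ht; apply continuous_const. Qed.

Lemma CInt_minus (f g : R -> C) (a b : R) :
  a <= b -> cont_on f a b -> cont_on g a b ->
  CInt (fun t => f t - g t)%C a b = (CInt f a b - CInt g a b)%C.
Proof.
  intros Hab Hf Hg; apply CInt_unique.
  apply (is_RInt_minus (V := C_R_NormedModule)); apply CInt_correct; auto.
Qed.

Lemma CInt_derive (f df : R -> C) (a b : R) :
  a <= b ->
  (forall t, a <= t <= b ->
     is_derive (K := R_AbsRing) (V := C_R_NormedModule) f t (df t)) ->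
  cont_on df a b -> CInt df a b = (f b - f a)%C.
Proof.
  intros Hab Hd Hc; apply CInt_unique.
  apply (is_RInt_derive (V := C_R_CompleteNormedModule) f df); intros t Ht;
    rewrite Rmin_left, Rmax_right in Ht by lra; [apply Hd, Ht | apply Hc, Ht].
Qed.

(** * Integration along segments *)

Definition seg (a b : C) (t : R) : C := (a + RtoC t * (b - a))%C.

Definition seg_int (f : C -> C) (a b : C) : C :=
  ((b - a) * CInt (fun t => f (seg a b t)) 0 1)%C.

Definition on_seg (f : C -> C) (a b : C) : Prop :=
  forall t, 0 <= t <= 1 -> continuous f (seg a b t).

Lemma is_derive_seg (a b : C) (t : R) :
  is_derive (K := R_AbsRing) (V := C_R_NormedModule) (seg a b) t (b - a)%C.
Proof.
  apply is_derive_curve_eps; intros eps He; exists 1; split; [lra|]; intros s _.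
  unfold seg; replace (_ - _ - _)%C with (RtoC 0).
  - rewrite Cmod_0; apply Rmult_le_pos; [lra | apply Rabs_pos].
  - apply injective_projections; simpl; ring.
Qed.

Lemma continuous_seg (a b : C) (t : R) : continuous (seg a b) t.
Proof.
  apply continuous_Cplus; [apply continuous_const|].
  apply continuous_Cmult; [apply continuous_RtoC, continuous_id | apply continuous_const].
Qed.

Lemma cont_on_seg (f : C -> C) (a b : C) :
  on_seg f a b -> cont_on (fun t => f (seg a b t)) 0 1.
Proof.
  intros Hf t Ht; apply (continuous_comp (seg a b) f); [apply continuous_seg | apply Hf, Ht].
Qed.

Lemma Cmod_seg (a b z : C) (t r : R) :
  0 <= t <= 1 -> Cmod (a - z) <= r -> Cmod (b - z) <= r -> Cmod (seg a b t - z) <= r.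
Proof.
  intros Ht Ha Hb.
  replace (seg a b t - z)%C with (RtoC (1 - t) * (a - z) + RtoC t * (b - z))%C
    by (unfold seg; apply injective_projections; simpl; ring).
  eapply Rle_trans; [apply Cmod_triangle|].
  rewrite !Cmod_mult, !Cmod_R, !Rabs_pos_eq by lra; nra.
Qed.

Lemma Cmod_seg_lt (a b z : C) (t r : R) :
  0 <= t <= 1 -> Cmod (a - z) < r -> Cmod (b - z) < r -> Cmod (seg a b t - z) < r.
Proof.
  intros Ht Ha Hb; assert (H := Cmod_seg a b z t (Rmax (Cmod (a - z)) (Cmod (b - z))) Ht
    (Rmax_l _ _) (Rmax_r _ _)).
  eapply Rle_lt_trans; [exact H|]; apply Rmax_lub_lt; assumption.
Qed.

Lemma seg_int_close (f g : C -> C) (a b : C) (M : R) :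
  on_seg f a b -> on_seg g a b ->
  (forall t, 0 <= t <= 1 -> Cmod (f (seg a b t) - g (seg a b t)) <= M) ->
  Cmod (seg_int f a b - seg_int g a b) <= M * Cmod (b - a).
Proof.
  intros Hf Hg HM; unfold seg_int.
  assert (Cf := cont_on_seg _ _ _ Hf); assert (Cg := cont_on_seg _ _ _ Hg).
  replace ((b - a) * CInt (fun t => f (seg a b t)) 0 1 -
    (b - a) * CInt (fun t => g (seg a b t)) 0 1)%C with
   ((b - a) * (CInt (fun t => f (seg a b t)) 0 1 - CInt (fun t => g (seg a b t)) 0 1))%C by ring.
  rewrite <- CInt_minus by (assumption || lra).
  rewrite Cmod_mult, Rmult_comm; apply Rmult_le_compat_r; [apply Cmod_ge_0|].
  replace M with ((1 - 0) * M) by ring.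
  apply CInt_bound; [lra| |exact HM].
  intros t Ht; apply continuous_Cminus; [apply Cf | apply Cg]; exact Ht.
Qed.

Lemma seg_int_primitive (F f : C -> C) (a b : C) :
  (forall t, 0 <= t <= 1 -> is_derive F (seg a b t) (f (seg a b t))) ->
  on_seg f a b -> seg_int f a b = (F b - F a)%C.
Proof.
  intros HF Hf; unfold seg_int.
  rewrite <- CInt_scal by (try lra; apply cont_on_seg, Hf).
  rewrite (CInt_derive (fun t => F (seg a b t))).
  - f_equal; [|f_equal]; f_equal; unfold seg; ring.
  - lra.
  - intros t Ht; apply is_derive_comp_curve; [apply HF, Ht | apply is_derive_seg].
  - apply cont_on_mult; [apply cont_on_const | apply cont_on_seg, Hf].
Qed.

Lemma is_derive_Cquad (p q r : C) (z : C) :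
  is_derive (fun w => p * w + q * (w - r) * (w - r))%C z (p + 2 * q * (z - r))%C.
Proof.
  apply is_derive_C_eps; intros eps He.
  assert (Hq := Cmod_ge_0 q).
  exists (eps / (Cmod q + 1)); split; [apply Rdiv_lt_0_compat; lra|]; intros w Hw.
  replace (_ - _ - _)%C with (q * (w - z) * (w - z))%C by ring.
  rewrite !Cmod_mult; apply Rmult_le_compat_r; [apply Cmod_ge_0|].
  apply Rlt_div_r in Hw; [|lra].
  assert (A := Cmod_ge_0 (w - z)); nra.
Qed.

Lemma continuous_Caffine (p q r : C) (z : C) :
  continuous (fun w : C => p + q * (w - r))%C z.
Proof.
  apply continuous_Cplus; [apply continuous_const|].
  apply continuous_Cmult; [apply continuous_const|].
  apply continuous_Cminus; [apply continuous_id | apply continuous_const].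
Qed.

(** The factor 2 and the centre [r] fit the use of this lemma: affine functions are first
    order expansions, and their integrals are quadratic expansions, at [r]. *)
Lemma seg_int_affine (p q r a b : C) :
  seg_int (fun w => p + 2 * q * (w - r))%C a b =
  ((p * b + q * (b - r) * (b - r)) - (p * a + q * (a - r) * (a - r)))%C.
Proof.
  apply (seg_int_primitive (fun w => p * w + q * (w - r) * (w - r))%C).
  - intros t _; apply is_derive_Cquad.
  - intros t _; apply continuous_Caffine.
Qed.

Lemma seg_int_swap (f : C -> C) (a b : C) :
  on_seg f a b -> seg_int f b a = (- seg_int f a b)%C.
Proof.
  intros Hf; unfold seg_int.
  set (g := fun t => f (seg a b t)).
  assert (Hg : cont_on g 0 1) by (apply cont_on_seg, Hf).
  assert (E : CInt (fun t => f (seg b a t)) 0 1 = CInt g 0 1).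
  { apply CInt_unique.
    apply (is_RInt_ext (V := C_R_NormedModule)) with
      (fun t => opp (G := C_R_NormedModule) (scal (K := R_AbsRing) (V := C_R_NormedModule)
        (-1) (g (-1 * t + 1)))).
    { intros t _; rewrite scal_C_R; unfold g.
      replace (seg a b (-1 * t + 1)) with (seg b a t)
        by (unfold seg; apply injective_projections; simpl; ring).
      change (- (RtoC (-1) * f (seg b a t)) = f (seg b a t))%C.
      apply injective_projections; simpl; ring. }
    rewrite <- (opp_opp (G := C_R_NormedModule) (CInt g 0 1)).
    apply (is_RInt_opp (V := C_R_NormedModule)).
    apply (is_RInt_comp_lin (V := C_R_NormedModule)).
    replace (-1 * 0 + 1) with 1 by ring; replace (-1 * 1 + 1) with 0 by ring.
    apply (is_RInt_swap (V := C_R_NormedModule)), CInt_correct; [lra | exact Hg]. }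
  rewrite E; fold g; ring.
Qed.

Lemma seg_int_split (f : C -> C) (a b m : C) :
  m = ((a + b) / 2)%C ->
  on_seg f a b -> seg_int f a b = (seg_int f a m + seg_int f m b)%C.
Proof.
  intros Em Hf; unfold seg_int.
  set (g := fun t => f (seg a b t)).
  assert (Hg : cont_on g 0 1) by (apply cont_on_seg, Hf).
  assert (H1 : cont_on g 0 (1 / 2)) by (intros t Ht; apply Hg; lra).
  assert (H2 : cont_on g (1 / 2) 1) by (intros t Ht; apply Hg; lra).
  assert (E : CInt g 0 1 = (CInt g 0 (1 / 2) + CInt g (1 / 2) 1)%C).
  { symmetry; apply (RInt_Chasles (V := C_R_CompleteNormedModule));
      apply cont_on_ex_RInt; (assumption || lra). }
  assert (L : forall v, 0 <= v -> v + 1 / 2 <= 1 ->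
    CInt (fun t => g (1 / 2 * t + v)) 0 1 = (RtoC 2 * CInt g v (v + 1 / 2))%C).
  { intros v Hv Hv1; apply CInt_unique.
    apply (is_RInt_ext (V := C_R_NormedModule)) with
      (fun t => scal (K := R_AbsRing) (V := C_R_NormedModule) 2
        (scal (K := R_AbsRing) (V := C_R_NormedModule) (1 / 2) (g (1 / 2 * t + v)))).
    { intros t _; rewrite !scal_C_R; apply injective_projections; simpl; field. }
    rewrite <- scal_C_R; apply (is_RInt_scal (V := C_R_NormedModule)).
    apply (is_RInt_comp_lin (V := C_R_NormedModule)).
    replace (1 / 2 * 0 + v) with v by ring; replace (1 / 2 * 1 + v) with (v + 1 / 2) by ring.
    apply CInt_correct; [lra|]; intros t Ht; apply Hg; lra. }
  assert (E1 : CInt (fun t => f (seg a m t)) 0 1 = (RtoC 2 * CInt g 0 (1 / 2))%C).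
  { assert (E0 := L 0 ltac:(lra) ltac:(lra)).
    replace (0 + 1 / 2) with (1 / 2) in E0 by ring; rewrite <- E0.
    apply CInt_ext; [lra|]; intros t _; unfold g; f_equal; rewrite Em; unfold seg.
    apply injective_projections; simpl; field. }
  assert (E2 : CInt (fun t => f (seg m b t)) 0 1 = (RtoC 2 * CInt g (1 / 2) 1)%C).
  { assert (E0 := L (1 / 2) ltac:(lra) ltac:(lra)).
    replace (1 / 2 + 1 / 2) with 1 in E0 by field; rewrite <- E0.
    apply CInt_ext; [lra|]; intros t _; unfold g; f_equal; rewrite Em; unfold seg.
    apply injective_projections; simpl; field. }
  fold g; rewrite E1, E2, E, Em; field.
Qed.

(** * The theorem of Goursat *)

Definition tri_int (f : C -> C) (a b c : C) : C :=
  (seg_int f a b + seg_int f b c + seg_int f c a)%C.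

(** The edges of the middle triangle [bc ca ab] cancel against those of the other three. *)
Lemma tri_int_split (f : C -> C) (a b c ab bc ca : C) :
  ab = ((a + b) / 2)%C -> bc = ((b + c) / 2)%C -> ca = ((c + a) / 2)%C ->
  on_seg f a b -> on_seg f b c -> on_seg f c a ->
  on_seg f ab bc -> on_seg f bc ca -> on_seg f ca ab ->
  tri_int f a b c =
  (tri_int f a ab ca + tri_int f ab b bc + tri_int f ca bc c + tri_int f bc ca ab)%C.
Proof.
  intros E1 E2 E3 H1 H2 H3 H4 H5 H6; unfold tri_int.
  rewrite (seg_int_split f a b ab E1 H1), (seg_int_split f b c bc E2 H2),
    (seg_int_split f c a ca E3 H3).
  rewrite (seg_int_swap f ab bc H4), (seg_int_swap f bc ca H5), (seg_int_swap f ca ab H6).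
  ring.
Qed.

Lemma on_seg_disk (f : C -> C) (z a b : C) (r : R) :
  (forall w, Cmod (w - z) < r -> continuous f w) ->
  Cmod (a - z) < r -> Cmod (b - z) < r -> on_seg f a b.
Proof. intros Hf Ha Hb t Ht; apply Hf, Cmod_seg_lt; assumption. Qed.

Lemma Cmod_half (a b z : C) (r : R) :
  Cmod (a - z) <= r -> Cmod (b - z) <= r -> Cmod ((a + b) / 2 - z) <= r.
Proof.
  intros Ha Hb; replace ((a + b) / 2)%C with (seg a b (1 / 2)).
  - apply Cmod_seg; (assumption || lra).
  - unfold seg; apply injective_projections; simpl; field.
Qed.

(** Halving a triangle halves its size [s], so if the integral over it is at least
    [c * s ^ 2] in modulus, the same holds for one of the four halves.  The small
    triangles shrink to a point of differentiability of [f], where the integral is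
    [o(s ^ 2)], because the affine part of [f] has a primitive. *)
Lemma goursat (f : C -> C) (z a b c : C) (r : R) :
  (forall w, Cmod (w - z) < r -> ex_derive f w) ->
  Cmod (a - z) < r -> Cmod (b - z) < r -> Cmod (c - z) < r ->
  tri_int f a b c = RtoC 0.
Proof.
  intros Hf Ha Hb Hc.
  assert (Hcont : forall w, Cmod (w - z) < r -> continuous f w).
  { intros w Hw; destruct (Hf w Hw) as [l Hl]; exact (is_derive_C_continuous f w l Hl). }
  set (r1 := Rmax (Cmod (a - z)) (Rmax (Cmod (b - z)) (Cmod (c - z)))).
  assert (Hr1 : r1 < r) by (repeat apply Rmax_lub_lt; assumption).
  assert (Ha1 : Cmod (a - z) <= r1) by apply Rmax_l.
  assert (Hb1 : Cmod (b - z) <= r1) by (eapply Rle_trans; [apply Rmax_l | apply Rmax_r]).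
  assert (Hc1 : Cmod (c - z) <= r1) by (eapply Rle_trans; [apply Rmax_r | apply Rmax_r]).
  assert (Hon : forall p q, Cmod (p - z) <= r1 -> Cmod (q - z) <= r1 -> on_seg f p q)
    by (intros p q Hp Hq; apply (on_seg_disk f z p q r Hcont); lra).
  clearbody r1.
  apply NNPP; intros Hne.
  set (u := (b - a)%C); set (v := (c - a)%C).
  set (T := fun (p : C) (s : R) => tri_int f p (p + RtoC s * u)%C (p + RtoC s * v)%C).
  set (k := Cmod (tri_int f a b c)).
  assert (Hk : 0 < k) by (apply Cmod_gt_0; exact Hne).
  set (B := fun (p : C) (s : R) => Cmod (p - z) <= r1 /\ Cmod (p + RtoC s * u - z) <= r1 /\
    Cmod (p + RtoC s * v - z) <= r1 /\ k * s ^ 2 <= Cmod (T p s)).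
  assert (Hu := Cmod_ge_0 u); assert (Hv := Cmod_ge_0 v).
  set (K := Cmod u + Cmod v + 1).
  destruct (bisection B K) with (p0 := a) (s0 := 1) as [w Hw].
  - intros p s [B1 [B2 [B3 B4]]].
    set (q := (p + RtoC s * u)%C) in *; set (t := (p + RtoC s * v)%C) in *.
    assert (C1 := Cmod_half _ _ _ _ B1 B2); assert (C2 := Cmod_half _ _ _ _ B2 B3);
    assert (C3 := Cmod_half _ _ _ _ B3 B1).
    set (pq := ((p + q) / 2)%C) in *; set (qt := ((q + t) / 2)%C) in *;
    set (tp := ((t + p) / 2)%C) in *.
    assert (S := tri_int_split f p q t pq qt tp eq_refl eq_refl eq_refl
      (Hon _ _ B1 B2) (Hon _ _ B2 B3) (Hon _ _ B3 B1)
      (Hon _ _ C1 C2) (Hon _ _ C2 C3) (Hon _ _ C3 C1)).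
    assert (Epq : pq = (p + RtoC (s / 2) * u)%C)
      by (unfold pq, q; apply injective_projections; simpl; field).
    assert (Etp : tp = (p + RtoC (s / 2) * v)%C)
      by (unfold tp, t; apply injective_projections; simpl; field).
    assert (Eq : q = (pq + RtoC (s / 2) * u)%C)
      by (unfold pq, q; apply injective_projections; simpl; field).
    assert (Eqt : qt = (pq + RtoC (s / 2) * v)%C)
      by (unfold pq, qt, q, t; apply injective_projections; simpl; field).
    assert (Eqt' : qt = (tp + RtoC (s / 2) * u)%C)
      by (unfold tp, qt, q, t; apply injective_projections; simpl; field).
    assert (Et : t = (tp + RtoC (s / 2) * v)%C)
      by (unfold tp, t; apply injective_projections; simpl; field).
    assert (Epq' : pq = (qt + RtoC (- (s / 2)) * v)%C)
      by (rewrite Eqt; apply injective_projections; simpl; field).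
    assert (Etp' : tp = (qt + RtoC (- (s / 2)) * u)%C)
      by (rewrite Eqt'; apply injective_projections; simpl; field).
    assert (Hstep : exists p' s', B p' s' /\ (s' = s / 2 \/ s' = - (s / 2)) /\
      Cmod (p' - p) <= K * Rabs s).
    { assert (D : forall d : C, forall m, 0 <= m -> Cmod d <= m + m + 2 ->
        Cmod (RtoC (s / 2) * d) <= (m + 1) * Rabs s).
      { intros d m Hm Hd; rewrite Cmod_mult, Cmod_R.
        unfold Rdiv; rewrite Rabs_mult, (Rabs_pos_eq (/ 2)) by lra.
        assert (A := Rabs_pos s); nra. }
      assert (D1 : Cmod (p - p) <= K * Rabs s).
      { replace (p - p)%C with (RtoC 0) by ring; rewrite Cmod_0.
        apply Rmult_le_pos; [unfold K; lra | apply Rabs_pos]. }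
      assert (D2 : Cmod (pq - p) <= K * Rabs s).
      { rewrite Epq; replace (_ - p)%C with (RtoC (s / 2) * u)%C by ring; apply D; lra. }
      assert (D3 : Cmod (tp - p) <= K * Rabs s).
      { rewrite Etp; replace (_ - p)%C with (RtoC (s / 2) * v)%C by ring; apply D; lra. }
      assert (D4 : Cmod (qt - p) <= K * Rabs s).
      { rewrite Eqt, Epq; replace (_ - p)%C with (RtoC (s / 2) * (u + v))%C by ring.
        apply D; [lra|]; assert (A := Cmod_triangle u v); lra. }
      destruct (Rle_dec (k * (s / 2) ^ 2) (Cmod (T p (s / 2)))) as [G|G1].
      { exists p, (s / 2); unfold B; rewrite <- Epq, <- Etp; auto 10. }
      destruct (Rle_dec (k * (s / 2) ^ 2) (Cmod (T pq (s / 2)))) as [G|G2].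
      { exists pq, (s / 2); unfold B; rewrite <- Eq, <- Eqt; auto 10. }
      destruct (Rle_dec (k * (s / 2) ^ 2) (Cmod (T tp (s / 2)))) as [G|G3].
      { exists tp, (s / 2); unfold B; rewrite <- Eqt', <- Et; auto 10. }
      destruct (Rle_dec (k * (- (s / 2)) ^ 2) (Cmod (T qt (- (s / 2))))) as [G|G4].
      { exists qt, (- (s / 2)); unfold B; rewrite <- Etp', <- Epq'; auto 10. }
      exfalso; unfold T in G1, G2, G3, G4, B4.
      rewrite <- Epq, <- Etp in G1; rewrite <- Eq, <- Eqt in G2.
      rewrite <- Eqt', <- Et in G3; rewrite <- Etp', <- Epq' in G4.
      fold q t in B4; rewrite S in B4.
      assert (A1 := Cmod_triangle (tri_int f p pq tp + tri_int f pq q qt + tri_int f tp qt t)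
        (tri_int f qt tp pq)).
      assert (A2 := Cmod_triangle (tri_int f p pq tp + tri_int f pq q qt) (tri_int f tp qt t)).
      assert (A3 := Cmod_triangle (tri_int f p pq tp) (tri_int f pq q qt)).
      simpl in G1, G2, G3, G4, B4; lra. }
    destruct Hstep as [p' [s' [HB [Hs' HK]]]]; exists p', s'; split; [exact HB|].
    split; [exact HK|].
    destruct Hs' as [->| ->]; [|rewrite Rabs_Ropp]; unfold Rdiv;
      rewrite Rabs_mult, (Rabs_pos_eq (/ 2)); lra.
  - unfold B, T; rewrite !Cmult_1_l; unfold u, v.
    replace (a + (b - a))%C with b by ring; replace (a + (c - a))%C with c by ring.
    fold k; repeat split; auto; simpl; lra.
  - assert (Hwz : Cmod (w - z) <= r1).
    { apply le_epsilon; intros eps He.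
      assert (HK : 0 < 2 * K + 1) by (unfold K; lra).
      destruct (Hw (eps / (2 * K + 1))) as [p [s [[B1 _] [H1 [H2 _]]]]].
      { apply Rdiv_lt_0_compat; lra. }
      apply Rlt_div_r in H1; [|lra].
      assert (A := Cmod_triangle_minus w p z); rewrite (Cmod_minus_sym w p) in A.
      assert (A1 := Rabs_pos s); lra. }
    destruct (Hf w ltac:(lra)) as [l Hl].
    set (K3 := 3 * K).
    assert (HK3 : 0 < K3) by (unfold K3, K; lra).
    set (eps := k / (8 * K * K3)).
    assert (HK0 : 0 < K) by (unfold K; lra).
    assert (He : 0 < eps) by (apply Rdiv_lt_0_compat; [lra|]; nra).
    destruct (proj1 (is_derive_C_eps f w l) Hl eps He) as [d [Hd H1]].
    destruct (Hw (d / K3)) as [p [s [[B1 [B2 [B3 B4]]] [Hs [Hp Hs0]]]]].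
    { apply Rdiv_lt_0_compat; lra. }
    assert (Hsp : 0 < Rabs s) by (apply Rabs_pos_lt, Hs0; lra).
    apply Rlt_div_r in Hs; [|lra].
    set (q := (p + RtoC s * u)%C) in *; set (t := (p + RtoC s * v)%C) in *.
    assert (Lq : Cmod (q - p) <= K * Rabs s).
    { unfold q; replace (_ - p)%C with (RtoC s * u)%C by ring.
      rewrite Cmod_mult, Cmod_R; unfold K; nra. }
    assert (Lt : Cmod (t - p) <= K * Rabs s).
    { unfold t; replace (_ - p)%C with (RtoC s * v)%C by ring.
      rewrite Cmod_mult, Cmod_R; unfold K; nra. }
    assert (Lqt : Cmod (t - q) <= K * Rabs s).
    { unfold t, q; replace (_ - _)%C with (RtoC s * (v - u))%C by ring.
      rewrite Cmod_mult, Cmod_R; assert (A := Cmod_triangle v (- u)).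
      rewrite Cmod_opp in A; unfold K; unfold Cminus; nra. }
    assert (P1 : Cmod (p - w) <= K3 * Rabs s) by (unfold K3; nra).
    assert (P2 : Cmod (q - w) <= K3 * Rabs s)
      by (assert (A := Cmod_triangle_minus q p w); unfold K3; lra).
    assert (P3 : Cmod (t - w) <= K3 * Rabs s)
      by (assert (A := Cmod_triangle_minus t p w); unfold K3; lra).
    set (g := fun x => (f w + 2 * (l / 2) * (x - w))%C).
    assert (Hclose : forall x y, Cmod (x - w) <= K3 * Rabs s -> Cmod (y - w) <= K3 * Rabs s ->
      Cmod (x - z) <= r1 -> Cmod (y - z) <= r1 -> Cmod (y - x) <= K * Rabs s ->
      Cmod (seg_int f x y - seg_int g x y) <= eps * (K3 * Rabs s) * (K * Rabs s)).
    { intros x y Hx Hy Hx1 Hy1 Hxy; apply Rle_trans with (eps * (K3 * Rabs s) * Cmod (y - x)).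
      2: { apply Rmult_le_compat_l; [|exact Hxy]; apply Rmult_le_pos; [lra|]; apply Rmult_le_pos; lra. }
      apply seg_int_close; [apply Hon; assumption | |].
      - intros m _; apply continuous_Caffine.
      - intros m Hm; set (o := seg x y m).
        assert (Ho : Cmod (o - w) <= K3 * Rabs s) by (apply Cmod_seg; assumption).
        replace (f o - g o)%C with (f o - f w - (o - w) * l)%C by (unfold g; field).
        eapply Rle_trans; [apply H1; lra|]; apply Rmult_le_compat_l; lra. }
    assert (A1 := Hclose p q P1 P2 B1 B2 Lq).
    assert (A2 := Hclose q t P2 P3 B2 B3 Lqt).
    assert (A3 := Hclose t p P3 P1 B3 B1 ltac:(rewrite Cmod_minus_sym; exact Lt)).
    assert (E : T p s = ((seg_int f p q - seg_int g p q) + (seg_int f q t - seg_int g q t)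
      + (seg_int f t p - seg_int g t p))%C).
    { unfold T, tri_int; fold q t; unfold g; rewrite !seg_int_affine; ring. }
    rewrite E in B4.
    assert (A4 := Cmod_triangle ((seg_int f p q - seg_int g p q) +
      (seg_int f q t - seg_int g q t)) (seg_int f t p - seg_int g t p)).
    assert (A5 := Cmod_triangle (seg_int f p q - seg_int g p q)
      (seg_int f q t - seg_int g q t)).
    assert (E2 : eps * (K3 * Rabs s) * (K * Rabs s) = k / 8 * s ^ 2).
    { rewrite <- (pow2_abs s); unfold eps; field; lra. }
    assert (0 < s ^ 2) by (rewrite <- pow2_abs; apply pow_lt, Hsp).
    nra.
Qed.

Definition disk_primitive (f : C -> C) (z : C) : C -> C := seg_int f z.

Lemma seg_int_const_error (f : C -> C) (a b : C) (M : R) :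
  on_seg f a b ->
  (forall t, 0 <= t <= 1 -> Cmod (f (seg a b t) - f a) <= M) ->
  Cmod (seg_int f a b - (b - a) * f a) <= M * Cmod (b - a).
Proof.
  intros Hf HM.
  replace ((b - a) * f a)%C with (seg_int (fun _ => f a) a b).
  - apply seg_int_close; [exact Hf | intros t _; apply continuous_const | exact HM].
  - unfold seg_int; rewrite CInt_const; replace (1 - 0) with 1 by ring; ring.
Qed.

(** By Goursat's theorem the difference of two values of the primitive is the integral of
    [f] over the segment between the two points. *)
Lemma is_derive_disk_primitive (f : C -> C) (z : C) (r : R) :
  (forall w, Cmod (w - z) < r -> ex_derive f w) ->
  forall w, Cmod (w - z) < r -> is_derive (disk_primitive f z) w (f w).
Proof.
  intros Hf w Hw.
  assert (Hcont : forall w, Cmod (w - z) < r -> continuous f w).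
  { intros x Hx; destruct (Hf x Hx) as [l Hl]; exact (is_derive_C_continuous f x l Hl). }
  assert (Hz : Cmod (z - z) < r).
  { replace (z - z)%C with (RtoC 0) by ring; rewrite Cmod_0.
    eapply Rle_lt_trans; [apply Cmod_ge_0 | exact Hw]. }
  apply is_derive_C_eps; intros eps He.
  destruct (proj1 (continuous_C_eps f w) (Hcont w Hw) eps He) as [d [Hd H1]].
  exists (Rmin d (r - Cmod (w - z))); split; [apply Rmin_pos; lra|]; intros x Hx.
  assert (X1 := Rlt_le_trans _ _ _ Hx (Rmin_l _ _)).
  assert (X2 := Rlt_le_trans _ _ _ Hx (Rmin_r _ _)).
  assert (Hxz : Cmod (x - z) < r) by (assert (A := Cmod_triangle_minus x w z); lra).
  assert (G := goursat f z z w x r Hf Hz Hw Hxz).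
  unfold tri_int in G; unfold disk_primitive.
  rewrite (seg_int_swap f z x (on_seg_disk f z z x r Hcont Hz Hxz)) in G.
  replace (seg_int f z x - seg_int f z w)%C with (seg_int f w x).
  - apply seg_int_const_error; [apply (on_seg_disk f z w x r); assumption|].
    intros t Ht; left; apply H1, Cmod_seg_lt; try assumption.
    replace (w - w)%C with (RtoC 0) by ring; rewrite Cmod_0; lra.
  - assert (E : seg_int f w x = (seg_int f z w + seg_int f w x + - seg_int f z x
      - seg_int f z w + seg_int f z x)%C) by ring.
    rewrite G in E; rewrite E; ring.
Qed.

(** * Complex derivatives under the integral sign *)

Lemma cont_on_bounded (f : R -> C) (a b : R) :
  a <= b -> cont_on f a b -> exists M, 0 <= M /\ forall t, a <= t <= b -> Cmod (f t) <= M.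
Proof.
  intros Hab Hf.
  destruct (continuity_ab_maj (fun t => Cmod (f t)) a b Hab) as [m [Hm _]].
  - intros t Ht; apply continuity_pt_filterlim.
    apply (continuous_Cmod (T := R_UniformSpace)), Hf, Ht.
  - exists (Cmod (f m)); split; [apply Cmod_ge_0 | exact Hm].
Qed.

(** Compactness of the parameter interval makes the continuity of [f] along the curve
    uniform, also towards points off the curve. *)
Lemma uniform_along_curve (f : C -> C) (p : R -> C) (a b eps : R) :
  cont_on p a b -> (forall t, a <= t <= b -> continuous f (p t)) -> 0 < eps ->
  exists d, 0 < d /\ forall t, a <= t <= b -> forall w, Cmod (w - p t) < d ->
    Cmod (f w - f (p t)) < eps.
Proof.
  intros Hp Hf He.
  assert (loc : forall t, {d : posreal | a <= t <= b ->
    exists e, d <= e /\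
      (forall x, Rabs (x - t) < d -> Cmod (p x - p t) < e) /\
      (forall w, Cmod (w - p t) < 2 * e -> Cmod (f w - f (p t)) < eps / 2)}).
  { intros t; apply constructive_indefinite_description.
    destruct (classic (a <= t <= b)) as [Ht|Ht].
    2: { exists (mkposreal 1 Rlt_0_1); intros N; contradiction. }
    destruct (proj1 (continuous_C_eps f (p t)) (Hf t Ht) (eps / 2) ltac:(lra)) as [e [He1 H1]].
    assert (H2 := proj1 (continuous_C_iff p t) (Hp t Ht) (e / 2) ltac:(lra)).
    apply locally_R in H2; destruct H2 as [d [Hd H2]].
    assert (Hm : 0 < Rmin d (e / 2)) by (apply Rmin_pos; lra).
    exists (mkposreal _ Hm); intros _; exists (e / 2); simpl; split; [apply Rmin_r|]; split.
    - intros x Hx; apply H2; eapply Rlt_le_trans; [exact Hx | apply Rmin_l].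
    - intros w Hw; apply H1; lra. }
  destruct (compactness_value_1d a b (fun t => proj1_sig (loc t))) as [d Hd].
  exists d; split; [apply cond_pos|]; intros x Hx w Hw.
  apply NNPP; intros N; apply (Hd x Hx); intros [t [Ht [H1 H2]]]; apply N.
  destruct (loc t) as [dt Hdt]; simpl in H1, H2.
  destruct (Hdt Ht) as [e [E1 [E2 E3]]].
  assert (A1 := E2 x H1).
  assert (A2 := E3 (p x) ltac:(assert (P := cond_pos dt); lra)).
  assert (A3 : Cmod (w - p t) < 2 * e) by (assert (A := Cmod_triangle_minus w (p x) (p t)); lra).
  assert (A4 := E3 w A3).
  assert (A5 := Cmod_triangle_minus (f w) (f (p t)) (f (p x))).
  rewrite (Cmod_minus_sym (f (p t))) in A5; lra.
Qed.

(** The difference quotients of [F] converge uniformly along the curve because [F' = f]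
    is uniformly continuous near it; this is why continuity of [f] is assumed. *)
Lemma is_derive_CInt_param (F f : C -> C) (z : C) (r a b : R) (al be k : R -> C) (x : C) :
  (forall w, Cmod (w - z) < r -> is_derive F w (f w)) ->
  (forall w, Cmod (w - z) < r -> continuous f w) ->
  a <= b -> cont_on al a b -> cont_on be a b -> cont_on k a b ->
  (forall t, a <= t <= b -> Cmod (al t + x * be t - z) < r) ->
  is_derive (fun y => CInt (fun t => F (al t + y * be t) * k t)%C a b) x
    (CInt (fun t => f (al t + x * be t) * be t * k t)%C a b).
Proof.
  intros HF Hf Hab Hal Hbe Hk Hx.
  assert (HFc : forall w, Cmod (w - z) < r -> continuous F w).
  { intros w Hw; exact (is_derive_C_continuous F w _ (HF w Hw)). }
  assert (Hcurve : forall y, cont_on (fun t => al t + y * be t)%C a b).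
  { intros y; apply cont_on_plus; [exact Hal|]; apply cont_on_mult; [apply cont_on_const|].
    exact Hbe. }
  assert (Hcomp : forall (g : C -> C) y, (forall w, Cmod (w - z) < r -> continuous g w) ->
    (forall t, a <= t <= b -> Cmod (al t + y * be t - z) < r) ->
    cont_on (fun t => g (al t + y * be t)%C) a b).
  { intros g y Hg Hy t Ht; apply (continuous_comp (fun t => al t + y * be t)%C g).
    - apply Hcurve, Ht.
    - apply Hg, Hy, Ht. }
  destruct (cont_on_bounded be a b Hab Hbe) as [M [HM0 HM]].
  destruct (cont_on_bounded k a b Hab Hk) as [N [HN0 HN]].
  apply is_derive_C_eps; intros eps He.
  set (S := (b - a + 1) * (M + 1) * (N + 1)).
  assert (HS : 0 < S) by (unfold S; repeat apply Rmult_lt_0_compat; lra).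
  set (e1 := eps / S).
  assert (He1 : 0 < e1) by (apply Rdiv_lt_0_compat; lra).
  destruct (uniform_along_curve f (fun t => al t + x * be t)%C a b e1 (Hcurve x)) as [d [Hd H1]].
  { intros t Ht; apply Hf, Hx, Ht. }
  { exact He1. }
  assert (Hroom : exists d2, 0 < d2 /\ forall t, a <= t <= b ->
    Cmod (al t + x * be t - z) <= r - d2).
  { destruct (continuity_ab_maj (fun t => Cmod (al t + x * be t - z)) a b Hab) as [m [Hm Hm2]].
    - intros t Ht; apply continuity_pt_filterlim.
      apply (continuous_Cmod (T := R_UniformSpace)).
      apply (continuous_Cminus (T := R_UniformSpace)); [apply Hcurve, Ht|].
      apply continuous_const.
    - exists (r - Cmod (al m + x * be m - z)%C); split; [assert (A := Hx m Hm2); lra|].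
      intros t Ht; assert (A := Hm t Ht); simpl in A; lra. }
  destruct Hroom as [d2 [Hd2 H2]].
  exists (Rmin d d2 / (M + 1)); split.
  { apply Rdiv_lt_0_compat; [apply Rmin_pos; assumption | lra]. }
  intros y Hy; apply Rlt_div_r in Hy; [|lra].
  assert (Hyx := Cmod_ge_0 (y - x)).
  assert (Hdist : forall t, a <= t <= b ->
    Cmod (al t + y * be t - (al t + x * be t)) <= M * Cmod (y - x)).
  { intros t Ht; replace (_ - _)%C with ((y - x) * be t)%C by ring.
    rewrite Cmod_mult, Rmult_comm; apply Rmult_le_compat_r; [lra | apply HM, Ht]. }
  assert (Hsmall : M * Cmod (y - x) < Rmin d d2) by nra.
  assert (Hs1 := Rlt_le_trans _ _ _ Hsmall (Rmin_l _ _)).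
  assert (Hs2 := Rlt_le_trans _ _ _ Hsmall (Rmin_r _ _)).
  assert (Hyz : forall t, a <= t <= b -> Cmod (al t + y * be t - z) < r).
  { intros t Ht; assert (A := Hdist t Ht); assert (A2 := H2 t Ht).
    assert (A3 := Cmod_triangle_minus (al t + y * be t) (al t + x * be t) z); lra. }
  assert (CFy := cont_on_mult _ _ _ _ (Hcomp F y HFc Hyz) Hk).
  assert (CFx := cont_on_mult _ _ _ _ (Hcomp F x HFc Hx) Hk).
  assert (Cfx := cont_on_mult _ _ _ _ (cont_on_mult _ _ _ _ (Hcomp f x Hf Hx) Hbe) Hk).
  assert (CFd : cont_on (fun t => F (al t + y * be t)%C * k t - F (al t + x * be t)%C * k t)%C
    a b) by (intros t Ht; apply continuous_Cminus; [apply CFy | apply CFx]; exact Ht).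
  assert (Cfs : cont_on (fun t => (y - x) * (f (al t + x * be t)%C * be t * k t))%C a b)
    by (apply cont_on_mult; [apply cont_on_const | exact Cfx]).
  rewrite <- CInt_minus, <- CInt_scal, <- CInt_minus by assumption.
  apply Rle_trans with ((b - a) * (e1 * (M * Cmod (y - x)) * N)).
  - apply CInt_bound; [exact Hab| |].
    + intros t Ht; apply continuous_Cminus; [apply continuous_Cminus|].
      * apply CFy, Ht.
      * apply CFx, Ht.
      * apply continuous_Cmult; [apply continuous_const | apply Cfx, Ht].
    + intros t Ht; set (w := (al t + y * be t)%C); set (p := (al t + x * be t)%C).
      replace (_ - _ - _)%C with ((F w - F p - (w - p) * f p) * k t)%C
        by (unfold w, p; ring).
      rewrite Cmod_mult; apply Rmult_le_compat; try apply Cmod_ge_0; [|apply HN, Ht].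
      assert (Hw := Hyz t Ht); assert (Hp := Hx t Ht); assert (Hwp := Hdist t Ht).
      fold w in Hw, Hwp; fold p in Hp, Hwp.
      rewrite <- (seg_int_primitive F f p w).
      * apply Rle_trans with (e1 * Cmod (w - p)); [|apply Rmult_le_compat_l; lra].
        apply seg_int_const_error; [apply (on_seg_disk f z p w r); assumption|].
        intros s Hs; left; apply (H1 t Ht); fold p.
        apply Cmod_seg_lt; [exact Hs| | lra].
        replace (p - p)%C with (RtoC 0) by ring; rewrite Cmod_0; lra.
      * intros s Hs; apply HF, Cmod_seg_lt; assumption.
      * apply (on_seg_disk f z p w r); assumption.
  - replace eps with (e1 * S) by (unfold e1; field; lra).
    replace ((b - a) * (e1 * (M * Cmod (y - x)) * N)) with
      (e1 * ((b - a) * M * N) * Cmod (y - x)) by ring.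
    apply Rmult_le_compat_r; [exact Hyx|]; apply Rmult_le_compat_l; [lra|].
    assert (0 <= (b - a) * M) by (apply Rmult_le_pos; lra).
    unfold S; apply Rmult_le_compat; try lra; apply Rmult_le_compat; lra.
Qed.

(** * Averages over circles, and derivatives of all orders *)

(** The function [exp (i m t)]; the frequency [m] is real so that negative powers belong
    to the same family. *)
Definition expi (m t : R) : C := (cos (m * t), sin (m * t)).

Lemma expi_plus (m n t : R) : (expi m t * expi n t)%C = expi (m + n) t.
Proof.
  unfold expi; rewrite Rmult_plus_distr_r, cos_plus, sin_plus.
  apply injective_projections; simpl; ring.
Qed.

Lemma expi_0 (t : R) : expi 0 t = RtoC 1.
Proof. unfold expi; rewrite Rmult_0_l, cos_0, sin_0; reflexivity. Qed.

Lemma expi_period (n : nat) : expi (- INR n) (2 * PI) = expi (- INR n) 0.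
Proof.
  unfold expi; rewrite Rmult_0_r.
  replace (- INR n * (2 * PI)) with (- (0 + 2 * INR n * PI)) by ring.
  rewrite cos_neg, sin_neg, cos_period, sin_period, sin_0, Ropp_0; reflexivity.
Qed.

Lemma expi_1_period : expi 1 (2 * PI) = expi 1 0.
Proof. unfold expi; rewrite Rmult_0_r, Rmult_1_l, cos_2PI, sin_2PI, cos_0, sin_0; reflexivity. Qed.

Lemma Cmod_expi (m t : R) : Cmod (expi m t) = 1.
Proof.
  unfold Cmod, expi; simpl fst; simpl snd.
  replace (cos (m * t) ^ 2 + sin (m * t) ^ 2) with 1; [apply sqrt_1|].
  assert (A := sin2_cos2 (m * t)); unfold Rsqr in A; simpl; lra.
Qed.

Lemma is_derive_expi (m t : R) :
  is_derive (K := R_AbsRing) (V := C_R_NormedModule) (expi m) t (Ci * RtoC m * expi m t)%C.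
Proof.
  replace (Ci * RtoC m * expi m t)%C with
    ((m * - sin (m * t), m * cos (m * t)) : C)
    by (unfold expi; apply injective_projections; simpl; ring).
  apply is_derive_curve_pair; auto_derive; trivial; ring.
Qed.

Lemma continuous_expi (m t : R) : continuous (expi m) t.
Proof.
  apply (continuous_C_pair (T := R_UniformSpace)); simpl;
    apply (ex_derive_continuous (K := R_AbsRing) (V := R_NormedModule)); auto_derive; trivial.
Qed.

Lemma is_derive_curve_mult (f g : R -> C) (t : R) (l m : C) :
  is_derive (K := R_AbsRing) (V := C_R_NormedModule) f t l ->
  is_derive (K := R_AbsRing) (V := C_R_NormedModule) g t m ->
  is_derive (K := R_AbsRing) (V := C_R_NormedModule) (fun s => f s * g s)%C t
    (l * g t + f t * m)%C.
Proof.
  assert (cp : forall (h : R -> C) (n : C),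
    is_derive (K := R_AbsRing) (V := C_R_NormedModule) h t n ->
    is_derive (fun s => fst (h s)) t (fst n) /\ is_derive (fun s => snd (h s)) t (snd n)).
  { intros h n H; split; apply is_derive_Reals; intros eps He;
      destruct (proj1 (is_derive_curve_eps _ _ _) H (eps / 2) ltac:(lra)) as [d [Hd H1]];
      exists (mkposreal d Hd); intros x Hx Hxd; simpl in Hxd;
      assert (A := H1 (t + x) ltac:(replace (t + x - t) with x by ring; exact Hxd));
      replace (t + x - t) with x in A by ring;
      assert (B := Rmax_Cmod (h (t + x)%R - h t - RtoC x * n)%C);
      assert (B1 := Rmax_l (Rabs (fst (h (t + x)%R - h t - RtoC x * n)%C))
        (Rabs (snd (h (t + x)%R - h t - RtoC x * n)%C)));
      assert (B2 := Rmax_r (Rabs (fst (h (t + x)%R - h t - RtoC x * n)%C))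
        (Rabs (snd (h (t + x)%R - h t - RtoC x * n)%C)));
      assert (P : 0 < Rabs x) by (apply Rabs_pos_lt, Hx); simpl in B, B1, B2.
    - replace ((fst (h (t + x)) - fst (h t)) / x - fst n) with
        ((fst (h (t + x)) + - fst (h t) + - (x * fst n - 0 * snd n)) / x) by (field; exact Hx).
      unfold Rdiv; rewrite Rabs_mult, Rabs_inv; apply Rlt_div_l; [exact P | nra].
    - replace ((snd (h (t + x)) - snd (h t)) / x - snd n) with
        ((snd (h (t + x)) + - snd (h t) + - (x * snd n + 0 * fst n)) / x) by (field; exact Hx).
      unfold Rdiv; rewrite Rabs_mult, Rabs_inv; apply Rlt_div_l; [exact P | nra]. }
  intros Hf Hg; destruct (cp f l Hf) as [F1 F2]; destruct (cp g m Hg) as [G1 G2].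
  apply (is_derive_ext (K := R_AbsRing) (V := C_R_NormedModule)
    (fun s => (fst (f s) * fst (g s) - snd (f s) * snd (g s),
               fst (f s) * snd (g s) + snd (f s) * fst (g s)) : C)); [reflexivity|].
  replace (l * g t + f t * m)%C with
    ((fst l * fst (g t) + fst (f t) * fst m - (snd l * snd (g t) + snd (f t) * snd m),
      fst l * snd (g t) + fst (f t) * snd m + (snd l * fst (g t) + snd (f t) * fst m)) : C)
    by (apply injective_projections; simpl; ring).
  apply is_derive_curve_pair.
  - apply (is_derive_minus (K := R_AbsRing) (V := R_NormedModule));
      apply (is_derive_mult (K := R_AbsRing)); trivial; intros; apply Rmult_comm.
  - apply (is_derive_plus (K := R_AbsRing) (V := R_NormedModule));
      apply (is_derive_mult (K := R_AbsRing)); trivial; intros; apply Rmult_comm.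
Qed.

Lemma is_derive_circle (z c : C) (m t : R) :
  is_derive (K := R_AbsRing) (V := C_R_NormedModule) (fun s => z + c * expi m s)%C t
    (Ci * RtoC m * expi m t * c)%C.
Proof.
  apply (is_derive_comp_curve (fun w => z + c * w)%C (expi m)).
  - apply is_derive_C_eps; intros eps He; exists 1; split; [lra|]; intros w _.
    replace (_ - _ - _)%C with (RtoC 0) by ring; rewrite Cmod_0.
    apply Rmult_le_pos; [lra | apply Cmod_ge_0].
  - apply is_derive_expi.
Qed.

Lemma two_pi_pos : 0 <= 2 * PI.
Proof. assert (H := PI_RGT_0); lra. Qed.

Lemma cont_on_expi (m a b : R) : cont_on (expi m) a b.
Proof. intros t _; apply continuous_expi. Qed.

Lemma cont_on_comp_disk (g : C -> C) (z : C) (r a b : R) (p : R -> C) :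
  (forall w, Cmod (w - z) < r -> continuous g w) -> cont_on p a b ->
  (forall t, a <= t <= b -> Cmod (p t - z) < r) -> cont_on (fun t => g (p t)) a b.
Proof.
  intros Hg Hp Hr t Ht; apply (continuous_comp p g); [apply Hp, Ht | apply Hg, Hr, Ht].
Qed.

Lemma cont_on_circle (z c : C) (m a b : R) : cont_on (fun t => z + c * expi m t)%C a b.
Proof.
  apply cont_on_plus; [apply cont_on_const|].
  apply cont_on_mult; [apply cont_on_const | apply cont_on_expi].
Qed.

(** The derivative of the average with respect to the complex radius [c] is the
    integral of a derivative over a period. *)
Lemma mean_value (F f : C -> C) (z : C) (r : R) (c : C) :
  (forall w, Cmod (w - z) < r -> is_derive F w (f w)) ->
  (forall w, Cmod (w - z) < r -> continuous f w) ->
  Cmod c < r ->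
  CInt (fun t => F (z + c * expi 1 t))%C 0 (2 * PI) = (RtoC (2 * PI) * F z)%C.
Proof.
  intros HF Hf Hc.
  assert (Hin : forall x t, Cmod x < r -> Cmod (z + x * expi 1 t - z) < r).
  { intros x t Hx; replace (z + x * expi 1 t - z)%C with (x * expi 1 t)%C by ring.
    rewrite Cmod_mult, Cmod_expi, Rmult_1_r; exact Hx. }
  pose (N := fun x => CInt (fun t => F (z + x * expi 1 t) * 1)%C 0 (2 * PI)).
  assert (HN : forall x, Cmod x < r -> is_derive N x (RtoC 0)).
  { intros x Hx.
    replace (RtoC 0) with
      (CInt (fun t => f (z + x * expi 1 t) * expi 1 t * 1)%C 0 (2 * PI)).
    { apply (is_derive_CInt_param F f z r 0 (2 * PI) (fun _ => z) (expi 1) (fun _ => RtoC 1) x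
        HF Hf two_pi_pos).
      - apply cont_on_const.
      - apply cont_on_expi.
      - apply cont_on_const.
      - intros t _; apply Hin, Hx. }
    assert (Hcf : cont_on (fun t => f (z + x * expi 1 t)%C) 0 (2 * PI)).
    { apply (cont_on_comp_disk f z r); [exact Hf | apply cont_on_circle|].
      intros t _; apply Hin, Hx. }
    destruct (classic (x = RtoC 0)) as [Ex|Ex].
    - rewrite Ex.
      rewrite (CInt_ext _ (fun t => f z / Ci * (Ci * RtoC 1 * expi 1 t))%C).
      2: exact two_pi_pos.
      2: { intros t _; replace (z + 0 * expi 1 t)%C with z by ring; field.
           intros E; apply (f_equal snd) in E; simpl in E; lra. }
      rewrite CInt_scal.
      2: exact two_pi_pos.
      2: { apply cont_on_mult; [apply cont_on_const | apply cont_on_expi]. }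
      rewrite (CInt_derive (expi 1)).
      2: exact two_pi_pos.
      2: { intros t _; apply is_derive_expi. }
      2: { apply cont_on_mult; [apply cont_on_const | apply cont_on_expi]. }
      rewrite expi_1_period; ring.
    - rewrite (CInt_ext _ (fun t => / (Ci * x) *
        (Ci * RtoC 1 * expi 1 t * x * f (z + x * expi 1 t)))%C).
      2: exact two_pi_pos.
      2: { intros t _; field; split; [exact Ex|].
           intros E; apply (f_equal snd) in E; simpl in E; lra. }
      assert (Hc2 : cont_on (fun t => Ci * RtoC 1 * expi 1 t * x * f (z + x * expi 1 t))%C
        0 (2 * PI)).
      { apply cont_on_mult; [|exact Hcf]; apply cont_on_mult; [|apply cont_on_const].
        apply cont_on_mult; [apply cont_on_const | apply cont_on_expi]. }
      rewrite CInt_scal by (exact two_pi_pos || exact Hc2).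
      rewrite (CInt_derive (fun t => F (z + x * expi 1 t)%C)).
      2: exact two_pi_pos.
      2: { intros t _; apply (is_derive_comp_curve F (fun t => z + x * expi 1 t)%C).
           - apply HF, Hin, Hx.
           - apply is_derive_circle. }
      2: exact Hc2.
      rewrite expi_1_period; ring. }
  assert (Hr0 : Cmod 0 < r) by (rewrite Cmod_0; eapply Rle_lt_trans; [apply Cmod_ge_0 | exact Hc]).
  assert (E : seg_int (fun _ => RtoC 0) 0 c = (N c - N 0)%C).
  { apply (seg_int_primitive N (fun _ => RtoC 0)).
    - intros t Ht; apply HN.
      replace (seg 0 c t) with (seg 0 c t - 0)%C by ring; apply Cmod_seg_lt; [exact Ht| |];
        unfold Cminus; rewrite Copp_0, Cplus_0_r; assumption.
    - intros t _; apply continuous_const. }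
  unfold seg_int in E; rewrite CInt_const in E.
  assert (E1 : N 0 = (RtoC (2 * PI) * F z)%C).
  { unfold N; rewrite (CInt_ext _ (fun _ => F z)).
    - rewrite CInt_const, Rminus_0_r; reflexivity.
    - exact two_pi_pos.
    - intros t _; rewrite Cmult_0_l, Cplus_0_r, Cmult_1_r; reflexivity. }
  rewrite <- E1; transitivity (N c).
  - apply CInt_ext; [exact two_pi_pos|]; intros t _; ring.
  - replace (N c) with (N 0 + (N c - N 0))%C by ring; rewrite <- E; ring.
Qed.

(** By Cauchy's formula this is the [n]-th derivative of [F] at [z], up to a constant
    factor. *)
Definition cauchy_int (F : C -> C) (s : R) (n : nat) (z : C) : C :=
  CInt (fun t => F (z + RtoC s * expi 1 t) * expi (- INR n) t)%C 0 (2 * PI).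

(** Differentiation under the integral sign replaces [F] by [f]; integration by parts over
    a period turns [f] back into [F] and lowers the frequency. *)
Lemma is_derive_cauchy_int (F f : C -> C) (a z : C) (r s : R) (n : nat) :
  (forall w, Cmod (w - a) < r -> is_derive F w (f w)) ->
  (forall w, Cmod (w - a) < r -> continuous f w) ->
  0 < s -> Cmod (z - a) + s < r ->
  is_derive (cauchy_int F s n) z (RtoC (INR (S n) / s) * cauchy_int F s (S n) z)%C.
Proof.
  intros HF Hf Hs Hz.
  assert (HFc : forall w, Cmod (w - a) < r -> continuous F w).
  { intros w Hw; exact (is_derive_C_continuous F w _ (HF w Hw)). }
  assert (Hin : forall t, Cmod (z + RtoC s * expi 1 t - a) < r).
  { intros t; assert (A := Cmod_triangle (z - a) (RtoC s * expi 1 t)).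
    rewrite Cmod_mult, Cmod_expi, Cmod_R, Rabs_pos_eq in A by lra.
    replace (z + RtoC s * expi 1 t - a)%C with ((z - a) + RtoC s * expi 1 t)%C by ring; lra. }
  assert (HcF : cont_on (fun t => F (z + RtoC s * expi 1 t)%C) 0 (2 * PI)).
  { apply (cont_on_comp_disk F a r); [exact HFc | apply cont_on_circle|]; intros t _; apply Hin. }
  assert (Hcf : cont_on (fun t => f (z + RtoC s * expi 1 t)%C) 0 (2 * PI)).
  { apply (cont_on_comp_disk f a r); [exact Hf | apply cont_on_circle|]; intros t _; apply Hin. }
  assert (D := is_derive_CInt_param F f a r 0 (2 * PI) (fun t => RtoC s * expi 1 t)%C
    (fun _ => RtoC 1) (expi (- INR n)) z HF Hf two_pi_pos).
  assert (E : CInt (fun t => f (RtoC s * expi 1 t + z * 1) * 1 * expi (- INR n) t)%C 0 (2 * PI)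
    = (RtoC (INR (S n) / s) * cauchy_int F s (S n) z)%C).
  { (* integration by parts over a period *)
    set (A := fun t => (Ci * RtoC 1 * expi 1 t * RtoC s * f (z + RtoC s * expi 1 t) *
      expi (- INR (S n)) t)%C).
    set (B := fun t => (F (z + RtoC s * expi 1 t) *
      (Ci * RtoC (- INR (S n)) * expi (- INR (S n)) t))%C).
    assert (HA : cont_on A 0 (2 * PI)).
    { apply cont_on_mult; [|apply cont_on_expi]; apply cont_on_mult; [|exact Hcf].
      apply cont_on_mult; [|apply cont_on_const].
      apply cont_on_mult; [apply cont_on_const | apply cont_on_expi]. }
    assert (HB : cont_on B 0 (2 * PI)).
    { apply cont_on_mult; [exact HcF|].
      apply cont_on_mult; [apply cont_on_const | apply cont_on_expi]. }
    assert (Z : (CInt A 0 (2 * PI) + CInt B 0 (2 * PI))%C = RtoC 0).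
    { rewrite <- CInt_plus by (exact two_pi_pos || assumption).
      rewrite (CInt_derive (fun t => F (z + RtoC s * expi 1 t) * expi (- INR (S n)) t)%C).
      - rewrite expi_1_period, expi_period; ring.
      - exact two_pi_pos.
      - intros t _; apply is_derive_curve_mult; [|apply is_derive_expi].
        apply (is_derive_comp_curve F (fun t => z + RtoC s * expi 1 t)%C).
        + apply HF, Hin.
        + apply is_derive_circle.
      - intros t Ht; apply continuous_Cplus; [apply HA | apply HB]; exact Ht. }
    assert (EA : CInt A 0 (2 * PI) = (Ci * RtoC s *
      CInt (fun t => f (RtoC s * expi 1 t + z * 1) * 1 * expi (- INR n) t) 0 (2 * PI))%C).
    { rewrite <- CInt_scal.
      - apply CInt_ext; [exact two_pi_pos|]; intros t _; unfold A.
        replace (expi (- INR n) t) with (expi 1 t * expi (- INR (S n)) t)%C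
          by (rewrite expi_plus; f_equal; rewrite S_INR; ring).
        replace (RtoC s * expi 1 t + z * 1)%C with (z + RtoC s * expi 1 t)%C by ring; ring.
      - exact two_pi_pos.
      - apply cont_on_mult; [|apply cont_on_expi]; apply cont_on_mult; [|apply cont_on_const].
        intros t Ht; apply (continuous_ext (fun t => f (z + RtoC s * expi 1 t)%C)).
        + intros x; f_equal; ring.
        + apply Hcf, Ht. }
    assert (EB : CInt B 0 (2 * PI) = (- (Ci * RtoC (INR (S n))) * cauchy_int F s (S n) z)%C).
    { unfold cauchy_int; rewrite <- CInt_scal.
      - apply CInt_ext; [exact two_pi_pos|]; intros t _; unfold B.
        rewrite RtoC_opp; ring.
      - exact two_pi_pos.
      - apply cont_on_mult; [exact HcF | apply cont_on_expi]. }
    rewrite EA, EB in Z.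
    set (X := CInt (fun t => f (RtoC s * expi 1 t + z * 1) * 1 * expi (- INR n) t)%C 0 (2 * PI))
      in *.
    set (Y := cauchy_int F s (S n) z) in *.
    assert (Hs' : RtoC s <> RtoC 0) by (intros E; apply RtoC_inj in E; lra).
    assert (HCi : Ci <> RtoC 0) by (intros E; apply (f_equal snd) in E; simpl in E; lra).
    assert (Z1 : (Ci * RtoC s * X)%C = (Ci * RtoC (INR (S n)) * Y)%C).
    { replace (Ci * RtoC s * X)%C with ((Ci * RtoC s * X + - (Ci * RtoC (INR (S n))) * Y) +
        Ci * RtoC (INR (S n)) * Y)%C by ring; rewrite Z; ring. }
    replace X with (/ (Ci * RtoC s) * (Ci * RtoC s * X))%C by (field; split; assumption).
    rewrite Z1, RtoC_div by lra; field; split; assumption. }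
  rewrite <- E.
  apply (is_derive_ext (K := C_AbsRing) (V := C_NormedModule)
    (fun y => CInt (fun t => F (RtoC s * expi 1 t + y * 1) * expi (- INR n) t)%C 0 (2 * PI))).
  { intros y; apply CInt_ext; [exact two_pi_pos|]; intros t _; do 2 f_equal; ring. }
  apply D.
  - apply cont_on_mult; [apply cont_on_const | apply cont_on_expi].
  - apply cont_on_const.
  - apply cont_on_expi.
  - intros t _; replace (RtoC s * expi 1 t + z * 1 - a)%C with (z + RtoC s * expi 1 t - a)%C
      by ring; apply Hin.
Qed.

(** A local primitive [F] of [f] has a continuous derivative, hence is a multiple of
    [cauchy_int F s 0], which can be differentiated arbitrarily often. *)
Lemma holomorphic_derive (f df : C -> C) (U : C -> Prop) :
  open U -> (forall w, U w -> is_derive f w (df w)) ->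
  forall w, U w -> ex_derive df w.
Proof.
  intros HU Hf a Ha.
  destruct (open_ball U a HU Ha) as [r [Hr Hball]].
  set (F := disk_primitive f a).
  assert (HF : forall w, Cmod (w - a) < r -> is_derive F w (f w)).
  { apply is_derive_disk_primitive; intros w Hw; exists (df w); apply Hf, Hball, Hw. }
  assert (Hfc : forall w, Cmod (w - a) < r -> continuous f w).
  { intros w Hw; exact (is_derive_C_continuous f w _ (Hf w (Hball w Hw))). }
  set (s := r / 2).
  assert (Hs : 0 < s) by (unfold s; lra).
  assert (D : forall n w, Cmod (w - a) < s ->
    is_derive (cauchy_int F s n) w (RtoC (INR (S n) / s) * cauchy_int F s (S n) w)%C).
  { intros n w Hw; apply (is_derive_cauchy_int F f a w r); auto; unfold s in *; lra. }
  assert (loc : forall w, Cmod (w - a) < s -> locally w (fun x => Cmod (x - a) < s))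
    by (intros w Hw; apply (open_disk a s w Hw)).
  assert (E0 : forall w, Cmod (w - a) < s ->
    F w = (/ RtoC (2 * PI) * cauchy_int F s 0 w)%C).
  { intros w Hw; unfold cauchy_int.
    rewrite (CInt_ext _ (fun t => F (w + RtoC s * expi 1 t)%C)).
    - rewrite (mean_value F f w (r - Cmod (w - a))).
      + field; intros E; apply RtoC_inj in E; assert (H := PI_RGT_0); lra.
      + intros x Hx; apply HF; assert (A := Cmod_triangle_minus x w a); lra.
      + intros x Hx; apply Hfc; assert (A := Cmod_triangle_minus x w a); lra.
      + rewrite Cmod_R, Rabs_pos_eq by lra; unfold s in *; lra.
    - exact two_pi_pos.
    - intros t _; simpl INR; rewrite Ropp_0, expi_0; ring. }
  assert (step : forall (g dg : C -> C) (k : C) (n : nat),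
    (forall w, Cmod (w - a) < s -> g w = (k * cauchy_int F s n w)%C) ->
    (forall w, Cmod (w - a) < s -> is_derive g w (dg w)) ->
    forall w, Cmod (w - a) < s ->
      dg w = (k * RtoC (INR (S n) / s) * cauchy_int F s (S n) w)%C).
  { intros g dg k n Hg Hdg w Hw; apply (is_derive_C_unique g w); [apply Hdg, Hw|].
    apply (is_derive_C_ext_loc (fun w => k * cauchy_int F s n w)%C).
    - generalize (loc w Hw); apply filter_imp; intros x Hx; symmetry; apply Hg, Hx.
    - rewrite <- Cmult_assoc.
      apply is_derive_Cscal, D, Hw. }
  assert (E1 := step F f _ _ E0 (fun w Hw => HF w ltac:(unfold s in *; lra))).
  assert (E2 := step f df _ _ E1 (fun w Hw => Hf w (Hball w ltac:(unfold s in *; lra)))).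
  assert (Ha0 : Cmod (a - a) < s)
    by (replace (a - a)%C with (RtoC 0) by ring; rewrite Cmod_0; exact Hs).
  set (k := (/ RtoC (2 * PI) * RtoC (INR 1 / s) * RtoC (INR 2 / s))%C).
  eexists; apply (is_derive_C_ext_loc (fun w => k * cauchy_int F s 2 w)%C).
  - generalize (loc a Ha0); apply filter_imp; intros x Hx; symmetry; apply E2, Hx.
  - apply is_derive_Cscal, D, Ha0.
Qed.

(** * Second order expansions *)

Definition little_o2 (g : C -> R) (a : C) : Prop :=
  forall eps, 0 < eps -> locally a (fun w => Rabs (g w) <= eps * Cmod (w - a) ^ 2).

Definition jet_poly (al be : C) (tau : R) (z : C) : R :=
  Re (al * z + be * z ^ 2) + tau / 4 * Cmod z ^ 2.

(** A second order Taylor expansion at [a] in which the quadratic part is split into the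
    real part of a complex square and a multiple of the squared modulus, so that [tau]
    is the Laplacian.  No partial derivatives occur, so that composition with another
    function amounts to substituting one expansion into the other. *)
Definition jet2 (h : C -> R) (a al be : C) (tau : R) : Prop :=
  little_o2 (fun w => h w - h a - jet_poly al be tau (w - a)) a.

Lemma locally_and (a : C) (P Q : C -> Prop) :
  locally a P -> locally a Q -> locally a (fun w => P w /\ Q w).
Proof. apply filter_and. Qed.

Lemma little_o2_le (f g : C -> R) (a : C) (K : R) :
  locally a (fun w => Rabs (f w) <= K * Rabs (g w)) -> little_o2 g a -> little_o2 f a.
Proof.
  intros H Hg eps He.
  assert (HK : 0 < Rabs K + 1) by (assert (A := Rabs_pos K); lra).
  assert (A := Hg (eps / (Rabs K + 1)) ltac:(apply Rdiv_lt_0_compat; lra)).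
  generalize (locally_and _ _ _ H A); apply filter_imp; intros w [H1 H2].
  assert (P := Rabs_pos (g w)); assert (P2 := Rle_abs K).
  eapply Rle_trans; [exact H1|].
  apply Rle_trans with ((Rabs K + 1) * (eps / (Rabs K + 1) * Cmod (w - a) ^ 2)).
  - apply Rle_trans with ((Rabs K + 1) * Rabs (g w)); [nra|].
    apply Rmult_le_compat_l; lra.
  - right; field; lra.
Qed.

Lemma little_o2_plus (f g : C -> R) (a : C) :
  little_o2 f a -> little_o2 g a -> little_o2 (fun w => f w + g w) a.
Proof.
  intros Hf Hg eps He.
  generalize (locally_and _ _ _ (Hf (eps / 2) ltac:(lra)) (Hg (eps / 2) ltac:(lra))).
  apply filter_imp; intros w [H1 H2].
  eapply Rle_trans; [apply Rabs_triang | lra].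
Qed.

Lemma little_o2_scal (f : C -> R) (a : C) (k : R) : little_o2 f a -> little_o2 (fun w => k * f w) a.
Proof.
  intros Hf; apply (little_o2_le _ f a (Rabs k)); [|exact Hf].
  apply filter_forall; intros w; rewrite Rabs_mult; lra.
Qed.

Lemma little_o2_ext_loc (f g : C -> R) (a : C) :
  locally a (fun w => f w = g w) -> little_o2 f a -> little_o2 g a.
Proof.
  intros H; apply (little_o2_le g f a 1); revert H; apply filter_imp; intros w ->; lra.
Qed.

Lemma little_o2_cubic (f : C -> R) (a : C) (K : R) :
  locally a (fun w => Rabs (f w) <= K * Cmod (w - a) ^ 3) -> little_o2 f a.
Proof.
  intros H eps He.
  assert (HK : 0 < Rabs K + 1) by (assert (A := Rabs_pos K); lra).
  assert (A : locally a (fun w => Cmod (w - a) < eps / (Rabs K + 1))).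
  { apply locally_Cmod; exists (eps / (Rabs K + 1)); split;
      [apply Rdiv_lt_0_compat; lra | auto]. }
  generalize (locally_and _ _ _ H A); apply filter_imp; intros w [H1 H2].
  apply Rlt_div_r in H2; [|exact HK].
  eapply Rle_trans; [exact H1|].
  assert (P := Cmod_ge_0 (w - a)); assert (P2 := Rle_abs K).
  replace (K * Cmod (w - a) ^ 3) with ((K * Cmod (w - a)) * Cmod (w - a) ^ 2) by ring.
  apply Rmult_le_compat_r; [apply pow_le, P | nra].
Qed.

Lemma locally_Cmod_lt (a : C) (d : R) : 0 < d -> locally a (fun w => Cmod (w - a) < d).
Proof. intros Hd; apply locally_Cmod; exists d; auto. Qed.

Lemma Re_mult_le (al z : C) : Rabs (Re (al * z)) <= Cmod al * Cmod z.
Proof. rewrite <- Cmod_mult; apply re_le_Cmod. Qed.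

Lemma jet_poly_linear_error (al be : C) (tau : R) (z : C) :
  Rabs (jet_poly al be tau z - Re (al * z)) <= (Cmod be + Rabs tau) * Cmod z ^ 2.
Proof.
  unfold jet_poly; rewrite re_plus.
  replace (_ - _) with (Re (be * z ^ 2) + tau / 4 * Cmod z ^ 2) by ring.
  eapply Rle_trans; [apply Rabs_triang|].
  assert (A := Re_mult_le be (z ^ 2)%C); rewrite Cmod_pow in A.
  assert (P : 0 <= Cmod z ^ 2) by (apply pow_le, Cmod_ge_0).
  rewrite Rabs_mult, (Rabs_pos_eq (Cmod z ^ 2)) by exact P.
  assert (B : Rabs (tau / 4) <= Rabs tau).
  { unfold Rdiv; rewrite Rabs_mult, (Rabs_pos_eq (/ 4)) by lra.
    assert (Q := Rabs_pos tau); lra. }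
  nra.
Qed.

Lemma jet_poly_bound (al be : C) (tau : R) (z : C) :
  Cmod z <= 1 -> Rabs (jet_poly al be tau z) <= (Cmod al + Cmod be + Rabs tau) * Cmod z.
Proof.
  intros Hz; assert (A := jet_poly_linear_error al be tau z).
  assert (B := Re_mult_le al z); assert (P := Cmod_ge_0 z).
  assert (Q : 0 <= Cmod be + Rabs tau)
    by (assert (Q1 := Cmod_ge_0 be); assert (Q2 := Rabs_pos tau); lra).
  replace (jet_poly al be tau z) with ((jet_poly al be tau z - Re (al * z)) + Re (al * z)) by ring.
  eapply Rle_trans; [apply Rabs_triang|].
  assert (Cmod z ^ 2 <= Cmod z) by (simpl; nra); nra.
Qed.

Section Expansion.
Variables (h : C -> R) (a al be : C) (tau : R).
Hypothesis Hh : jet2 h a al be tau.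

Lemma jet2_linear_error :
  exists K, locally a (fun w => Rabs (h w - h a - Re (al * (w - a))) <= K * Cmod (w - a) ^ 2).
Proof.
  exists (Cmod be + Rabs tau + 1); generalize (Hh 1 Rlt_0_1); apply filter_imp; intros w H.
  assert (A := jet_poly_linear_error al be tau (w - a)).
  replace (h w - h a - Re (al * (w - a))) with
    ((h w - h a - jet_poly al be tau (w - a)) +
     (jet_poly al be tau (w - a) - Re (al * (w - a)))) by ring.
  eapply Rle_trans; [apply Rabs_triang | lra].
Qed.

Lemma jet2_lipschitz :
  exists K, 0 < K /\ locally a (fun w => Rabs (h w - h a) <= K * Cmod (w - a)).
Proof.
  set (K := Cmod al + Cmod be + Rabs tau + 1).
  exists K; split.
  { assert (P1 := Cmod_ge_0 al); assert (P2 := Cmod_ge_0 be); assert (P3 := Rabs_pos tau);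
      unfold K; lra. }
  generalize (locally_and _ _ _ (Hh 1 Rlt_0_1) (locally_Cmod_lt a 1 Rlt_0_1)).
  apply filter_imp; intros w [H H1].
  assert (A := jet_poly_bound al be tau (w - a) ltac:(lra)).
  replace (h w - h a) with
    ((h w - h a - jet_poly al be tau (w - a)) + jet_poly al be tau (w - a)) by ring.
  eapply Rle_trans; [apply Rabs_triang|].
  assert (P := Cmod_ge_0 (w - a)).
  assert (Cmod (w - a) ^ 2 <= Cmod (w - a)) by (simpl; nra); unfold K; lra.
Qed.

Lemma jet2_continuous : continuous h a.
Proof.
  destruct jet2_lipschitz as [K [HK H]].
  apply continuous_R_iff; intros eps He.
  generalize (locally_and _ _ _ H (locally_Cmod_lt a (eps / K) ltac:(apply Rdiv_lt_0_compat; lra))).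
  apply filter_imp; intros w [H1 H2]; apply Rlt_div_r in H2; [|exact HK]; lra.
Qed.

(** The average of the expansion over the four directions [1, i, -1, -i] cancels the real
    parts and leaves the Laplacian. *)
Lemma jet2_max : locally a (fun w => h w <= h a) -> tau <= 0.
Proof.
  intros Hm; apply Rnot_lt_le; intros Ht.
  assert (A := locally_and _ _ _ Hm (Hh (tau / 8) ltac:(lra))).
  apply locally_Cmod in A; destruct A as [d [Hd A]].
  set (s := d / 2).
  assert (Hs : 0 < s) by (unfold s; lra).
  assert (dir : forall u : C, Cmod u = 1 ->
    Re (al * (RtoC s * u) + be * (RtoC s * u) ^ 2) + tau / 8 * s ^ 2 <= 0).
  { intros u Hu.
    assert (E : Cmod (RtoC s * u) = s) by (rewrite Cmod_mult, Cmod_R, Hu, Rabs_pos_eq; lra).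
    destruct (A (a + RtoC s * u)%C) as [A1 A2].
    { replace (a + RtoC s * u - a)%C with (RtoC s * u)%C by ring; rewrite E; unfold s; lra. }
    replace (a + RtoC s * u - a)%C with (RtoC s * u)%C in A2 by ring.
    unfold jet_poly in A2; rewrite E in A2; apply Rabs_le_between in A2; lra. }
  assert (D1 := dir (RtoC 1) Cmod_1); assert (D2 := dir (- RtoC 1)%C Cmod_m1).
  assert (D3 := dir Ci Cmod_Ci).
  assert (D4 := dir (- Ci)%C ltac:(rewrite Cmod_opp; apply Cmod_Ci)).
  simpl in D1, D2, D3, D4.
  assert (0 < tau * (s * s)) by (apply Rmult_lt_0_compat; [|apply Rmult_lt_0_compat]; assumption).
  lra.
Qed.

End Expansion.

Lemma jet2_ext_loc (f g : C -> R) (a al be : C) (tau : R) :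
  locally a (fun w => f w = g w) -> jet2 f a al be tau -> jet2 g a al be tau.
Proof.
  intros H; assert (E := locally_singleton _ _ H); simpl in E.
  apply little_o2_ext_loc; revert H; apply filter_imp; intros w Hw; rewrite Hw, E; reflexivity.
Qed.

Lemma jet2_eq (f : C -> R) (a al be al' be' : C) (tau tau' : R) :
  al = al' -> be = be' -> tau = tau' -> jet2 f a al be tau -> jet2 f a al' be' tau'.
Proof. intros -> -> ->; trivial. Qed.

Lemma jet2_plus (f g : C -> R) (a al be al' be' : C) (tau tau' : R) :
  jet2 f a al be tau -> jet2 g a al' be' tau' ->
  jet2 (fun w => f w + g w) a (al + al') (be + be') (tau + tau').
Proof.
  intros Hf Hg; generalize (little_o2_plus _ _ _ Hf Hg); apply little_o2_ext_loc.
  apply filter_forall; intros w; unfold jet_poly.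
  rewrite !re_plus, !Cmult_plus_distr_r, !re_plus; field.
Qed.

Lemma jet2_scal (f : C -> R) (a al be : C) (tau k : R) :
  jet2 f a al be tau -> jet2 (fun w => k * f w) a (RtoC k * al) (RtoC k * be) (k * tau).
Proof.
  intros Hf; generalize (little_o2_scal _ _ k Hf); apply little_o2_ext_loc.
  apply filter_forall; intros w; unfold jet_poly.
  rewrite !re_plus, <- !Cmult_assoc, !re_scal_l; field.
Qed.

Lemma jet2_const (k : R) (a : C) : jet2 (fun _ => k) a 0 0 0.
Proof.
  intros eps He; apply filter_forall; intros w; unfold jet_poly.
  rewrite !Cmult_0_l, Cplus_0_l; simpl Re.
  replace (_ - _ - _) with 0 by field.
  rewrite Rabs_R0; apply Rmult_le_pos; [lra | apply pow_le, Cmod_ge_0].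
Qed.

Lemma jet2_Cmod2 (a : C) : jet2 (fun w => Cmod w ^ 2) a (2 * Cconj a) 0 4.
Proof.
  intros eps He; apply filter_forall; intros w; unfold jet_poly.
  rewrite !Cmod2_alt; unfold Re, Im; simpl.
  match goal with |- Rabs ?x <= _ => replace x with 0 by field end.
  rewrite Rabs_R0; apply Rmult_le_pos; [lra|]; apply Rplus_le_le_0_compat;
    rewrite Rmult_1_r; apply Rle_0_sqr.
Qed.

Definition taylor2 (phi : R -> R) (t p1 p2 : R) : Prop :=
  forall eps, 0 < eps -> locally t (fun x =>
    Rabs (phi x - phi t - p1 * (x - t) - p2 / 2 * (x - t) ^ 2) <= eps * (x - t) ^ 2).

(** The derivative of the remainder is [o(|x - t|)], so the mean value theorem applies. *)
Lemma taylor2_derive (phi dphi : R -> R) (t p2 r : R) :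
  0 < r -> (forall x, Rabs (x - t) < r -> is_derive phi x (dphi x)) ->
  is_derive dphi t p2 -> taylor2 phi t (dphi t) p2.
Proof.
  intros Hr H1 H2 eps He.
  apply is_derive_Reals in H2.
  destruct (H2 eps He) as [d Hd].
  apply locally_R; exists (Rmin r d); split; [apply Rmin_pos; [exact Hr | apply cond_pos]|].
  intros x Hx.
  assert (X1 := Rlt_le_trans _ _ _ Hx (Rmin_l _ _)).
  assert (X2 := Rlt_le_trans _ _ _ Hx (Rmin_r _ _)).
  set (g := fun y => phi y - (dphi t * (y - t) + p2 / 2 * (y - t) ^ 2)).
  assert (between : forall y, Rmin t x <= y <= Rmax t x -> Rabs (y - t) <= Rabs (x - t)).
  { intros y Hy; unfold Rmin, Rmax in Hy; destruct (Rle_dec t x);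
      [rewrite !Rabs_pos_eq | rewrite !Rabs_left1]; lra. }
  assert (Dg : forall y, Rmin t x <= y <= Rmax t x ->
    is_derive g y (dphi y - dphi t - p2 * (y - t))).
  { intros y Hy; assert (A := between y Hy).
    assert (D := H1 y ltac:(lra)).
    replace (dphi y - dphi t - p2 * (y - t)) with (dphi y - (dphi t + p2 * (y - t))) by ring.
    apply (is_derive_minus (K := R_AbsRing) (V := R_NormedModule)); [exact D|].
    auto_derive; [trivial | field]. }
  destruct (MVT_gen g t x (fun y => dphi y - dphi t - p2 * (y - t))) as [c [Hc E]].
  - intros y Hy; apply Dg; lra.
  - intros y Hy; apply continuity_pt_filterlim.
    apply (ex_derive_continuous (K := R_AbsRing) (V := R_NormedModule)).
    eexists; apply Dg, Hy.
  - replace (phi x - phi t - dphi t * (x - t) - p2 / 2 * (x - t) ^ 2) with (g x - g t)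
      by (unfold g; field).
    rewrite E, Rabs_mult, <- (pow2_abs (x - t)).
    replace (eps * Rabs (x - t) ^ 2) with ((eps * Rabs (x - t)) * Rabs (x - t)) by ring.
    apply Rmult_le_compat_r; [apply Rabs_pos|].
    assert (A := between c Hc).
    apply Rle_trans with (eps * Rabs (c - t)); [|apply Rmult_le_compat_l; lra].
    destruct (Req_dec c t) as [->|Hct].
    + replace (dphi t - dphi t - p2 * (t - t)) with 0 by ring.
      rewrite Rminus_diag, Rabs_R0; lra.
    + assert (B := Hd (c - t) ltac:(lra) ltac:(lra)).
      replace (t + (c - t)) with c in B by ring.
      replace (dphi c - dphi t - p2 * (c - t)) with
        (((dphi c - dphi t) / (c - t) - p2) * (c - t)) by (field; lra).
      rewrite Rabs_mult; apply Rmult_le_compat_r; [apply Rabs_pos | lra].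
Qed.

(** The square of the linear part contributes to both quadratic parts:
    [Re (al z) ^ 2 = (|al| ^ 2 |z| ^ 2 + Re (al ^ 2 z ^ 2)) / 2]. *)
Lemma jet2_comp_real (phi : R -> R) (p1 p2 : R) (h : C -> R) (a al be : C) (tau : R) :
  jet2 h a al be tau -> taylor2 phi (h a) p1 p2 ->
  jet2 (fun w => phi (h w)) a (RtoC p1 * al) (RtoC p1 * be + RtoC (p2 / 4) * (al * al))
    (p1 * tau + p2 * Cmod al ^ 2).
Proof.
  intros Hh Hphi.
  destruct (jet2_lipschitz _ _ _ _ _ Hh) as [K [HK L]].
  destruct (jet2_linear_error _ _ _ _ _ Hh) as [K2 L2].
  assert (N1 : little_o2 (fun w => phi (h w) - phi (h a) - p1 * (h w - h a)
      - p2 / 2 * (h w - h a) ^ 2) a).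
  { intros eps He.
    assert (He1 : 0 < eps / K ^ 2) by (apply Rdiv_lt_0_compat; [lra | apply pow_lt, HK]).
    assert (A := jet2_continuous _ _ _ _ _ Hh _ (Hphi _ He1)).
    unfold filtermap in A.
    generalize (locally_and _ _ _ L A); apply filter_imp; intros w [B1 B2].
    eapply Rle_trans; [exact B2|].
    apply Rle_trans with (eps / K ^ 2 * (K * Cmod (w - a)) ^ 2); [|right; field; lra].
    apply Rmult_le_compat_l; [lra|].
    rewrite <- (pow2_abs (h w - h a)); apply pow_incr; split; [apply Rabs_pos | exact B1]. }
  assert (N2 : little_o2 (fun w => (h w - h a) ^ 2 - Re (al * (w - a)) ^ 2) a).
  { apply (little_o2_cubic _ _ (K2 * (K + Cmod al))).
    generalize (locally_and _ _ _ L L2); apply filter_imp; intros w [B1 B2].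
    replace (_ - _) with ((h w - h a - Re (al * (w - a))) * (h w - h a + Re (al * (w - a))))
      by ring.
    rewrite Rabs_mult.
    replace (K2 * (K + Cmod al) * Cmod (w - a) ^ 3) with
      ((K2 * Cmod (w - a) ^ 2) * ((K + Cmod al) * Cmod (w - a))) by ring.
    apply Rmult_le_compat; try apply Rabs_pos; [exact B2|].
    eapply Rle_trans; [apply Rabs_triang|].
    assert (B3 := Re_mult_le al (w - a)); lra. }
  generalize (little_o2_plus _ _ _ N1 (little_o2_plus _ _ _ (little_o2_scal _ _ p1 Hh)
    (little_o2_scal _ _ (p2 / 2) N2))).
  apply little_o2_ext_loc, filter_forall; intros w; unfold jet_poly.
  rewrite !Cmod2_alt; unfold Re, Im; simpl; field.
Qed.

(** Second order expansion of a holomorphic function, by integrating the first order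
    expansion of its derivative. *)
Lemma holomorphic_expansion (f df : C -> C) (U : C -> Prop) (a m : C) :
  open U -> (forall w, U w -> is_derive f w (df w)) -> U a -> is_derive df a m ->
  little_o2 (fun w => Cmod (f w - f a - (df a * (w - a) + m / 2 * (w - a) ^ 2))%C) a.
Proof.
  intros HU Hf Ha Hm eps He.
  destruct (open_ball U a HU Ha) as [r [Hr Hball]].
  destruct (proj1 (is_derive_C_eps _ _ _) Hm eps He) as [d [Hd H1]].
  apply locally_Cmod; exists (Rmin r d); split; [apply Rmin_pos; assumption|]; intros w Hw.
  assert (W1 := Rlt_le_trans _ _ _ Hw (Rmin_l _ _)).
  assert (W2 := Rlt_le_trans _ _ _ Hw (Rmin_r _ _)).
  assert (Haa : Cmod (a - a) = 0) by (replace (a - a)%C with (RtoC 0) by ring; apply Cmod_0).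
  assert (Hdf : forall x, Cmod (x - a) < r -> continuous df x).
  { intros x Hx; destruct (holomorphic_derive f df U HU Hf x (Hball x Hx)) as [l Hl].
    exact (is_derive_C_continuous df x l Hl). }
  rewrite Rabs_pos_eq by apply Cmod_ge_0.
  rewrite <- (seg_int_primitive f df a w).
  - replace (df a * (w - a) + m / 2 * (w - a) ^ 2)%C with
      (seg_int (fun x => df a + 2 * (m / 2) * (x - a)) a w)%C
      by (rewrite seg_int_affine; simpl; ring).
    replace (eps * Cmod (w - a) ^ 2) with ((eps * Cmod (w - a)) * Cmod (w - a)) by ring.
    apply seg_int_close.
    + apply (on_seg_disk df a a w r); [exact Hdf | lra | exact W1].
    + intros t _; apply continuous_Caffine.
    + intros t Ht; set (x := seg a w t).
      assert (Hx : Cmod (x - a) <= Cmod (w - a)).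
      { apply Cmod_seg; [exact Ht | rewrite Haa; apply Cmod_ge_0 | lra]. }
      replace (_ - _)%C with (df x - df a - (x - a) * m)%C by field.
      eapply Rle_trans; [apply H1; lra|]; apply Rmult_le_compat_l; lra.
  - intros t Ht; apply Hf, Hball, Cmod_seg_lt; [exact Ht | lra | exact W1].
  - apply (on_seg_disk df a a w r); [exact Hdf | lra | exact W1].
Qed.

(** Real parts of complex polynomials stay such under the substitution, so the Laplacian
    is only multiplied by the squared modulus of the derivative. *)
Lemma jet2_comp_holomorphic (h : C -> R) (f df : C -> C) (U : C -> Prop) (a al be : C) (tau : R) :
  open U -> (forall w, U w -> is_derive f w (df w)) -> U a ->
  jet2 h (f a) al be tau ->
  exists be', jet2 (fun w => h (f w)) a (al * df a) be' (tau * Cmod (df a) ^ 2).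
Proof.
  intros HU Hf Ha Hh.
  destruct (holomorphic_derive f df U HU Hf a Ha) as [m Hm].
  assert (E := holomorphic_expansion f df U a m HU Hf Ha Hm).
  set (b := df a) in *; set (c := (m / 2)%C) in *.
  exists (al * c + be * b ^ 2)%C.
  assert (Hb := Cmod_ge_0 b); assert (Hc := Cmod_ge_0 c).
  set (B := Cmod b + Cmod c + 1).
  assert (L1 : locally a (fun w => Cmod (f w - f a - b * (w - a)) <= (Cmod c + 1) * Cmod (w - a) ^ 2)).
  { generalize (E 1 Rlt_0_1); apply filter_imp; intros w H.
    rewrite Rabs_pos_eq in H by apply Cmod_ge_0.
    replace (f w - f a - b * (w - a))%C with
      ((f w - f a - (b * (w - a) + c * (w - a) ^ 2)) + c * (w - a) ^ 2)%C by ring.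
    eapply Rle_trans; [apply Cmod_triangle|]; rewrite Cmod_mult, Cmod_pow; lra. }
  assert (L2 : locally a (fun w => Cmod (f w - f a) <= B * Cmod (w - a))).
  { generalize (locally_and _ _ _ L1 (locally_Cmod_lt a 1 Rlt_0_1)); apply filter_imp.
    intros w [H H1]; replace (f w - f a)%C with ((f w - f a - b * (w - a)) + b * (w - a))%C by ring.
    eapply Rle_trans; [apply Cmod_triangle|]; rewrite Cmod_mult.
    assert (P := Cmod_ge_0 (w - a)).
    assert (Cmod (w - a) ^ 2 <= Cmod (w - a)) by (simpl; nra); unfold B; nra. }
  assert (HB : 0 < B) by (unfold B; lra).
  assert (N1 : little_o2 (fun w => h (f w) - h (f a) - jet_poly al be tau (f w - f a)) a).
  { intros eps He.
    assert (He1 : 0 < eps / B ^ 2) by (apply Rdiv_lt_0_compat; [lra | apply pow_lt, HB]).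
    assert (A := is_derive_C_continuous f a _ (Hf a Ha) _ (Hh _ He1)); unfold filtermap in A.
    generalize (locally_and _ _ _ L2 A); apply filter_imp; intros w [B1 B2].
    eapply Rle_trans; [exact B2|].
    apply Rle_trans with (eps / B ^ 2 * (B * Cmod (w - a)) ^ 2); [|right; field; lra].
    apply Rmult_le_compat_l; [lra|]; apply pow_incr; split; [apply Cmod_ge_0 | exact B1]. }
  assert (N2 : little_o2 (fun w => Re (al * (f w - f a - (b * (w - a) + c * (w - a) ^ 2)))) a).
  { revert E; apply (little_o2_le _ _ _ (Cmod al)); apply filter_forall; intros w.
    rewrite (Rabs_pos_eq (Cmod _)) by apply Cmod_ge_0; apply Re_mult_le. }
  assert (N3 : little_o2 (fun w => Re (be * ((f w - f a) ^ 2 - (b * (w - a)) ^ 2))) a).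
  { apply (little_o2_cubic _ _ (Cmod be * ((Cmod c + 1) * (B + B)))).
    generalize (locally_and _ _ _ L1 L2); apply filter_imp; intros w [B1 B2].
    eapply Rle_trans; [apply Re_mult_le|].
    replace ((f w - f a) ^ 2 - (b * (w - a)) ^ 2)%C with
      ((f w - f a - b * (w - a)) * ((f w - f a) + b * (w - a)))%C by (simpl; ring).
    rewrite Cmod_mult, !Rmult_assoc; apply Rmult_le_compat_l; [apply Cmod_ge_0|].
    replace ((Cmod c + 1) * ((B + B) * Cmod (w - a) ^ 3)) with
      (((Cmod c + 1) * Cmod (w - a) ^ 2) * ((B + B) * Cmod (w - a))) by ring.
    apply Rmult_le_compat; try apply Cmod_ge_0; [exact B1|].
    eapply Rle_trans; [apply Cmod_triangle|]; rewrite Cmod_mult.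
    assert (P := Cmod_ge_0 (w - a)); unfold B in *; nra. }
  assert (N4 : little_o2 (fun w => Cmod (f w - f a) ^ 2 - Cmod (b * (w - a)) ^ 2) a).
  { apply (little_o2_cubic _ _ ((Cmod c + 1) * (B + B))).
    generalize (locally_and _ _ _ L1 L2); apply filter_imp; intros w [B1 B2].
    set (p := (f w - f a)%C) in *; set (q := (b * (w - a))%C) in *.
    replace (Cmod p ^ 2 - Cmod q ^ 2) with ((Cmod p - Cmod q) * (Cmod p + Cmod q)) by ring.
    rewrite Rabs_mult, (Rabs_pos_eq (Cmod p + Cmod q))
      by (apply Rplus_le_le_0_compat; apply Cmod_ge_0).
    replace ((Cmod c + 1) * (B + B) * Cmod (w - a) ^ 3) with
      (((Cmod c + 1) * Cmod (w - a) ^ 2) * ((B + B) * Cmod (w - a))) by ring.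
    apply Rmult_le_compat; [apply Rabs_pos | apply Rplus_le_le_0_compat; apply Cmod_ge_0 | |].
    - eapply Rle_trans; [|exact B1].
      assert (A1 := Cmod_triangle_rev p q); assert (A2 := Cmod_triangle_rev q p).
      rewrite Cmod_minus_sym in A2; apply Rabs_le_between; lra.
    - unfold q; rewrite Cmod_mult; assert (P := Cmod_ge_0 (w - a)); unfold B in *; nra. }
  generalize (little_o2_plus _ _ _ (little_o2_plus _ _ _ N1 N2)
    (little_o2_plus _ _ _ N3 (little_o2_scal _ _ (tau / 4) N4))).
  apply little_o2_ext_loc, filter_forall; intros w; unfold jet_poly.
  rewrite (Cmod_mult b).
  set (z := (w - a)%C); set (y := (f w - f a)%C).
  replace (be * (y ^ 2 - (b * z) ^ 2))%C with (be * y ^ 2 - be * b ^ 2 * z ^ 2)%C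
    by (simpl; ring).
  replace (al * (y - (b * z + c * z ^ 2)))%C with (al * y - al * b * z - al * c * z ^ 2)%C
    by ring.
  replace ((al * c + be * b ^ 2) * z ^ 2)%C with (al * c * z ^ 2 + be * b ^ 2 * z ^ 2)%C by ring.
  unfold Cminus; rewrite !re_plus, !re_opp; field.
Qed.

(** * Expansions of the functions that occur in the proof *)

Lemma taylor2_ln (t : R) : 0 < t -> taylor2 ln t (/ t) (- / t ^ 2).
Proof.
  intros Ht; apply (taylor2_derive ln Rinv t (- / t ^ 2) t Ht).
  - intros x Hx; apply is_derive_ln; apply Rabs_lt_between in Hx; lra.
  - auto_derive; [lra | field; lra].
Qed.

Lemma taylor2_ln_minus (c t : R) :
  t < c -> taylor2 (fun x => ln (c - x)) t (- / (c - t)) (- / (c - t) ^ 2).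
Proof.
  intros Ht.
  apply (taylor2_derive (fun x => ln (c - x)) (fun x => - / (c - x)) t _ (c - t)); [lra| |].
  - intros x Hx; apply Rabs_lt_between in Hx; auto_derive; [lra | field; lra].
  - auto_derive; [lra | field; lra].
Qed.

Lemma taylor2_inv_minus (c t : R) :
  t < c -> taylor2 (fun x => / (c - x)) t (/ (c - t) ^ 2) (2 / (c - t) ^ 3).
Proof.
  intros Ht.
  apply (taylor2_derive (fun x => / (c - x)) (fun x => / (c - x) ^ 2) t _ (c - t)); [lra| |].
  - intros x Hx; apply Rabs_lt_between in Hx; auto_derive; [lra | field; lra].
  - auto_derive; [simpl; nra | field; lra].
Qed.

Lemma Cmod2_pos (a : C) : a <> RtoC 0 -> 0 < Cmod a ^ 2.
Proof. intros Ha; apply pow_lt, Cmod_gt_0, Ha. Qed.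

Lemma locally_neq_0 (a : C) : a <> RtoC 0 -> locally a (fun w : C => 0 < Cmod w).
Proof.
  intros Ha; apply Cmod_gt_0 in Ha.
  apply locally_Cmod; exists (Cmod a); split; [exact Ha|]; intros w Hw.
  assert (A := Cmod_triangle_rev a w); rewrite Cmod_minus_sym in A; lra.
Qed.

(** The squared modulus of the gradient is recorded because it enters the Laplacian of
    functions of [ln |z|]. *)
Lemma jet2_ln_Cmod (a : C) :
  a <> RtoC 0 ->
  exists al be, jet2 (fun w => ln (Cmod w)) a al be 0 /\ Cmod al ^ 2 = / Cmod a ^ 2.
Proof.
  intros Ha; assert (Hp := Cmod2_pos a Ha).
  assert (J := jet2_scal _ _ _ _ _ (1 / 2)
    (jet2_comp_real ln _ _ _ _ _ _ _ (jet2_Cmod2 a) (taylor2_ln _ Hp))).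
  assert (E : Cmod (2 * Cconj a) ^ 2 = 4 * Cmod a ^ 2).
  { rewrite Cmod_mult, Cmod_conj, Cmod_R, Rabs_pos_eq by lra; ring. }
  eexists; eexists; split.
  - apply (jet2_ext_loc (fun w => 1 / 2 * ln (Cmod w ^ 2))).
    { generalize (locally_neq_0 a Ha); apply filter_imp; intros w Hw.
      rewrite ln_pow by exact Hw; simpl; field. }
    eapply jet2_eq; [reflexivity | reflexivity | | exact J].
    rewrite E; field; apply Rgt_not_eq, Cmod_gt_0, Ha.
  - rewrite !Cmod_mult, Cmod_conj, !Cmod_R, !Rabs_pos_eq; try lra.
    + simpl; field; apply Rgt_not_eq, Cmod_gt_0, Ha.
    + apply Rlt_le, Rinv_0_lt_compat, Hp.
Qed.

Lemma jet2_ln_disk (a : C) (c : R) :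
  Cmod a ^ 2 < c ->
  exists al be, jet2 (fun w => ln (c - Cmod w ^ 2)) a al be (- (4 * c / (c - Cmod a ^ 2) ^ 2)).
Proof.
  intros Ha.
  assert (J := jet2_comp_real (fun x => ln (c - x)) _ _ _ _ _ _ _ (jet2_Cmod2 a)
    (taylor2_ln_minus c _ Ha)).
  eexists; eexists; eapply jet2_eq; [reflexivity | reflexivity | | exact J].
  rewrite Cmod_mult, Cmod_conj, Cmod_R, Rabs_pos_eq by lra; field; lra.
Qed.

Lemma jet2_inv_log (a : C) (c : R) :
  a <> RtoC 0 -> ln (Cmod a) < c ->
  exists al be, jet2 (fun w => / (c - ln (Cmod w))) a al be
    (2 / (Cmod a ^ 2 * (c - ln (Cmod a)) ^ 3)).
Proof.
  intros Ha Hc; destruct (jet2_ln_Cmod a Ha) as [al [be [J E]]].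
  assert (J2 := jet2_comp_real (fun x => / (c - x)) _ _ _ _ _ _ _ J (taylor2_inv_minus c _ Hc)).
  eexists; eexists; eapply jet2_eq; [reflexivity | reflexivity | | exact J2].
  rewrite E; field; split; first [lra | apply Rgt_not_eq, Cmod_gt_0, Ha].
Qed.

Lemma jet2_ln_Cmod_holomorphic (f df : C -> C) (U : C -> Prop) (a : C) :
  open U -> (forall w, U w -> is_derive f w (df w)) -> U a -> f a <> RtoC 0 ->
  exists al be, jet2 (fun w => ln (Cmod (f w))) a al be 0.
Proof.
  intros HU Hf Ha H0; destruct (jet2_ln_Cmod (f a) H0) as [al [be [J _]]].
  destruct (jet2_comp_holomorphic _ f df U a al be 0 HU Hf Ha J) as [be' J'].
  eexists; eexists; eapply jet2_eq; [reflexivity | reflexivity | | exact J'].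
  ring.
Qed.

(** * Functions of class C2 *)

Lemma differentiable_estimate (g : R -> R -> R) (x y eps : R) :
  locally_2d (fun u v => ex_derive (fun t => g t v) u) x y ->
  ex_derive (fun t => g x t) y ->
  continuity_2d_pt (fun u v => Derive (fun t => g t v) u) x y ->
  0 < eps ->
  exists d, 0 < d /\ forall u v, Rabs (u - x) < d -> Rabs (v - y) < d ->
    Rabs (g u v - g x y - (Derive (fun t => g t y) x * (u - x) + Derive (fun t => g x t) y * (v - y)))
    <= eps * Rmax (Rabs (u - x)) (Rabs (v - y)).
Proof.
  intros H1 H2 H3 He.
  assert (D : differentiable_pt_lim g x y (Derive (fun t => g t y) x) (Derive (fun t => g x t) y)).
  { apply filterdiff_differentiable_pt_lim.
    apply (is_derive_filterdiff g x y (fun u v => Derive (fun t => g t v) u)).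
    - apply locally_2d_locally in H1; revert H1; apply filter_imp; intros w Hw.
      apply Derive_correct, Hw.
    - apply Derive_correct, H2.
    - apply continuity_2d_pt_filterlim in H3; exact H3. }
  destruct (D (mkposreal eps He)) as [d Hd]; exists d; split; [apply cond_pos | exact Hd].
Qed.

(** The increment is split into one in the second variable at [x] and one in the first
    variable at [v].  The latter is estimated by the mean value theorem, and the mixed term
    comes from the differentiability of the first partial derivative at [(x, y)]. *)
Lemma C2_jet2 (U : C -> Prop) (f : C -> R) (a : C) :
  open U -> C2_on U f -> U a ->
  exists be, jet2 f a
    (Derive (fun t => f (t, snd a)) (fst a), - Derive (fun t => f (fst a, t)) (snd a)) be
    (laplacian f a).
Proof.
  intros HU HC Ha; destruct a as [x y]; simpl fst; simpl snd.
  destruct (open_ball U _ HU Ha) as [r [Hr Hball]].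
  assert (Hbox : forall u v, Rabs (u - x) < r / 2 -> Rabs (v - y) < r / 2 ->
    ex_diff_n (fun x y => f (x, y)) 2 u v).
  { intros u v Hu Hv; apply (HC (u, v)), Hball.
    replace ((u, v) - (x, y))%C with (RtoC (u - x) + Ci * RtoC (v - y))%C
      by (apply injective_projections; simpl; ring).
    eapply Rle_lt_trans; [apply Cmod_triangle|]; rewrite Cmod_mult, Cmod_Ci, !Cmod_R; lra. }
  set (fx := fun u v => Derive (fun t => f (t, v)) u).
  set (fy := fun u v => Derive (fun t => f (u, t)) v).
  set (fxx := Derive (fun t => fx t y) x); set (fxy := Derive (fun t => fx x t) y).
  set (fyy := Derive (fun t => fy x t) y).
  assert (EL : laplacian f (x, y) = fxx + fyy) by reflexivity.
  change (Derive (fun t => f (t, y)) x) with (fx x y).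
  change (Derive (fun t => f (x, t)) y) with (fy x y).
  assert (Dx : forall u v, Rabs (u - x) < r / 2 -> Rabs (v - y) < r / 2 ->
    is_derive (fun t => f (t, v)) u (fx u v)).
  { intros u v Hu Hv; destruct (Hbox u v Hu Hv) as [_ [E _]]; apply Derive_correct, E. }
  assert (Dy : forall u v, Rabs (u - x) < r / 2 -> Rabs (v - y) < r / 2 ->
    is_derive (fun t => f (u, t)) v (fy u v)).
  { intros u v Hu Hv; destruct (Hbox u v Hu Hv) as [_ [_ [E _]]]; apply Derive_correct, E. }
  assert (Hx0 : Rabs (x - x) < r / 2) by (rewrite Rminus_diag, Rabs_R0; lra).
  assert (Hy0 : Rabs (y - y) < r / 2) by (rewrite Rminus_diag, Rabs_R0; lra).
  assert (Ty : taylor2 (fun v => f (x, v)) y (fy x y) fyy).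
  { apply (taylor2_derive _ (fy x) y fyy (r / 2)); [lra| |].
    - intros v Hv; apply Dy; assumption.
    - destruct (Hbox x y Hx0 Hy0) as [_ [_ [_ [_ [_ [_ [E _]]]]]]]; apply Derive_correct, E. }
  assert (Hfx : forall eps, 0 < eps -> exists d, 0 < d /\ forall u v,
    Rabs (u - x) < d -> Rabs (v - y) < d ->
    Rabs (fx u v - fx x y - (fxx * (u - x) + fxy * (v - y)))
    <= eps * Rmax (Rabs (u - x)) (Rabs (v - y))).
  { intros eps He; apply (differentiable_estimate fx); [| | |exact He].
    - assert (Hr2 : 0 < r / 2) by lra; exists (mkposreal _ Hr2); intros u v Hu Hv.
      destruct (Hbox u v Hu Hv) as [_ [_ [_ [[_ [E _]] _]]]]; exact E.
    - destruct (Hbox x y Hx0 Hy0) as [_ [_ [_ [[_ [_ [E _]]] _]]]]; exact E.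
    - destruct (Hbox x y Hx0 Hy0) as [_ [_ [_ [[_ [_ [_ [E _]]]] _]]]]; apply E. }
  exists ((fxx - fyy) / 4, - fxy / 2); intros eps He.
  destruct (Hfx (eps / 2) ltac:(lra)) as [d1 [Hd1 H1]].
  assert (H2 := Ty (eps / 2) ltac:(lra)); apply locally_R in H2; destruct H2 as [d2 [Hd2 H2]].
  apply locally_Cmod; exists (Rmin (r / 2) (Rmin d1 d2)); split.
  { repeat apply Rmin_pos; lra. }
  intros [u v] Hw.
  assert (M := Rmax_Cmod ((u, v) - (x, y))%C); simpl fst in M; simpl snd in M.
  fold (Rminus u x) in M; fold (Rminus v y) in M.
  set (m := Rmax (Rabs (u - x)) (Rabs (v - y))) in *.
  assert (Mu : Rabs (u - x) <= m) by apply Rmax_l.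
  assert (Mv : Rabs (v - y) <= m) by apply Rmax_r.
  assert (W1 := Rlt_le_trans _ _ _ Hw (Rmin_l _ _)).
  assert (W2 := Rlt_le_trans _ _ _ Hw (Rmin_r _ _)).
  assert (W3 := Rlt_le_trans _ _ _ W2 (Rmin_l _ _)).
  assert (W4 := Rlt_le_trans _ _ _ W2 (Rmin_r _ _)).
  set (n := Cmod ((u, v) - (x, y))%C) in *.
  assert (A1 : Rabs (f (u, v) - f (x, v) - (fx x y * (u - x) + fxx / 2 * (u - x) ^ 2
    + fxy * (v - y) * (u - x))) <= eps / 2 * n ^ 2).
  { set (g := fun s => f (s, v) - (fx x y * (s - x) + fxx / 2 * (s - x) ^ 2
      + fxy * (v - y) * (s - x))).
    assert (between : forall s, Rmin x u <= s <= Rmax x u -> Rabs (s - x) <= Rabs (u - x)).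
    { intros s Hs; unfold Rmin, Rmax in Hs; destruct (Rle_dec x u);
        [rewrite !Rabs_pos_eq | rewrite !Rabs_left1]; lra. }
    assert (Dg : forall s, Rmin x u <= s <= Rmax x u ->
      is_derive g s (fx s v - (fx x y + fxx * (s - x) + fxy * (v - y)))).
    { intros s Hs; assert (B := between s Hs).
      apply (is_derive_minus (K := R_AbsRing) (V := R_NormedModule)); [apply Dx; lra|].
      auto_derive; [trivial | field]. }
    destruct (MVT_gen g x u (fun s => fx s v - (fx x y + fxx * (s - x) + fxy * (v - y))))
      as [c [Hc E]].
    - intros s Hs; apply Dg; lra.
    - intros s Hs; apply continuity_pt_filterlim.
      apply (ex_derive_continuous (K := R_AbsRing) (V := R_NormedModule)); eexists; apply Dg, Hs.
    - replace (_ - _ - _) with (g u - g x) by (unfold g; field).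
      assert (B := between c Hc).
      rewrite E, Rabs_mult.
      replace (eps / 2 * n ^ 2) with ((eps / 2 * n) * n) by ring.
      apply Rmult_le_compat; try apply Rabs_pos; [|lra].
      replace (_ - _) with (fx c v - fx x y - (fxx * (c - x) + fxy * (v - y))) by ring.
      eapply Rle_trans; [apply H1; lra|]; apply Rmult_le_compat_l; [lra|].
      apply Rmax_lub; lra. }
  assert (A2 := H2 v ltac:(lra)).
  assert (A3 : (v - y) ^ 2 <= n ^ 2).
  { rewrite <- (pow2_abs (v - y)); apply pow_incr; split; [apply Rabs_pos | lra]. }
  rewrite EL.
  replace (f (u, v) - f (x, y) - _) with
    ((f (u, v) - f (x, v) - (fx x y * (u - x) + fxx / 2 * (u - x) ^ 2
      + fxy * (v - y) * (u - x))) +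
     (f (x, v) - f (x, y) - fy x y * (v - y) - fyy / 2 * (v - y) ^ 2)).
  - eapply Rle_trans; [apply Rabs_triang|].
    assert (eps / 2 * (v - y) ^ 2 <= eps / 2 * n ^ 2) by (apply Rmult_le_compat_l; lra); lra.
  - unfold jet_poly; rewrite Cmod2_alt; unfold Re, Im; simpl; field.
Qed.

Lemma Derive_n_2_ln (g : R -> R) (x : R) :
  locally x (fun t => 0 < g t /\ ex_derive g t) -> ex_derive (Derive g) x ->
  Derive_n (fun t => ln (g t)) 2 x = Derive_n g 2 x / g x - Derive g x ^ 2 / g x ^ 2.
Proof.
  intros H1 H2; destruct (locally_singleton _ _ H1) as [Hp Hd].
  change (Derive (Derive (fun t => ln (g t))) x =
    Derive (Derive g) x / g x - Derive g x ^ 2 / g x ^ 2).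
  rewrite (Derive_ext_loc _ (fun t => Derive g t * / g t)).
  - rewrite Derive_mult, Derive_inv; try assumption; [| lra | apply ex_derive_inv; [exact Hd|lra]].
    simpl; field; lra.
  - revert H1; apply filter_imp; intros t [Ht Hg].
    apply is_derive_unique.
    apply (is_derive_comp (K := R_AbsRing) (V := R_NormedModule) ln g).
    + apply is_derive_ln, Ht.
    + apply Derive_correct, Hg.
Qed.

Lemma positive_set_open (G : C -> Prop) (lam : C -> R) :
  open G -> (forall z, G z -> continuous lam z) -> open (positive_set G lam).
Proof.
  intros HG Hc z [Hz Hp].
  assert (A := proj1 (continuous_R_iff _ _) (Hc z Hz) (lam z) Hp).
  generalize (locally_and _ _ _ (HG z Hz) A); apply filter_imp; intros w [W1 W2].
  split; [exact W1|]; apply Rabs_lt_between in W2; lra.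
Qed.

Lemma jet2_ln_C2 (U : C -> Prop) (f : C -> R) (a : C) :
  open U -> C2_on U f -> (forall z, U z -> 0 < f z) -> U a ->
  exists al be, jet2 (fun w => ln (f w)) a al be (laplacian (fun w => ln (f w)) a).
Proof.
  intros HU HC Hp Ha; assert (Hpa := Hp a Ha).
  destruct (C2_jet2 U f a HU HC Ha) as [be J].
  assert (J2 := jet2_comp_real ln _ _ _ _ _ _ _ J (taylor2_ln (f a) Hpa)).
  eexists; eexists; eapply jet2_eq; [reflexivity | reflexivity | | exact J2].
  destruct (open_ball U _ HU Ha) as [r [Hr Hball]].
  destruct a as [x y].
  assert (Hx : forall u, Rabs (u - x) < r -> U (u, y)).
  { intros u Hu; apply Hball; replace ((u, y) - (x, y))%C with (RtoC (u - x))
      by (apply injective_projections; simpl; ring); rewrite Cmod_R; exact Hu. }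
  assert (Hy : forall v, Rabs (v - y) < r -> U (x, v)).
  { intros v Hv; apply Hball; replace ((x, v) - (x, y))%C with (Ci * RtoC (v - y))%C
      by (apply injective_projections; simpl; ring).
    rewrite Cmod_mult, Cmod_Ci, Cmod_R; lra. }
  assert (E1 := Derive_n_2_ln (fun t => f (t, y)) x).
  assert (E2 := Derive_n_2_ln (fun t => f (x, t)) y).
  transitivity (Derive_n (fun t => ln (f (t, y))) 2 x + Derive_n (fun t => ln (f (x, t))) 2 y).
  2: reflexivity.
  rewrite E1, E2.
  - rewrite Cmod2_alt; unfold laplacian, partial_derive, Re, Im; simpl; field; lra.
  - apply locally_R; exists r; split; [exact Hr|]; intros v Hv; split; [apply Hp, Hy, Hv|].
    destruct (HC _ (Hy v Hv)) as [_ [_ [E _]]]; exact E.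
  - destruct (HC _ Ha) as [_ [_ [_ [_ [_ [_ [E _]]]]]]]; exact E.
  - apply locally_R; exists r; split; [exact Hr|]; intros u Hu; split; [apply Hp, Hx, Hu|].
    destruct (HC _ (Hx u Hu)) as [_ [E _]]; exact E.
  - destruct (HC _ Ha) as [_ [_ [_ [[_ [E _]] _]]]]; exact E.
Qed.

(** * The lemma of Ahlfors *)

Lemma unit_disk_open : open unit_disk.
Proof.
  intros z Hz; assert (A := open_disk 0 1 z); simpl in A.
  unfold Cminus in A; rewrite Copp_0, Cplus_0_r in A.
  generalize (A Hz); apply filter_imp; intros w; rewrite Cplus_0_r; trivial.
Qed.

(** Curvature at most -4, in a form that applies to the given pseudometric as well as to
    the hyperbolic metric, of which no regularity is known beforehand. *)
Definition curved_metric (G : C -> Prop) (mu : C -> R) : Prop :=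
  forall z, G z -> 0 <= mu z /\ continuous mu z /\
    (0 < mu z -> exists al be tau,
      jet2 (fun w => ln (mu w)) z al be tau /\ 4 * mu z ^ 2 <= tau).

Lemma pseudometric_curved (G : C -> Prop) (lam : C -> R) :
  open G -> conformal_pseudometric G lam -> curvature_le G lam (-4) -> curved_metric G lam.
Proof.
  intros HG [H0 [Hc HC]] Hk z Hz; split; [apply H0, Hz|]; split; [apply Hc, Hz|]; intros Hp.
  destruct (jet2_ln_C2 (positive_set G lam) lam z (positive_set_open G lam HG Hc) HC
    (fun w Hw => proj2 Hw) (conj Hz Hp)) as [al [be J]].
  exists al, be; eexists; split; [exact J|].
  assert (A := Hk z (conj Hz Hp)); unfold gauss_curvature in A.
  assert (P : 0 < lam z ^ 2) by (apply pow_lt, Hp).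
  apply Rle_div_l in A; [lra | exact P].
Qed.

(** The product [F] on the left vanishes for [|z| = rho], so a positive maximum over the
    closed disk lies inside.  There the Laplacian of [ln F] is nonpositive; it is the sum of
    at least [4 * (mu (f z) * |f' z|) ^ 2] from the curvature, of 0 from the harmonic function
    [ln |f'|], and of [- 4 rho ^ 2 / (rho ^ 2 - |z| ^ 2) ^ 2]. *)
Lemma ahlfors_radius (G : C -> Prop) (mu : C -> R) (f df : C -> C) (rho : R) :
  curved_metric G mu ->
  (forall z, unit_disk z -> is_derive f z (df z)) ->
  (forall z, unit_disk z -> G (f z)) ->
  0 < rho < 1 ->
  forall z, Cmod z <= rho -> mu (f z) * Cmod (df z) * (rho ^ 2 - Cmod z ^ 2) <= rho.
Proof.
  intros Hmu Hf HG Hrho.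
  set (F := fun w => mu (f w) * Cmod (df w) * (rho ^ 2 - Cmod w ^ 2)).
  assert (Hdisk : forall w, Cmod w <= rho -> unit_disk w) by (intros w Hw; unfold unit_disk; lra).
  assert (C1 : forall w, unit_disk w -> continuous (fun w => mu (f w)) w).
  { intros w Hw; apply (continuous_comp f mu).
    - exact (is_derive_C_continuous f w _ (Hf w Hw)).
    - apply Hmu, HG, Hw. }
  assert (Hddf : forall w, unit_disk w -> is_derive df w (C_derive df w)).
  { intros w Hw; apply C_derive_correct; [exact w|].
    apply (holomorphic_derive f df unit_disk unit_disk_open Hf w Hw). }
  assert (C2 : forall w, unit_disk w -> continuous (fun w => Cmod (df w)) w).
  { intros w Hw; apply (continuous_Cmod (T := C_UniformSpace)).
    exact (is_derive_C_continuous df w _ (Hddf w Hw)). }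
  assert (C3 : forall w : C, continuous (fun w : C => rho ^ 2 - Cmod w ^ 2) w).
  { intros w; apply (continuous_ext (fun w : C => rho ^ 2 + -1 * Cmod w ^ 2)).
    - intros x; simpl; ring.
    - exact (jet2_continuous _ _ _ _ _ (jet2_plus _ _ _ _ _ _ _ _ _ (jet2_const (rho ^ 2) w)
        (jet2_scal _ _ _ _ _ (-1) (jet2_Cmod2 w)))). }
  destruct (continuous_max_closed F (fun w => Cmod w <= rho) rho) as [a [Ha Hmax]].
  - exists (RtoC 0); rewrite Cmod_0; lra.
  - trivial.
  - intros w Hw; apply le_epsilon; intros eps He; destruct (Hw eps He) as [x [H1 H2]].
    assert (A := Cmod_triangle_rev w x); rewrite Cmod_minus_sym in A; lra.
  - intros w Hw; apply (continuous_mult (K := R_AbsRing)); [|apply C3].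
    apply (continuous_mult (K := R_AbsRing)); [apply C1 | apply C2]; apply Hdisk, Hw.
  - intros z Hz; eapply Rle_trans; [exact (Hmax z Hz)|].
    destruct (Rle_dec (F a) 0) as [HF|HF]; [lra|]; apply Rnot_le_lt in HF.
    assert (Da := Hdisk a Ha).
    destruct (Hmu (f a) (HG a Da)) as [M0 [_ MJ]].
    assert (P2 := Cmod_ge_0 (df a)).
    assert (Q3 : 0 <= rho ^ 2 - Cmod a ^ 2).
    { assert (A : Cmod a ^ 2 <= rho ^ 2) by (apply pow_incr; split; [apply Cmod_ge_0 | exact Ha]).
      lra. }
    assert (P1 : 0 < mu (f a)).
    { destruct M0 as [M0|M0]; [exact M0|]; unfold F in HF; rewrite <- M0 in HF; lra. }
    assert (P2' : 0 < Cmod (df a)).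
    { destruct P2 as [P2|P2]; [exact P2|]; unfold F in HF; rewrite <- P2 in HF; lra. }
    assert (P3 : 0 < rho ^ 2 - Cmod a ^ 2).
    { destruct Q3 as [Q3|Q3]; [exact Q3|]; unfold F in HF; rewrite <- Q3 in HF; lra. }
    destruct (MJ P1) as [al [be [tau [J1 Htau]]]].
    destruct (jet2_comp_holomorphic _ f df unit_disk a _ _ _ unit_disk_open Hf Da J1)
      as [be1 J1'].
    destruct (jet2_ln_Cmod_holomorphic df (C_derive df) unit_disk a unit_disk_open Hddf Da)
      as [al2 [be2 J2]]; [apply Cmod_gt_0, P2'|].
    destruct (jet2_ln_disk a (rho ^ 2)) as [al3 [be3 J3]]; [lra|].
    assert (J := jet2_plus _ _ _ _ _ _ _ _ _ (jet2_plus _ _ _ _ _ _ _ _ _ J1' J2) J3).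
    assert (pos : forall g : C -> R, continuous g a -> 0 < g a -> locally a (fun w => 0 < g w)).
    { intros g Hg Hp; generalize (proj1 (continuous_R_iff _ _) Hg (g a) Hp).
      apply filter_imp; intros w Hw; apply Rabs_lt_between in Hw; lra. }
    assert (L : locally a (fun w => ln (mu (f w)) + ln (Cmod (df w)) + ln (rho ^ 2 - Cmod w ^ 2)
      <= ln (mu (f a)) + ln (Cmod (df a)) + ln (rho ^ 2 - Cmod a ^ 2))).
    { generalize (locally_and _ _ _ (pos _ (C1 a Da) P1)
        (locally_and _ _ _ (pos _ (C2 a Da) P2') (pos _ (C3 a) P3))).
      apply filter_imp; intros w [W1 [W2 W3]].
      rewrite <- !ln_mult by (try apply Rmult_lt_0_compat; assumption).
      apply ln_le; [repeat apply Rmult_lt_0_compat; assumption|].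
      apply Hmax, Rnot_lt_le; intros N.
      assert (rho ^ 2 < Cmod w ^ 2); [|lra].
      simpl; nra. }
    assert (T := jet2_max _ _ _ _ _ J L).
    set (m := mu (f a)) in *; set (d := Cmod (df a)) in *; set (s := rho ^ 2 - Cmod a ^ 2) in *.
    assert (T2 : 4 * m ^ 2 * d ^ 2 <= 4 * rho ^ 2 / s ^ 2).
    { assert (0 <= d ^ 2) by (apply pow_le; lra); nra. }
    apply Rle_div_r in T2; [|apply pow_lt, P3].
    apply Rnot_lt_le; intros N.
    change (F a) with (m * d * s) in N.
    assert (rho * rho < (m * d * s) * (m * d * s)) by (apply Rmult_le_0_lt_compat; lra).
    simpl in T2; lra.
Qed.

Lemma ahlfors (G : C -> Prop) (mu : C -> R) (f df : C -> C) :
  curved_metric G mu ->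
  (forall z, unit_disk z -> is_derive f z (df z)) ->
  (forall z, unit_disk z -> G (f z)) ->
  forall z, unit_disk z -> mu (f z) * Cmod (df z) <= lambda_disk z.
Proof.
  intros Hmu Hf HG z Hz; unfold unit_disk in Hz; assert (Hz0 := Cmod_ge_0 z).
  set (t := Cmod z ^ 2); set (X := mu (f z) * Cmod (df z)).
  assert (Ht : 0 <= t < 1) by (unfold t; simpl; nra).
  unfold lambda_disk; fold t X; apply (Rle_div_r X 1 (1 - t)); [lra|].
  apply Rnot_lt_le; intros N.
  assert (HX : 0 < X) by nra.
  assert (HI : / X < 1 - t).
  { apply (Rmult_lt_reg_l X); [exact HX|]; rewrite Rinv_r by lra; exact N. }
  assert (HI0 : 0 < / X) by (apply Rinv_0_lt_compat, HX).
  (* the estimate for the radius [sqrt s] fails at [z] *)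
  set (s := (t + / X + 1) / 2).
  assert (Hs : t + / X < s < 1) by (unfold s; lra).
  assert (Hq : 0 < sqrt s < 1).
  { split; [apply sqrt_lt_R0; lra|]; rewrite <- sqrt_1; apply sqrt_lt_1; lra. }
  assert (Es : sqrt s ^ 2 = s) by (simpl; rewrite Rmult_1_r; apply sqrt_sqrt; lra).
  assert (Hzs : Cmod z <= sqrt s).
  { apply Rsqr_incr_0; [|exact Hz0|lra]; unfold Rsqr, t in *; simpl in *; lra. }
  assert (A := ahlfors_radius G mu f df (sqrt s) Hmu Hf HG Hq z Hzs).
  rewrite Es in A; fold t in A; fold X in A.
  assert (B : X * (/ X) < X * (s - t)) by (apply Rmult_lt_compat_l; lra).
  rewrite Rinv_r in B by lra; lra.
Qed.

(** * The hyperbolic metric *)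

Lemma is_derive_inverse (p q : C -> C) (u l : C) :
  is_derive p (q u) l -> l <> RtoC 0 -> continuous q u ->
  locally u (fun v => p (q v) = v) -> is_derive q u (/ l)%C.
Proof.
  intros Hp Hl Hq Hpq; assert (El := locally_singleton _ _ Hpq); simpl in El.
  assert (Hm : 0 < Cmod l) by (apply Cmod_gt_0, Hl).
  apply is_derive_C_eps; intros eps He.
  set (e1 := Rmin (Cmod l / 2) (eps * Cmod l ^ 2 / 2)).
  assert (Hm2 : 0 < Cmod l ^ 2) by (apply pow_lt, Hm).
  assert (He1 : 0 < e1) by (apply Rmin_pos; nra).
  destruct (proj1 (is_derive_C_eps _ _ _) Hp e1 He1) as [d [Hd H1]].
  assert (H2 := proj1 (continuous_C_iff _ _) Hq d Hd).
  assert (H3 := locally_and _ _ _ H2 Hpq); apply locally_Cmod in H3.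
  destruct H3 as [d2 [Hd2 H3]]; exists d2; split; [exact Hd2|]; intros v Hv.
  destruct (H3 v Hv) as [B1 B2].
  assert (A := H1 (q v) B1); rewrite B2, El in A.
  set (x := (q v - q u)%C) in *; set (y := (v - u)%C) in *.
  assert (A1 := Cmod_triangle_rev (x * l) y); rewrite Cmod_minus_sym, Cmod_mult in A1.
  assert (Hx := Cmod_ge_0 x).
  assert (E1 : e1 <= Cmod l / 2) by apply Rmin_l.
  assert (E2 : e1 <= eps * Cmod l ^ 2 / 2) by apply Rmin_r.
  assert (A2 : Cmod x * Cmod l <= 2 * Cmod y) by nra.
  replace (x - y * / l)%C with (- ((y - x * l) / l))%C by (field; exact Hl).
  rewrite Cmod_opp, Cmod_div by exact Hl.
  apply Rle_div_l; [exact Hm|].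
  eapply Rle_trans; [exact A|].
  apply Rle_trans with (eps * Cmod l ^ 2 / 2 * Cmod x); [apply Rmult_le_compat_r; lra|].
  replace (eps * Cmod l ^ 2 / 2 * Cmod x) with (eps * Cmod l / 2 * (Cmod x * Cmod l)) by field.
  replace (eps * Cmod y * Cmod l) with (eps * Cmod l / 2 * (2 * Cmod y)) by field.
  apply Rmult_le_compat_l; [nra | exact A2].
Qed.

Lemma lambda_disk_pos (z : C) : unit_disk z -> 0 < lambda_disk z.
Proof.
  intros Hz; unfold unit_disk in Hz; assert (P := Cmod_ge_0 z).
  apply Rdiv_lt_0_compat; [lra | simpl; nra].
Qed.

(** Locally [lam = (lambda_disk / |p'|) o q] for an inverse branch [q] of the covering,
    so the metric has the Laplacian of the metric of the disk, transported by [q]. *)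
Lemma hyperbolic_metric_jet2 (Omega : C -> Prop) (lam : C -> R) :
  hyperbolic_metric Omega lam ->
  forall w, Omega w -> 0 < lam w /\
    exists al be, jet2 (fun x => ln (lam x)) w al be (4 * lam w ^ 2).
Proof.
  intros [p [[Hhol [Hmap [Honto Hcov]]] Heq]] w Hw.
  assert (Hp : forall z, unit_disk z -> is_derive p z (C_derive p z)).
  { intros z Hz; apply C_derive_correct; [exact z | apply Hhol, Hz]. }
  assert (Hdp : forall z, unit_disk z -> is_derive (C_derive p) z (C_derive (C_derive p) z)).
  { intros z Hz; apply C_derive_correct; [exact z|].
    apply (holomorphic_derive p _ unit_disk unit_disk_open Hp z Hz). }
  assert (Hdp0 : forall z, unit_disk z -> 0 < Cmod (C_derive p z)).
  { intros z Hz; assert (A := Heq z Hz); assert (B := lambda_disk_pos z Hz).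
    destruct (Cmod_ge_0 (C_derive p z)) as [P|P]; [exact P|].
    rewrite <- P, Rmult_0_r in A; lra. }
  assert (Hlam : forall z, unit_disk z -> lam (p z) = lambda_disk z / Cmod (C_derive p z)).
  { intros z Hz; rewrite <- (Heq z Hz); field; apply Rgt_not_eq, Hdp0, Hz. }
  destruct (Honto w Hw) as [z [Hz Ez]].
  destruct (Hcov w Hw) as [U [HU [HUw [_ [I [V [_ [_ [HV Hhomeo]]]]]]]]].
  destruct (proj1 (HV z)) as [i Hi]; [split; [exact Hz | rewrite Ez; exact HUw]|].
  destruct (Hhomeo i) as [_ [q [Hq _]]].
  assert (Dq : forall u, U u -> unit_disk (q u)).
  { intros u Hu; apply (proj2 (HV (q u))); exists i; apply Hq, Hu. }
  assert (Hdq : forall u, U u -> is_derive q u (/ C_derive p (q u))%C).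
  { intros u Hu; apply (is_derive_inverse p).
    - apply Hp, Dq, Hu.
    - apply Cmod_gt_0, Hdp0, Dq, Hu.
    - apply Hq, Hu.
    - generalize (HU u Hu); apply filter_imp; intros v Hv; apply Hq, Hv. }
  assert (Hlq : forall u, U u -> lam u = lambda_disk (q u) / Cmod (C_derive p (q u))).
  { intros u Hu; rewrite <- Hlam by (apply Dq, Hu); f_equal; symmetry; apply Hq, Hu. }
  assert (Hpos : forall u, U u -> 0 < 1 - Cmod (q u) ^ 2).
  { intros u Hu; assert (A := Dq u Hu); unfold unit_disk in A.
    assert (B := Cmod_ge_0 (q u)); simpl; nra. }
  split.
  { rewrite (Hlq w HUw); apply Rdiv_lt_0_compat; [apply lambda_disk_pos | apply Hdp0];
      apply Dq, HUw. }
  destruct (jet2_ln_disk (q w) 1) as [al1 [be1 J1]]; [assert (A := Hpos w HUw); lra|].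
  destruct (jet2_ln_Cmod_holomorphic (C_derive p) _ unit_disk (q w) unit_disk_open Hdp
    (Dq w HUw)) as [al2 [be2 J2]]; [apply Cmod_gt_0, Hdp0, Dq, HUw|].
  assert (J := jet2_plus _ _ _ _ _ _ _ _ _ (jet2_scal _ _ _ _ _ (-1) J1)
    (jet2_scal _ _ _ _ _ (-1) J2)).
  destruct (jet2_comp_holomorphic _ q (fun u => / C_derive p (q u))%C U w _ _ _ HU Hdq HUw J)
    as [be J'].
  eexists; exists be.
  apply (jet2_ext_loc (fun u => -1 * ln (1 - Cmod (q u) ^ 2) +
    -1 * ln (Cmod (C_derive p (q u))))).
  { generalize (HU w HUw); apply filter_imp; intros u Hu.
    rewrite (Hlq u Hu); unfold lambda_disk.
    assert (A := Hpos u Hu); assert (B := Hdp0 (q u) (Dq u Hu)).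
    rewrite ln_div, ln_div, ln_1; try assumption; try lra.
    apply Rdiv_lt_0_compat; lra. }
  eapply jet2_eq; [reflexivity | reflexivity | | exact J'].
  rewrite (Hlq w HUw); unfold lambda_disk.
  assert (A := Hpos w HUw); assert (B := Hdp0 (q w) (Dq w HUw)).
  rewrite Cmod_inv by (apply Cmod_gt_0, B); simpl; field; simpl in A; lra.
Qed.

Lemma hyperbolic_metric_curved (Omega : C -> Prop) (lam : C -> R) :
  open Omega -> hyperbolic_metric Omega lam -> curved_metric Omega lam.
Proof.
  intros HO Hh w Hw; destruct (hyperbolic_metric_jet2 Omega lam Hh w Hw) as [P [al [be J]]].
  split; [lra|]; split.
  - apply (continuous_ext_loc _ (fun x => exp (ln (lam x)))).
    + generalize (HO w Hw); apply filter_imp; intros x Hx.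
      apply exp_ln; apply (hyperbolic_metric_jet2 Omega lam Hh x Hx).
    + apply (continuous_comp (fun x => ln (lam x)) exp); [exact (jet2_continuous _ _ _ _ _ J)|].
      apply continuous_exp.
  - intros _; exists al, be; eexists; split; [exact J | lra].
Qed.

(** * The punctured disk around an isolated boundary point *)

(** An infinite infimum is excluded since its real part is 0. *)
Lemma dist_set_le (E : C -> Prop) (w : C) :
  0 < dist_set 0 E -> E w -> dist_set 0 E <= Cmod w.
Proof.
  unfold dist_set; intros Hp Hw.
  destruct (Glb_Rbar_correct (fun d => exists w, E w /\ d = Cmod (w - RtoC 0))) as [Hlb _].
  assert (A := Hlb (Cmod (w - RtoC 0)) (ex_intro _ w (conj Hw eq_refl))).
  replace (w - RtoC 0)%C with w in A by ring.
  destruct (Glb_Rbar _); simpl in *; lra.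
Qed.

Lemma not_boundary_locally (S : C -> Prop) (z : C) :
  ~ boundary S z -> locally z S \/ locally z (fun w => ~ S w).
Proof.
  intros H; apply NNPP; intros N; apply H; split; intros P HP; apply NNPP; intros N1; apply N.
  - right; generalize HP; apply filter_imp; intros w Hw HS; apply N1; exists w; auto.
  - left; generalize HP; apply filter_imp; intros w Hw; apply NNPP; intros HS; apply N1.
    exists w; auto.
Qed.

(** The indicator function of [S] is locally constant along a segment without boundary
    points, hence has derivative 0. *)
Lemma seg_not_boundary (S : C -> Prop) (a b : C) :
  (forall t, 0 <= t <= 1 -> ~ boundary S (seg a b t)) -> S a -> S b.
Proof.
  intros Hb Ha.
  set (g := fun t => if excluded_middle_informative (S (seg a b t)) then 1 else 0).
  assert (E : g 0 = g 1).
  { apply (eq_is_derive (V := R_NormedModule) g 0 1); [|lra]; intros t Ht.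
    assert (L : exists k, locally t (fun s => k = g s)).
    { destruct (not_boundary_locally S _ (Hb t Ht)) as [L|L];
        assert (L1 := continuous_seg a b t _ L); unfold filtermap in L1; simpl in L1.
      - exists 1; generalize L1; apply filter_imp; intros s Hs; unfold g.
        destruct (excluded_middle_informative _); [reflexivity | contradiction].
      - exists 0; generalize L1; apply filter_imp; intros s Hs; unfold g.
        destruct (excluded_middle_informative _); [contradiction | reflexivity]. }
    destruct L as [k L].
    apply (is_derive_ext_loc (V := R_NormedModule) (fun _ => k) g t _ L).
    apply (is_derive_const (V := R_NormedModule)). }
  unfold g in E.
  replace (seg a b 0) with a in E by (unfold seg; ring).
  replace (seg a b 1) with b in E by (unfold seg; ring).
  destruct (excluded_middle_informative (S a)) as [|N]; [|contradiction].
  destruct (excluded_middle_informative (S b)) as [HS|]; [exact HS | lra].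
Qed.

(** A segment through 0 is replaced by two segments via [i * a]. *)
Lemma punctured_disk_subset (Omega : C -> Prop) (R0 : R) :
  open Omega -> boundary Omega 0 -> 0 < R0 ->
  (forall w, boundary Omega w -> w <> RtoC 0 -> R0 <= Cmod w) ->
  forall z, 0 < Cmod z < R0 -> Omega z.
Proof.
  intros HO [B1 B2] HR Hd.
  assert (H0 : ~ Omega 0).
  { intros H; destruct (B2 Omega (HO _ H)) as [w [W1 W2]]; contradiction. }
  destruct (B1 (fun w => Cmod (w - 0) < R0) (locally_Cmod_lt 0 R0 HR)) as [a [A1 A2]].
  replace (a - 0)%C with a in A1 by ring.
  assert (Ha0 : a <> RtoC 0) by (intros E; apply H0; rewrite <- E; exact A2).
  assert (step : forall p q, Cmod p < R0 -> Cmod q < R0 ->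
    (forall t, 0 <= t <= 1 -> seg p q t <> RtoC 0) -> Omega p -> Omega q).
  { intros p q Hp Hq Hpq; apply seg_not_boundary; intros t Ht Hb.
    assert (A := Hd _ Hb (Hpq t Ht)).
    assert (B := Cmod_seg_lt p q 0 t R0 Ht).
    unfold Cminus in B; rewrite Copp_0, !Cplus_0_r in B; specialize (B Hp Hq); lra. }
  intros z [Hz0 Hz]; apply Cmod_gt_0 in Hz0.
  destruct (classic (exists t, 0 <= t <= 1 /\ seg a z t = RtoC 0)) as [[t [Ht Et]]|N].
  2: { apply (step a z A1 Hz); [|exact A2]; intros t Ht E; apply N; exists t; auto. }
  assert (Ht0 : t <> 0).
  { intros ->; apply Ha0; rewrite <- Et; unfold seg; ring. }
  set (k := (1 - t) / t).
  assert (Ez : z = (- (RtoC k * a))%C).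
  { transitivity ((seg a z t - RtoC (1 - t) * a) / RtoC t)%C.
    - unfold seg; rewrite RtoC_minus; field; intros E; apply RtoC_inj in E; contradiction.
    - rewrite Et; unfold k; rewrite RtoC_div by exact Ht0; field.
      intros E; apply RtoC_inj in E; contradiction. }
  assert (Hk : k <> 0).
  { intros E; apply Hz0; rewrite Ez, E; ring. }
  assert (Hia : Cmod (Ci * a) < R0) by (rewrite Cmod_mult, Cmod_Ci; lra).
  assert (zero : forall x y : R, ((x, y) * a)%C = RtoC 0 -> x = 0 /\ y = 0).
  { intros x y E; assert (E1 : ((x, y) : C) = RtoC 0).
    { replace ((x, y) : C) with ((x, y) * a / a)%C by (field; exact Ha0); rewrite E; field.
      exact Ha0. }
    inversion E1; auto. }
  apply (step (Ci * a)%C z Hia Hz).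
  - intros s Hs E.
    destruct (zero (- (s * k)) (1 - s)) as [Z1 Z2].
    { rewrite <- E, Ez; unfold seg; apply injective_projections; simpl; ring. }
    assert (s = 1) by lra; subst s; lra.
  - apply (step a (Ci * a)%C A1 Hia); [|exact A2].
    intros s Hs E; destruct (zero (1 - s) s) as [Z1 Z2]; [|lra].
    rewrite <- E; unfold seg; apply injective_projections; simpl; ring.
Qed.

(** * The complex exponential and the metric of the punctured disk *)

Definition cexp (z : C) : C := (RtoC (exp (Re z)) * expi 1 (Im z))%C.

Lemma cexp_plus (z w : C) : cexp (z + w) = (cexp z * cexp w)%C.
Proof.
  unfold cexp; rewrite re_plus, im_plus, exp_plus, RtoC_mult.
  unfold expi; rewrite !Rmult_1_l, cos_plus, sin_plus.
  apply injective_projections; simpl; ring.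
Qed.

Lemma Cmod_cexp (z : C) : Cmod (cexp z) = exp (Re z).
Proof.
  unfold cexp; rewrite Cmod_mult, Cmod_expi, Cmod_R, Rabs_pos_eq; [ring|].
  apply Rlt_le, exp_pos.
Qed.

Lemma is_derive_cexp (z : C) : is_derive cexp z (cexp z).
Proof.
  assert (E0 : cexp 0 = RtoC 1).
  { unfold cexp, expi; simpl; rewrite exp_0, Rmult_0_r, cos_0, sin_0.
    apply injective_projections; simpl; ring. }
  assert (Te : taylor2 exp 0 (exp 0) 1).
  { apply (taylor2_derive exp exp 0 1 1 Rlt_0_1).
    - intros x _; apply is_derive_exp.
    - assert (D := is_derive_exp 0); rewrite exp_0 in D; exact D. }
  assert (Tc : taylor2 cos 0 (- sin 0) (-1)).
  { apply (taylor2_derive cos (fun x => - sin x) 0 (-1) 1 Rlt_0_1).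
    - intros x _; auto_derive; [trivial | ring].
    - auto_derive; [trivial | rewrite cos_0; ring]. }
  assert (Ts : taylor2 sin 0 (cos 0) 0).
  { apply (taylor2_derive sin cos 0 0 1 Rlt_0_1).
    - intros x _; auto_derive; [trivial | ring].
    - auto_derive; [trivial | rewrite sin_0; ring]. }
  rewrite exp_0 in Te; rewrite sin_0 in Tc; rewrite cos_0 in Ts.
  assert (He := Te 1 Rlt_0_1); assert (Hc := Tc 1 Rlt_0_1); assert (Hs := Ts 1 Rlt_0_1).
  apply locally_R in He; destruct He as [d1 [D1 He]].
  apply locally_R in Hc; destruct Hc as [d2 [D2 Hc]].
  apply locally_R in Hs; destruct Hs as [d3 [D3 Hs]].
  set (d := Rmin 1 (Rmin d1 (Rmin d2 d3))).
  assert (Hd : 0 < d) by (unfold d; repeat apply Rmin_pos; lra).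
  assert (small : forall h : C, Cmod h < d -> Cmod (cexp h - 1 - h) <= 40 * Cmod h ^ 2).
  { intros [x y] Hh.
    assert (M := Rmax_Cmod (x, y)); simpl in M.
    assert (Mx := Rmax_l (Rabs x) (Rabs y)); assert (My := Rmax_r (Rabs x) (Rabs y)).
    assert (Q1 : d <= 1) by apply Rmin_l.
    assert (Q2 : d <= d1) by (unfold d; eapply Rle_trans; [apply Rmin_r | apply Rmin_l]).
    assert (Q3 : d <= d2) by (unfold d; eapply Rle_trans; [apply Rmin_r|];
      eapply Rle_trans; [apply Rmin_r | apply Rmin_l]).
    assert (Q4 : d <= d3) by (unfold d; eapply Rle_trans; [apply Rmin_r|];
      eapply Rle_trans; [apply Rmin_r | apply Rmin_r]).
    set (n := Cmod (x, y)) in *.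
    assert (A1 := He x ltac:(rewrite Rminus_0_r; lra)).
    assert (A2 := Hc y ltac:(rewrite Rminus_0_r; lra)).
    assert (A3 := Hs y ltac:(rewrite Rminus_0_r; lra)).
    rewrite exp_0 in A1; rewrite cos_0 in A2; rewrite sin_0 in A3.
    rewrite !Rminus_0_r in A1, A2, A3.
    assert (X2 : x ^ 2 <= n ^ 2)
      by (rewrite <- (pow2_abs x); apply pow_incr; split; [apply Rabs_pos | lra]).
    assert (Y2 : y ^ 2 <= n ^ 2)
      by (rewrite <- (pow2_abs y); apply pow_incr; split; [apply Rabs_pos | lra]).
    assert (XY : Rabs x * Rabs y <= n ^ 2).
    { simpl; rewrite Rmult_1_r; apply Rmult_le_compat; try apply Rabs_pos; lra. }
    assert (n0 : 0 <= n) by apply Cmod_ge_0.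
    assert (n2 : n ^ 2 <= n) by (simpl; nra).
    assert (B1 : Rabs (exp x - 1 - x) <= 2 * n ^ 2).
    { apply Rabs_le_between in A1; apply Rabs_le_between; simpl in *; nra. }
    assert (B2 : Rabs (cos y - 1) <= 2 * n ^ 2).
    { apply Rabs_le_between in A2; apply Rabs_le_between; simpl in *; nra. }
    assert (B3 : Rabs (sin y - y) <= 2 * n ^ 2).
    { apply Rabs_le_between in A3; apply Rabs_le_between; simpl in *; nra. }
    assert (B4 : Rabs (exp x - 1) <= 2 * n ^ 2 + Rabs x).
    { replace (exp x - 1) with ((exp x - 1 - x) + x) by ring.
      eapply Rle_trans; [apply Rabs_triang | lra]. }
    assert (B5 : 0 <= exp x <= 4).
    { split; [apply Rlt_le, exp_pos|]; apply Rabs_le_between in B4; lra. }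
    replace (cexp (x, y) - 1 - (x, y))%C with
      (RtoC (exp x * (cos y - 1) + (exp x - 1 - x)) +
       Ci * RtoC (exp x * (sin y - y) + (exp x - 1) * y))%C
      by (unfold cexp, expi; rewrite !Rmult_1_l; apply injective_projections; simpl; ring).
    eapply Rle_trans; [apply Cmod_triangle|].
    rewrite Cmod_mult, Cmod_Ci, !Cmod_R, Rmult_1_l.
    assert (F1 : Rabs (exp x * (cos y - 1) + (exp x - 1 - x)) <= 10 * n ^ 2).
    { eapply Rle_trans; [apply Rabs_triang|]; rewrite Rabs_mult, (Rabs_pos_eq (exp x)) by lra.
      assert (Z := Rabs_pos (cos y - 1)); nra. }
    assert (F2 : Rabs (exp x * (sin y - y) + (exp x - 1) * y) <= 11 * n ^ 2).
    { eapply Rle_trans; [apply Rabs_triang|]; rewrite !Rabs_mult, (Rabs_pos_eq (exp x)) by lra.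
      assert (Z := Rabs_pos (sin y - y)); assert (Z2 := Rabs_pos y).
      assert (Rabs (exp x - 1) * Rabs y <= 2 * n ^ 2 * Rabs y + Rabs x * Rabs y) by nra.
      nra. }
    assert (0 <= n ^ 2) by (apply pow_le, n0); lra. }
  apply is_derive_C_eps; intros eps Heps.
  assert (Hm : 0 < 40 * (Cmod (cexp z) + 1)) by (assert (P := Cmod_ge_0 (cexp z)); lra).
  exists (Rmin d (eps / (40 * (Cmod (cexp z) + 1)))); split.
  { apply Rmin_pos; [exact Hd | apply Rdiv_lt_0_compat; lra]. }
  intros w Hw.
  assert (W1 := small (w - z)%C (Rlt_le_trans _ _ _ Hw (Rmin_l _ _))).
  assert (W2 := Rlt_le_trans _ _ _ Hw (Rmin_r _ _)); apply Rlt_div_r in W2; [|exact Hm].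
  replace (cexp w) with (cexp z * cexp (w - z))%C by (rewrite <- cexp_plus; f_equal; ring).
  replace (_ - _ - _)%C with (cexp z * (cexp (w - z) - 1 - (w - z)))%C by ring.
  rewrite Cmod_mult; assert (P := Cmod_ge_0 (cexp z)); assert (P2 := Cmod_ge_0 (w - z)).
  apply Rle_trans with (Cmod (cexp z) * (40 * Cmod (w - z) ^ 2));
    [apply Rmult_le_compat_l; lra|].
  replace (Cmod (cexp z) * (40 * Cmod (w - z) ^ 2)) with
    ((Cmod (w - z) * (40 * Cmod (cexp z))) * Cmod (w - z)) by ring.
  apply Rmult_le_compat_r; lra.
Qed.

Lemma is_derive_Cdiv_one_minus (z : C) :
  z <> RtoC 1 -> is_derive (fun w => w / (1 - w))%C z (/ ((1 - z) * (1 - z)))%C.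
Proof.
  intros Hz.
  assert (Hz1 : (1 - z)%C <> RtoC 0).
  { intros E; apply Hz; replace z with (RtoC 1 - (1 - z))%C by ring; rewrite E; ring. }
  set (m := Cmod (1 - z)); assert (Hm : 0 < m) by (apply Cmod_gt_0, Hz1).
  apply is_derive_C_eps; intros eps He.
  assert (Hm3 : 0 < eps * m ^ 3 / 2) by (assert (P := pow_lt m 3 Hm); nra).
  exists (Rmin (m / 2) (eps * m ^ 3 / 2)); split; [apply Rmin_pos; lra|]; intros w Hw.
  assert (W1 := Rlt_le_trans _ _ _ Hw (Rmin_l _ _)).
  assert (W2 := Rlt_le_trans _ _ _ Hw (Rmin_r _ _)).
  assert (Hw1 : m / 2 <= Cmod (1 - w)).
  { assert (A := Cmod_triangle_rev (1 - z) (w - z)).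
    replace (1 - z - (w - z))%C with (1 - w)%C in A by ring; fold m in A; lra. }
  assert (Hw2 : (1 - w)%C <> RtoC 0) by (apply Cmod_gt_0; lra).
  replace (_ - _ - _)%C with
    ((w - z) * (w - z) / ((1 - w) * ((1 - z) * (1 - z))))%C by (field; split; assumption).
  rewrite Cmod_div by (repeat apply Cmult_neq_0; assumption).
  rewrite !Cmod_mult; fold m.
  assert (Hp : 0 < Cmod (1 - w) * (m * m)) by (apply Rmult_lt_0_compat; nra).
  apply Rle_div_l; [exact Hp|].
  assert (P := Cmod_ge_0 (w - z)).
  assert (A : eps * m ^ 3 / 2 <= eps * (Cmod (1 - w) * (m * m))).
  { replace (eps * m ^ 3 / 2) with (eps * (m / 2 * (m * m))) by field.
    apply Rmult_le_compat_l; [lra|]; apply Rmult_le_compat_r; nra. }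
  nra.
Qed.

(** The map [x |-> z * exp (- 2 L x / (1 - x))], with [L = ln (R0 / |z|)], is the universal
    covering of the punctured disk of radius [R0] that takes 0 to [z]; it is [exp] composed
    with a conformal map of the disk onto a half-plane.  The lemma of Ahlfors is applied
    to it at the origin. *)
Lemma metric_le_punctured_disk (G : C -> Prop) (mu : C -> R) (R0 : R) :
  curved_metric G mu -> (forall z, 0 < Cmod z < R0 -> G z) ->
  forall z, 0 < Cmod z < R0 -> mu z * (2 * Cmod z * (ln R0 - ln (Cmod z))) <= 1.
Proof.
  intros Hmu HG z [Hz Hz1].
  set (L := ln R0 - ln (Cmod z)).
  assert (HL : 0 < L) by (unfold L; assert (A := ln_increasing _ _ Hz Hz1); lra).
  set (psi := fun x => (z * cexp (RtoC (- 2 * L) * (x / (1 - x))))%C).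
  set (dpsi := fun x => (z * ((RtoC (- 2 * L) * / ((1 - x) * (1 - x))) *
    cexp (RtoC (- 2 * L) * (x / (1 - x)))))%C).
  assert (H1 : forall x, unit_disk x -> x <> RtoC 1).
  { intros x Hx E; unfold unit_disk in Hx; rewrite E, Cmod_1 in Hx; lra. }
  assert (Hpsi : forall x, unit_disk x -> is_derive psi x (dpsi x)).
  { intros x Hx; apply is_derive_Cscal.
    apply (is_derive_Ccomp cexp (fun x => RtoC (- 2 * L) * (x / (1 - x)))%C).
    - apply is_derive_cexp.
    - apply is_derive_Cscal, is_derive_Cdiv_one_minus, H1, Hx. }
  assert (Hrange : forall x, unit_disk x -> G (psi x)).
  { intros x Hx; apply HG; unfold psi; rewrite Cmod_mult, Cmod_cexp.
    split; [apply Rmult_lt_0_compat; [exact Hz | apply exp_pos]|].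
    rewrite re_scal_l.
    assert (Hre : - / 2 < Re (x / (1 - x))).
    { assert (Hx2 : Cmod x ^ 2 < 1)
        by (unfold unit_disk in Hx; assert (P := Cmod_ge_0 x); simpl; nra).
      assert (Hn : (1 - x)%C <> RtoC 0).
      { intros E; apply (H1 x Hx); replace x with (RtoC 1 - (1 - x))%C by ring; rewrite E; ring. }
      apply Cmod2_pos in Hn; rewrite Cmod2_alt in Hx2, Hn.
      destruct x as [u v]; simpl in *.
      match goal with |- _ < ?e => replace e with
        ((u * (1 - u) - v * v) / ((1 + - u) * ((1 + - u) * 1) + (0 + - v) * ((0 + - v) * 1)))
        by (field; lra) end.
      apply Rlt_div_r; [lra | nra]. }
    assert (E : R0 = Cmod z * exp L).
    { unfold L; unfold Rminus; rewrite exp_plus, exp_Ropp, !exp_ln by lra; field; lra. }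
    rewrite E; apply Rmult_lt_compat_l; [exact Hz|]; apply exp_increasing; nra. }
  assert (A := ahlfors G mu psi dpsi Hmu Hpsi Hrange 0).
  assert (D0 : unit_disk 0) by (unfold unit_disk; rewrite Cmod_0; lra).
  specialize (A D0).
  assert (E0 : (0 / (1 - 0))%C = RtoC 0) by field.
  assert (Ec : cexp (RtoC (- 2 * L) * 0) = RtoC 1).
  { rewrite Cmult_0_r; unfold cexp, expi; simpl; rewrite exp_0, Rmult_0_r, cos_0, sin_0.
    apply injective_projections; simpl; ring. }
  assert (E1 : psi 0 = z) by (unfold psi; rewrite E0, Ec; ring).
  assert (E2 : Cmod (dpsi 0) = 2 * Cmod z * L).
  { unfold dpsi; rewrite E0, Ec.
    replace (z * (RtoC (- 2 * L) * / ((1 - 0) * (1 - 0)) * 1))%C with (z * RtoC (- 2 * L))%C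
      by field.
    rewrite Cmod_mult, Cmod_R, Rabs_left by lra; ring. }
  rewrite E1, E2 in A; unfold lambda_disk in A; rewrite Cmod_0 in A.
  replace (1 / (1 - 0 ^ 2)) with 1 in A by field; exact A.
Qed.

(** * The comparison near the puncture *)

(** With [y = c / (ln R0 - ln |z|)] the claim is [ln (lam / lamO) + y <= 0].  The function
    [y] tends to 0 at the puncture and satisfies [Delta y = 8 * lamR ^ 2 * y] for the
    metric [lamR] of the punctured disk of radius [R0], and [lamO <= lamR].  At a positive
    maximum of [ln (lam / lamO) + y] the Laplacian would be positive, because
    [lam ^ 2 / lamO ^ 2 >= 1 + 2 * ln (lam / lamO)]. *)
Lemma comparison (G : C -> Prop) (lam lamO : C -> R) (R0 r c : R) :
  curved_metric G lam ->
  (forall z, G z -> 0 < lamO z /\ continuous lamO z /\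
     exists al be, jet2 (fun w => ln (lamO w)) z al be (4 * lamO z ^ 2)) ->
  (forall z, 0 < Cmod z < R0 -> G z) ->
  (forall z, G z -> lam z <= lamO z) ->
  (forall z, 0 < Cmod z < R0 -> lamO z * (2 * Cmod z * (ln R0 - ln (Cmod z))) <= 1) ->
  0 < r < R0 -> 0 <= c ->
  (forall z, Cmod z = r -> lam z * exp (c * / (ln R0 - ln r)) <= lamO z) ->
  forall z, 0 < Cmod z < r -> lam z * exp (c * / (ln R0 - ln (Cmod z))) <= lamO z.
Proof.
  intros Hlam HO HG Hle HR Hr Hc Hcirc z Hz.
  set (y := fun w : C => c * / (ln R0 - ln (Cmod w))).
  set (H := fun w => lam w * / lamO w * exp (y w)).
  assert (HL : forall w, 0 < Cmod w < R0 -> 0 < ln R0 - ln (Cmod w)).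
  { intros w [W1 W2]; assert (A := ln_increasing _ _ W1 W2); lra. }
  assert (HGr : forall w, 0 < Cmod w <= r -> G w) by (intros w Hw; apply HG; lra).
  assert (Hiff : forall w, G w -> (lam w * exp (y w) <= lamO w <-> H w <= 1)).
  { intros w Hw; destruct (HO w Hw) as [P _]; unfold H.
    replace (lam w * / lamO w * exp (y w)) with (lam w * exp (y w) / lamO w) by (field; lra).
    rewrite (Rle_div_l (lam w * exp (y w)) 1 (lamO w)) by exact P; rewrite Rmult_1_l; tauto. }
  assert (Gz : G z) by (apply HG; lra).
  apply (proj2 (Hiff z Gz)), Rnot_lt_le; intros HN.
  (* close to the puncture [H] is smaller than [H z] since there [y < ln (H z)] *)
  set (l := ln (H z)).
  assert (Hl : 0 < l) by (unfold l; rewrite <- ln_1; apply ln_increasing; lra).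
  set (del := Rmin (Cmod z) (exp (ln R0 - (c + 1) / l))).
  assert (Hdel : 0 < del) by (apply Rmin_pos; [lra | apply exp_pos]).
  assert (Hdz : del <= Cmod z) by apply Rmin_l.
  assert (Hnear : forall w, Cmod w = del -> H w < H z).
  { intros w Hw; assert (W : 0 < Cmod w < R0) by lra.
    destruct (HO w (HG w W)) as [P _]; assert (Q := Hle w (HG w W)).
    destruct (Hlam w (HG w W)) as [Q0 _].
    assert (E : ln (Cmod w) <= ln R0 - (c + 1) / l).
    { rewrite Hw, <- (ln_exp (ln R0 - (c + 1) / l)); apply ln_le; [exact Hdel | apply Rmin_r]. }
    assert (Yl : y w < l).
    { unfold y; assert (A := HL w W).
      apply Rlt_div_l; [exact A|].
      assert (B : (c + 1) / l * l = c + 1) by (field; lra); nra. }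
    apply Rle_lt_trans with (1 * exp (y w)).
    - apply Rmult_le_compat_r; [apply Rlt_le, exp_pos|].
      apply (Rle_div_l (lam w) 1 (lamO w)); lra.
    - rewrite Rmult_1_l; rewrite <- (exp_ln (H z)) by lra; apply exp_increasing, Yl. }
  assert (Hy : forall w, 0 < Cmod w < R0 -> exists al be,
    jet2 y w al be (c * (2 / (Cmod w ^ 2 * (ln R0 - ln (Cmod w)) ^ 3)))).
  { intros w Hw; destruct (jet2_inv_log w (ln R0)) as [al [be J]].
    - apply Cmod_gt_0; lra.
    - assert (A := HL w Hw); lra.
    - eexists; eexists; exact (jet2_scal _ _ _ _ _ c J). }
  destruct (continuous_max_closed H (fun w => del <= Cmod w <= r) r) as [a [[Ha1 Ha2] Hmax]].
  - exists z; lra.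
  - intros w Hw; lra.
  - intros w Hw; split; apply le_epsilon; intros eps He; destruct (Hw eps He) as [x [H1 H2]];
      assert (A := Cmod_triangle_rev w x); assert (B := Cmod_triangle_rev x w);
      rewrite (Cmod_minus_sym w x) in A; lra.
  - intros w Hw; assert (Gw := HGr w ltac:(lra)).
    destruct (HO w Gw) as [P [Q _]]; destruct (Hlam w Gw) as [_ [Q2 _]].
    destruct (Hy w ltac:(lra)) as [al [be J]].
    apply (continuous_mult (K := R_AbsRing)); [apply (continuous_mult (K := R_AbsRing))|].
    + exact Q2.
    + apply (continuous_comp lamO Rinv); [exact Q|].
      apply continuous_Rinv; lra.
    + apply (continuous_comp y exp); [exact (jet2_continuous _ _ _ _ _ J) | apply continuous_exp].
  - assert (HHa : H z <= H a) by (apply Hmax; lra).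
    assert (Gd : 0 < Cmod a < R0) by lra.
    assert (Ga := HG a Gd).
    assert (Hint : del < Cmod a < r).
    { split.
      - destruct Ha1 as [Ha1|Ha1]; [exact Ha1|]; assert (A := Hnear a (eq_sym Ha1)); lra.
      - destruct Ha2 as [Ha2|Ha2]; [exact Ha2|].
        assert (A := Hcirc a Ha2); rewrite <- Ha2 in A; apply (proj1 (Hiff a Ga)) in A; lra. }
    destruct (HO a Ga) as [P [PC [al2 [be2 J2]]]]; destruct (Hlam a Ga) as [Q0 [QC QJ]].
    assert (Q : 0 < lam a).
    { destruct Q0 as [Q0|Q0]; [exact Q0|]; unfold H in HHa at 2; rewrite <- Q0 in HHa; lra. }
    destruct (QJ Q) as [al1 [be1 [tau [J1 Ht]]]].
    destruct (Hy a Gd) as [al3 [be3 J3]].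
    assert (J := jet2_plus _ _ _ _ _ _ _ _ _
      (jet2_plus _ _ _ _ _ _ _ _ _ J1 (jet2_scal _ _ _ _ _ (-1) J2)) J3).
    assert (HE : forall w, G w -> 0 < lam w ->
      ln (H w) = ln (lam w) + -1 * ln (lamO w) + y w /\ 0 < H w).
    { intros w Gw Pw; destruct (HO w Gw) as [P' _].
      assert (Pi : 0 < / lamO w) by (apply Rinv_0_lt_compat, P').
      assert (Pe := exp_pos (y w)).
      assert (Pm : 0 < lam w * / lamO w) by (apply Rmult_lt_0_compat; assumption).
      unfold H; split; [|apply Rmult_lt_0_compat; assumption].
      rewrite !ln_mult, ln_Rinv, ln_exp by assumption; ring. }
    assert (T : tau + -1 * (4 * lamO a ^ 2) +
      c * (2 / (Cmod a ^ 2 * (ln R0 - ln (Cmod a)) ^ 3)) <= 0).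
    { apply (jet2_max _ _ _ _ _ J).
      assert (L1 : locally a (fun w => 0 < lam w)).
      { generalize (proj1 (continuous_R_iff _ _) QC (lam a) Q); apply filter_imp.
        intros w Hw; apply Rabs_lt_between in Hw; lra. }
      assert (L2 : locally a (fun w => del <= Cmod w <= r)).
      { generalize (locally_Cmod_lt a (Rmin (Cmod a - del) (r - Cmod a))
          ltac:(apply Rmin_pos; lra)).
        apply filter_imp; intros w Hw.
        assert (W1 := Rlt_le_trans _ _ _ Hw (Rmin_l _ _)).
        assert (W2 := Rlt_le_trans _ _ _ Hw (Rmin_r _ _)).
        assert (A := Cmod_triangle_rev w a); assert (B := Cmod_triangle_rev a w).
        rewrite (Cmod_minus_sym a w) in B; lra. }
      generalize (locally_and _ _ _ L1 L2); apply filter_imp; intros w [W1 W2].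
      destruct (HE w (HGr w ltac:(lra)) W1) as [E1 E1']; destruct (HE a Ga Q) as [E2 _].
      rewrite <- E1, <- E2; apply ln_le; [exact E1' | apply Hmax, W2]. }
    destruct (HE a Ga Q) as [E _].
    assert (El : l <= ln (H a)) by (apply ln_le; lra).
    rewrite E in El.
    assert (B := HR a Gd); assert (PL := HL a Gd).
    change (y a) with (c * / (ln R0 - ln (Cmod a))) in El.
    set (L := ln R0 - ln (Cmod a)) in *.
    set (t := ln (lam a) + -1 * ln (lamO a)) in *; set (v := c * / L) in *.
    set (m := lamO a) in *; set (n := Cmod a) in *.
    assert (Hv : 0 <= v) by (apply Rmult_le_pos; [exact Hc | apply Rlt_le, Rinv_0_lt_compat, PL]).
    assert (F1 : m ^ 2 * (1 + 2 * t) <= lam a ^ 2).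
    { assert (A := exp_ineq1_le (2 * t)).
      assert (X : lam a = m * exp t).
      { unfold t; rewrite exp_plus, exp_ln by exact Q.
        replace (-1 * ln m) with (- ln m) by ring; rewrite exp_Ropp, exp_ln by exact P.
        field; lra. }
      rewrite X, Rpow_mult_distr; apply Rmult_le_compat_l; [apply pow_le; lra|].
      simpl; rewrite Rmult_1_r, <- exp_plus; replace (t + t) with (2 * t) by ring; lra. }
    set (k := / (n * L)).
    assert (Hk : 2 * m <= k).
    { apply (Rle_div_r (2 * m) 1 (n * L)) in B || idtac.
      unfold k; rewrite <- (Rmult_1_l (/ (n * L))); apply (Rle_div_r (2 * m) 1 (n * L)).
      - apply Rmult_lt_0_compat; lra.
      - lra. }
    assert (F2 : c * (2 / (n ^ 2 * L ^ 3)) = 2 * k ^ 2 * v) by (unfold k, v; field; lra).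
    rewrite F2 in T.
    assert (F3 : 4 * m ^ 2 <= k ^ 2).
    { replace (4 * m ^ 2) with ((2 * m) ^ 2) by ring; apply pow_incr; lra. }
    assert (Pm2 : 0 < m ^ 2) by (apply pow_lt, P).
    assert (F4 : 4 * m ^ 2 * v <= k ^ 2 * v) by (apply Rmult_le_compat_r; lra).
    assert (F5 : 0 < m ^ 2 * (t + v)) by (apply Rmult_lt_0_compat; lra).
    lra.
Qed.

Lemma circle_max (f : C -> R) (r : R) :
  0 < r -> (forall z, Cmod z = r -> continuous f z) ->
  exists a, Cmod a = r /\ forall z, Cmod z = r -> f z <= f a.
Proof.
  intros Hr Hf; apply (continuous_max_closed f (fun z => Cmod z = r) r); [| | |exact Hf].
  - exists (RtoC r); rewrite Cmod_R, Rabs_pos_eq; lra.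
  - intros z Hz; lra.
  - intros w Hw; apply Rle_antisym; apply le_epsilon; intros eps He;
      destruct (Hw eps He) as [x [H1 H2]];
      assert (A := Cmod_triangle_rev w x); assert (B := Cmod_triangle_rev x w);
      rewrite (Cmod_minus_sym w x) in A; lra.
Qed.

Theorem theorem4p1 :
  forall (Omega : C -> Prop) (lam lamOmega : C -> R),
    hyperbolic_domain Omega ->
    isolated_point (boundary Omega) (RtoC 0) ->
    conformal_pseudometric Omega lam ->
    curvature_le Omega lam (-4) ->
    hyperbolic_metric Omega lamOmega ->
    let R0 := dist_set (RtoC 0) (fun w => boundary Omega w /\ w <> RtoC 0) in
    forall r : R, 0 < r < R0 ->
    exists M : R,
      is_max (fun m => exists xi : C, Cmod xi = r /\ m = lam xi / lamOmega xi) M /\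
      forall z : C, 0 < Cmod z < r ->
        lam z <= nnpow M (C_exponent r R0 z) * lamOmega z /\
        C_exponent r R0 z < 1.
Proof.
  intros Omega lam lamO [_ [HOpen _]] [Hb0 _] Hpseudo Hcurv Hhyp R0 r Hr.
  assert (HG : forall z, 0 < Cmod z < R0 -> Omega z).
  { apply (punctured_disk_subset Omega R0 HOpen Hb0); [lra|]; intros w Hw Hw0.
    apply dist_set_le; [fold R0; lra | split; assumption]. }
  assert (Clam := pseudometric_curved Omega lam HOpen Hpseudo Hcurv).
  assert (ClamO := hyperbolic_metric_curved Omega lamO HOpen Hhyp).
  assert (JO : forall z, Omega z -> 0 < lamO z /\ continuous lamO z /\
     exists al be, jet2 (fun w => ln (lamO w)) z al be (4 * lamO z ^ 2)).
  { intros z Hz; destruct (hyperbolic_metric_jet2 Omega lamO Hhyp z Hz) as [P J].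
    split; [exact P|]; split; [apply ClamO, Hz | exact J]. }
  assert (Hle : forall z, Omega z -> lam z <= lamO z).
  { intros w Hw; destruct Hhyp as [p [[Hhol [Hmap [Honto _]]] Heq]].
    destruct (Honto w Hw) as [z [Hz <-]].
    assert (A := ahlfors Omega lam p (C_derive p) Clam
      (fun x Hx => C_derive_correct p x x (Hhol x Hx)) (fun x Hx => proj1 (Hmap x Hx)) z Hz).
    rewrite <- (Heq z Hz) in A; apply (Rmult_le_reg_r (Cmod (C_derive p z))); [|exact A].
    assert (B := lambda_disk_pos z Hz); rewrite <- (Heq z Hz) in B.
    destruct (Cmod_ge_0 (C_derive p z)) as [P|P]; [exact P|].
    rewrite <- P, Rmult_0_r in B; lra. }
  assert (HR := metric_le_punctured_disk Omega lamO R0 ClamO HG).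
  assert (Hcirc : forall w, Cmod w = r -> Omega w) by (intros w Hw; apply HG; lra).
  destruct (circle_max (fun w => lam w / lamO w) r) as [a [Ha Hmax]]; [lra| |].
  { intros w Hw; assert (Ow := Hcirc w Hw).
    destruct (JO w Ow) as [P [Q _]]; destruct (Clam w Ow) as [_ [Q2 _]].
    apply (continuous_mult (K := R_AbsRing)); [exact Q2|].
    apply (continuous_comp lamO Rinv); [exact Q | apply continuous_Rinv; lra]. }
  set (M := lam a / lamO a) in *.
  destruct (JO a (Hcirc a Ha)) as [Pa _].
  assert (HM : 0 <= M <= 1).
  { split.
    - apply Rle_div_r; [exact Pa|]; rewrite Rmult_0_l; apply Clam, Hcirc, Ha.
    - apply (Rle_div_l (lam a) 1 (lamO a)); [exact Pa|].
      rewrite Rmult_1_l; apply Hle, Hcirc, Ha. }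
  exists M; split.
  { split; [exists a; auto|]; intros x [xi [Hxi ->]]; apply Hmax, Hxi. }
  intros z Hz.
  set (S := ln R0 - ln r); set (L := ln R0 - ln (Cmod z)).
  assert (HS : 0 < S).
  { unfold S; assert (A := ln_increasing r R0 ltac:(lra) ltac:(lra)); lra. }
  assert (HSL : S < L).
  { unfold S, L; assert (A := ln_increasing (Cmod z) r ltac:(lra) ltac:(lra)); lra. }
  assert (EC : C_exponent r R0 z = S * / L).
  { unfold C_exponent, S, L; rewrite !ln_div by lra; field; unfold S, L in HS, HSL; lra. }
  assert (HC : 0 < C_exponent r R0 z < 1).
  { rewrite EC; split.
    - apply Rmult_lt_0_compat; [exact HS | apply Rinv_0_lt_compat; lra].
    - apply (Rlt_div_l S 1 L); lra. }
  split; [|lra].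
  assert (Oz : Omega z) by (apply HG; lra).
  destruct (JO z Oz) as [Pz _].
  assert (key : forall N, 0 < N <= 1 -> M <= N ->
    lam z <= Rpower N (C_exponent r R0 z) * lamO z).
  { intros N HN HMN.
    assert (HlnN : ln N <= 0) by (rewrite <- ln_1; apply ln_le; lra).
    assert (A := comparison Omega lam lamO R0 r (- ln N * S) Clam JO HG Hle HR Hr).
    assert (Hc : 0 <= - ln N * S) by (apply Rmult_le_pos; lra).
    specialize (A Hc).
    assert (B : forall w, Cmod w = r -> lam w * exp (- ln N * S * / (ln R0 - ln r)) <= lamO w).
    { intros w Hw; fold S.
      replace (- ln N * S * / S) with (- ln N) by (field; lra).
      rewrite exp_Ropp, exp_ln by lra.
      destruct (JO w (Hcirc w Hw)) as [Pw _].
      assert (D := Rle_trans _ _ _ (Hmax w Hw) HMN).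
      apply (Rle_div_l (lam w) N (lamO w) Pw) in D.
      apply (Rle_div_l (lam w) (lamO w) N); lra. }
    specialize (A B z Hz); fold L in A.
    unfold Rpower; rewrite EC.
    replace (- ln N * S * / L) with (- (S * / L * ln N)) in A by (field; lra).
    rewrite exp_Ropp in A.
    rewrite Rmult_comm.
    apply (Rle_div_l (lam z) (lamO z) (exp (S * / L * ln N)) (exp_pos _)) in A; exact A. }
  unfold nnpow; destruct (Rlt_dec 0 M) as [HM0|HM0].
  { apply key; lra. }
  (* if the maximum is 0, the bound holds for every positive number in its place *)
  rewrite Rmult_0_l; apply Rnot_lt_le; intros Hpos.
  (* [N] is so small that its power is at most half of [lam z / lamO z] *)
  set (X := lam z / (2 * lamO z)).
  assert (HX : 0 < X) by (apply Rdiv_lt_0_compat; lra).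
  set (N := Rmin 1 (Rpower X (/ C_exponent r R0 z))).
  assert (HN : 0 < N <= 1) by (split; [apply Rmin_pos; [lra | apply exp_pos] | apply Rmin_l]).
  assert (K := key N HN ltac:(lra)).
  assert (E : Rpower N (C_exponent r R0 z) <= X).
  { rewrite <- (Rpower_1 X HX), <- (Rinv_l (C_exponent r R0 z)), <- Rpower_mult by lra.
    apply Rle_Rpower_l; [lra|]; split; [lra | apply Rmin_r]. }
  assert (E2 : X * lamO z = lam z / 2) by (unfold X; field; lra).
  assert (Rpower N (C_exponent r R0 z) * lamO z <= X * lamO z)
    by (apply Rmult_le_compat_r; lra).
  lra.
Qed.
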